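(* Let $(X,\mu)$ be a probability space, $\phi$ an invertible measure preserving transformation of $X$, $M=L^\infty(X,\mu)\rtimes_{\alpha_\phi}\mathbb{Z}$ the crossed product, and $U\in M$ the canonical unitary implementing $\alpha_\phi$. Let $T=U|T|\in M$ be invertible and centered such that $|T|\in L^\infty(X,\mu)$. For $r\in[-1,1]\setminus\{0\}$, $\lambda\in(0,1)$ and $f_{r,\lambda}(x)=[1-\lambda+\lambda x^r]^{1/r}$, $$\lim_{n\to\infty}\bigl\|\Delta_{f_{r,\lambda}}^n(T)-UH\bigr\|_2=0,\qquad\text{where } H=\bigl(E^\phi(|T|^r)\bigr)^{1/r}.$$
   Context: The automorphism $\alpha_\phi$ of $L^\infty(X,\mu)$ is $\alpha_\phi(f)=f\circ\phi$. The crossed product $M=L^\infty(X,\mu)\rtimes_{\alpha_\phi}\mathbb{Z}$ is the von Neumann algebra on $L^2(X,\mu)\otimes\ell^2(\mathbb{Z})$ generated by the operators $(\pi(f)\xi)(n)=\alpha_\phi^{-n}(f)\xi(n)$, $f\in L^\infty(X,\mu)$, and the unitary $(U\xi)(n)=\xi(n-1)$; $f$ is identified with $\pi(f)$, and $UfU^*=\alpha_\phi(f)=f\circ\phi$. $\tau$ is the normal (tracial) state on $M$ with $\tau(U^kf)=\delta_{k,0}\int_Xf\,d\mu$ for $k\in\mathbb{Z}$, $f\in L^\infty(X,\mu)$, and $\|x\|_2=\tau(x^*x)^{1/2}$. $E^\phi$ is the $\mu$-preserving conditional expectation of $L^\infty(X,\mu)$ onto the subalgebra of $\phi$-invariant functions.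 The functions $f=f_{r,\lambda}$ are representing functions of operator means (power means): operator monotone on $(0,\infty)$ with $f(1)=1$. Induced Aluthge transformation: for an invertible operator $S$ with polar decomposition $S=W|S|$ and spectral decomposition $|S|=\int_{\sigma(|S|)}s\,dE_s$, define $\Delta_f(S):=\int_{\sigma(|S|)}\int_{\sigma(|S|)} s f(t/s)\,dE_s\,W\,dE_t$ (double operator integral). Concretely (known fact), if $\nu$ is a probability measure on $[0,1]$ with $f(x)=\int_0^1[1-\theta+\theta x^{-1}]^{-1}d\nu(\theta)$ for $x>0$ (such $\nu$ exists), then $\Delta_f(S)=\int_0^1\int_0^\infty e^{-(1-\theta)s|S|^{-1}}\,W\,e^{-\theta s|S|^{-1}}\,ds\,d\nu(\theta)$. Iterates: $\Delta_f^0(S)=S$, $\Delta_f^n(S)=\Delta_f(\Delta_f^{n-1}(S))$. $T=U|T|$ is centered if $\{U^{*m}|T|U^m,\ |T|,\ U^n|T|U^{*n}: n,m=1,2,\dots\}$ is a commuting set. *)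

(* Defs.v *)
From HB Require Import structures.
From mathcomp Require Import all_boot all_order all_algebra.
From mathcomp Require Import complex.
From mathcomp Require Import all_classical all_reals all_analysis.

Set Implicit Arguments.
Unset Strict Implicit.
Unset Printing Implicit Defensive.

Import Order.TTheory GRing.Theory Num.Theory.
Import numFieldNormedType.Exports.

Local Open Scope classical_set_scope.
Local Open Scope ring_scope.
Local Open Scope complex_scope.
Local Open Scope quotient_scope.

HB.instance Definition _ := isPointed.Build int 0.
HB.instance Definition _ := @isMeasurable.Build default_measure_display
  int discrete_measurable discrete_measurable0
  discrete_measurableC discrete_measurableU.

Section ComplexFunctions.
Context d (T : measurableType d) (R : realType).

Definition cmeasurable (f : T -> R[i]) : Prop :=
  measurable_fun setT (fun x => complex.Re (f x)) /\
  measurable_fun setT (fun x => complex.Im (f x)).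

Definition cintegral (m : set T -> \bar R) (f : T -> R[i]) : R[i] :=
  (fine (\int[m]_x (complex.Re (f x))%:E)%E)
  +i* (fine (\int[m]_x (complex.Im (f x))%:E)%E).

Definition Linf (m : {measure set T -> \bar R}) (f : T -> R[i]) : Prop :=
  cmeasurable f /\ exists K : R, {ae m, forall x, `|f x| <= K%:C}.

Definition square_integrable (m : {measure set T -> \bar R}) :
    pred (T -> R[i]) := fun f =>
  ((fun x => complex.Re (f x)) \in Lfun m 2%:E) &&
  ((fun x => complex.Im (f x)) \in Lfun m 2%:E).

End ComplexFunctions.

Section L2.
Context d (T : measurableType d) (R : realType).
Variable m : {measure set T -> \bar R}.
Local Notation C := R[i].

Definition L2fun := {f : T -> C | square_integrable m f}.

Definition L2eq (f g : L2fun) : bool := `[< \val f = \val g %[ae m] >].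

Let L2eq_refl : reflexive L2eq.
Proof. by move=> f; apply/asboolP; exact: ae_eq_refl. Qed.

Let L2eq_sym : symmetric L2eq.
Proof. by move=> f g; apply/idP/idP => /asboolP h; apply/asboolP/ae_eq_sym. Qed.

Let L2eq_trans : transitive L2eq.
Proof.
by move=> f g h /asboolP gf /asboolP fh; apply/asboolP/(ae_eq_trans gf fh).
Qed.

Canonical L2eq_canonical := EquivRel L2eq L2eq_refl L2eq_sym L2eq_trans.

Definition L2 : Type := {eq_quot L2eq}.
HB.instance Definition _ := Choice.on L2.
HB.instance Definition _ := EqQuotient.on L2.

Definition L2repr (u : L2) : T -> C := \val (repr u).
Coercion L2repr : L2 >-> Funclass.

Lemma square_integrable0 : square_integrable m (fun=> 0).
Proof. by apply/andP; split; exact: (LfunP (cst 0 : LfunType m (lee1n 2))). Qed.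

Lemma square_integrableD f g : square_integrable m f ->
  square_integrable m g -> square_integrable m (fun x => f x + g x).
Proof.
move=> /andP[fr fi] /andP[gr gi]; apply/andP; split.
- rewrite (_ : (fun x => _) =
    (fun x => complex.Re (f x)) + (fun x => complex.Re (g x))).
    exact: (Lfun_addr_closed m (lee1n 2)).2.
  by apply/funext => x; rewrite raddfD.
- rewrite (_ : (fun x => _) =
    (fun x => complex.Im (f x)) + (fun x => complex.Im (g x))).
    exact: (Lfun_addr_closed m (lee1n 2)).2.
  by apply/funext => x; rewrite raddfD.
Qed.

Lemma square_integrableZ (a : C) f : square_integrable m f ->
  square_integrable m (fun x => a * f x).
Proof.
have lin (k l : R) (g h : T -> R) : g \in Lfun m 2%:E -> h \in Lfun m 2%:E ->
    (fun x => k * g x + l * h x) \in Lfun m 2%:E.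
  move=> gm hm.
  have hm' : l *: h \in Lfun m 2%:E.
    rewrite -[_ *: _]addr0; apply: (Lfun_submod_closed m (lee1n 2)).2 => //.
    exact: (Lfun_submod_closed m (lee1n 2)).1.
  exact: (Lfun_submod_closed m (lee1n 2)).2.
move=> /andP[fr fi]; apply/andP; split.
- rewrite (_ : (fun x => _) = fun x =>
    complex.Re a * complex.Re (f x) + - complex.Im a * complex.Im (f x)).
    exact: lin.
  by apply/funext => x; case: a (f x) => [a b] [p q] /=; rewrite mulNr.
- rewrite (_ : (fun x => _) = fun x =>
    complex.Re a * complex.Im (f x) + complex.Im a * complex.Re (f x)).
    exact: lin.
  by apply/funext => x; case: a (f x) => [a b] [p q].
Qed.

Definition L2fun0 : L2fun :=
  exist (fun f => square_integrable m f) (fun=> 0) square_integrable0.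

(* The class of [f]; it is the zero class when [f] is not square integrable. *)
Definition toL2 (f : T -> C) : L2 :=
  \pi_L2 (insubd L2fun0 f).

Lemma L2P (u : L2) : square_integrable m u. Proof. exact: valP. Qed.

Lemma toL2K f : square_integrable m f -> toL2 f = f %[ae m].
Proof.
move=> mf.
have /eqP : repr (toL2 f) = insubd L2fun0 f
  %[mod L2] by rewrite reprK.
by rewrite eqmodE => /asboolP; rewrite val_insubd mf.
Qed.

Lemma L2_eqP (u v : L2) : (u : T -> C) = v %[ae m] <-> u = v.
Proof.
split=> [uv|-> //]; last exact: ae_eq_refl.
by rewrite -[u]reprK -[v]reprK; apply/eqP; rewrite eqmodE; exact/asboolP.
Qed.

Lemma toL2_eq f g : square_integrable m f -> square_integrable m g ->
  f = g %[ae m] -> toL2 f = toL2 g.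
Proof.
move=> mf mg fg; apply/L2_eqP.
apply: ae_eq_trans (toL2K mf) _.
by apply: ae_eq_trans fg _; exact/ae_eq_sym/toL2K.
Qed.

Definition L2_zero : L2 := toL2 (fun=> 0).
Definition L2_opp (u : L2) : L2 := toL2 (fun x => (- 1) * u x).
Definition L2_add (u v : L2) : L2 := toL2 (fun x => u x + v x).
Definition L2_scale (a : C) (u : L2) : L2 := toL2 (fun x => a * u x).

Let addE u v : (L2_add u v : T -> C) = (fun x => u x + v x) %[ae m].
Proof. by apply: toL2K; apply: square_integrableD; exact: L2P. Qed.

Let scaleE a u : (L2_scale a u : T -> C) = (fun x => a * u x) %[ae m].
Proof. by apply: toL2K; apply: square_integrableZ; exact: L2P. Qed.

Let oppE u : (L2_opp u : T -> C) = (fun x => - u x) %[ae m].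
Proof.
by apply: filterS (scaleE (- 1) u) => x /= /(_ I) h _; rewrite h // mulN1r.
Qed.

Let zeroE : (L2_zero : T -> C) = (fun=> 0) %[ae m].
Proof. exact: (toL2K square_integrable0). Qed.

Let L2_addA : associative L2_add.
Proof.
move=> u v w; apply/L2_eqP.
apply: filter_app (addE u v); apply: filterS3 (addE v w)
  (addE (L2_add u v) w) (addE u (L2_add v w)) => x e1 e2 e3 e4 _ /=.
by rewrite e3// e1// e2//= e4// addrA.
Qed.

Let L2_addC : commutative L2_add.
Proof.
move=> u v; apply/L2_eqP.
by have := addE u v; have := addE v u; apply: filterS2 => x e1 e2 _;
  rewrite e1// e2//= addrC.
Qed.

Let L2_add0 : left_id L2_zero L2_add.
Proof.
move=> u; apply/L2_eqP.
by have := addE L2_zero u; have := zeroE; apply: filterS2 => x e1 e2 _;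
  rewrite e2//= e1// add0r.
Qed.

Let L2_addN : left_inverse L2_zero L2_opp L2_add.
Proof.
move=> u; apply/L2_eqP.
by have := addE (L2_opp u) u; have := zeroE; have := oppE u;
  apply: filterS3 => x e1 e2 e3 _; rewrite e3//= e1// e2// addNr.
Qed.

HB.instance Definition _ :=
  GRing.isZmodule.Build L2 L2_addA L2_addC L2_add0 L2_addN.

Let L2_scaleA a b u : L2_scale a (L2_scale b u) = L2_scale (a * b) u.
Proof.
apply/L2_eqP.
by have := scaleE a (L2_scale b u); have := scaleE b u;
  have := scaleE (a * b) u; apply: filterS3 => x e1 e2 e3 _;
  rewrite e3//= e1// e2//= mulrA.
Qed.

Let L2_scale1 : left_id 1 L2_scale.
Proof.
move=> u; apply/L2_eqP.
by have := scaleE 1 u; apply: filterS => x e1 _; rewrite e1//= mul1r.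
Qed.

Let L2_scaleDr : right_distributive L2_scale +%R.
Proof.
move=> a u v; apply/L2_eqP.
apply: filter_app (scaleE a u); apply: filter_app (scaleE a v).
apply: filterS3 (scaleE a (u + v)) (addE u v)
  (addE (L2_scale a u) (L2_scale a v)) => x e1 e2 e3 e4 e5 _ /=.
by rewrite e1// e2// e3//= e4// e5// mulrDr.
Qed.

Let L2_scaleDl u : {morph L2_scale^~ u : a b / a + b}.
Proof.
move=> a b; apply/L2_eqP.
apply: filter_app (scaleE a u); apply: filterS3 (scaleE b u)
  (scaleE (a + b) u) (addE (L2_scale a u) (L2_scale b u)) => x e1 e2 e3 e4 _ /=.
by rewrite e2// e3//= e1// e4// mulrDl.
Qed.

HB.instance Definition _ := GRing.Zmodule_isLmodule.Build C L2
  L2_scaleA L2_scale1 L2_scaleDr L2_scaleDl.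

(* Linear in the first variable. *)
Definition dot (u v : L2) : C := cintegral m (fun x => u x * (v x)^*).

Definition L2norm (u : L2) : R := Num.sqrt (complex.Re (dot u u)).

End L2.

Section Operators.
Context d (T : measurableType d) (R : realType).
Variable m : {measure set T -> \bar R}.

Definition operator : Type := L2 m -> L2 m.

Definition bounded_op (A : operator) : Prop :=
  linear A /\ exists K : R, forall u, L2norm (A u) <= K * L2norm u.

Definition invertible_op (A : operator) : Prop :=
  bounded_op A /\ exists B : operator, [/\ bounded_op B, cancel A B & cancel B A].

(* It exists, uniquely, for bounded [A] since [L2 m] is complete. *)
Definition adjoint (A : operator) : operator :=
  xget (fun=> 0) [set B : operator | forall u v, dot (A u) v = dot u (B v)].

(* [0 <= z] in [R[i]] says that [z] is real and nonnegative. *)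
Definition positive_op (A : operator) : Prop :=
  bounded_op A /\ forall u, 0 <= dot (A u) u.

Definition partial_isometry (W : operator) : Prop :=
  bounded_op W /\ W \o adjoint W \o W = W.

(* [A = |S|] *)
Definition is_abs (S A : operator) : Prop :=
  positive_op A /\ A \o A = adjoint S \o S.

(* [S = W |S|] with [A = |S|] *)
Definition polar_decomposition (S W A : operator) : Prop :=
  [/\ is_abs S A, S = W \o A, partial_isometry W &
      forall u, W u = 0 <-> S u = 0].

Definition commuting_set (F : set operator) : Prop :=
  forall A B, F A -> F B -> A \o B = B \o A.

Definition centered (S : operator) : Prop :=
  exists W A, polar_decomposition S W A /\
    commuting_set ([set B | exists2 k : nat, (0 < k)%N &
                      B = iter k (adjoint W) \o A \o iter k W]
                   `|` [set A]
                   `|` [set B | exists2 k : nat, (0 < k)%N &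
                      B = iter k W \o A \o iter k (adjoint W)]).

Definition commutant (F : set operator) : set operator :=
  [set A | bounded_op A /\ forall B, F B -> A \o B = B \o A].

Definition vN_generated (F : set operator) : set operator :=
  commutant (commutant (F `|` adjoint @` F)).

(* Normal states are taken as the positive functionals of norm one of the form
   [A |-> \sum_k <A (xi k), eta k>] with [xi], [eta] square summable, i.e. the
   sigma-weakly continuous ones; linearity on [M] follows from this form. *)
Definition normal_state (M : set operator) (tau : operator -> R[i]) : Prop :=
  [/\ (exists xi eta : nat -> L2 m,
         [/\ (\sum_(0 <= k <oo) (L2norm (xi k) ^+ 2)%:E < +oo)%E,
             (\sum_(0 <= k <oo) (L2norm (eta k) ^+ 2)%:E < +oo)%E &
             forall A, M A ->
               (fun n : nat => Normc.normc
                  (tau A - \sum_(0 <= k < n) dot (A (xi k)) (eta k)))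
                 @ \oo --> (0 : R)]),
      (forall A, M A -> 0 <= tau (adjoint A \o A)) &
      tau idfun = 1].

(* Only for selfadjoint [A], whose spectrum is real. *)
Definition spectrum (A : operator) : set R :=
  [set s | ~ invertible_op (fun u => A u - s%:C *: u)].

(* The measure [B |-> <E B u, u>]. *)
Definition spectral_measure_at (E : set R -> operator) (u : L2 m) (B : set R) :
  \bar R := (complex.Re (dot (E B u) u))%:E.

Definition projection_valued_measure (E : set R -> operator) : Prop :=
  [/\ (forall B, measurable B ->
         [/\ bounded_op (E B), adjoint (E B) = E B & E B \o E B = E B]),
      E setT = idfun,
      (forall B B', measurable B -> measurable B' ->
         E (B `&` B') = E B \o E B') &
      forall u, semi_sigma_additive (spectral_measure_at E u)].

(* [B] is [\int_D a(s) dE_s]: as [a] is real, [B] is determined by its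
   quadratic form. *)
Definition is_spectral_integral (E : set R -> operator) (D : set R)
    (a : R -> R) (B : operator) : Prop :=
  bounded_op B /\
  forall u, dot (B u) u =
    (fine (\int[spectral_measure_at E u]_(s in D) (a s)%:E)%E)%:C.

Definition spectral_decomposition (A : operator) (E : set R -> operator) :
    Prop :=
  [/\ projection_valued_measure E, measurable (spectrum A),
      E (spectrum A) = idfun &
      is_spectral_integral E (spectrum A) id A].

(* [Y] is the double operator integral [\int_D \int_D psi(s, t) dE_s W dE_t].
   It is defined, as usual, by separating the variables of the kernel: if
   [psi(s, t) = \int alpha(s, x) beta(t, x) dsigma(x)] on [D x D] with [sigma]
   finite and [alpha], [beta] bounded and measurable, then it is the weak
   integral of [(\int_D alpha(s, x) dE_s) W (\int_D beta(t, x) dE_t)] with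
   respect to [dsigma(x)], whichever the separation. A real kernel that has a
   complex separation has a real one. *)
Definition is_double_operator_integral (E : set R -> operator) (D : set R)
    (psi : R -> R -> R) (W Y : operator) : Prop :=
  bounded_op Y /\
  exists (d' : measure_display) (Om : measurableType d')
    (sigma : {finite_measure set Om -> \bar R})
    (alpha beta : R -> Om -> R) (A B : Om -> operator),
  [/\ measurable_fun (D `*` [set: Om]) (fun p : R * Om => alpha p.1 p.2) /\
      measurable_fun (D `*` [set: Om]) (fun p : R * Om => beta p.1 p.2),
      (exists K : R, forall s x, D s -> `|alpha s x| <= K /\ `|beta s x| <= K),
      (forall s t, D s -> D t ->
         psi s t = \int[sigma]_x (alpha s x * beta t x)),
      (forall x, is_spectral_integral E D (alpha^~ x) (A x) /\
                 is_spectral_integral E D (beta^~ x) (B x)) &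
      forall u v, dot (Y u) v = cintegral sigma (fun x => dot (A x (W (B x u))) v)].

Definition is_aluthge (f : R -> R) (S Y : operator) : Prop :=
  exists (W A : operator) (E : set R -> operator),
  [/\ polar_decomposition S W A, spectral_decomposition A E &
      is_double_operator_integral E (spectrum A)
        (fun s t => s * f (t / s)) W Y].

Definition aluthge (f : R -> R) (S : operator) : operator :=
  xget (fun=> 0) [set Y | is_aluthge f S Y].

End Operators.

Definition power_mean (R : realType) (r lam : R) (x : R) : R :=
  (1 - lam + lam * x `^ r) `^ r^-1.

Section CrossedProduct.
Context d (X : measurableType d) (R : realType).
Variable mu : probability X R.

Definition invertible_measure_preserving (phi phiV : X -> X) : Prop :=
  [/\ measurable_fun setT phi, measurable_fun setT phiV,
      cancel phi phiV, cancel phiV phi &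
      forall A, measurable A -> mu (phi @^-1` A) = mu A].

Definition ziter (S : Type) (g gV : S -> S) (k : int) : S -> S :=
  match k with Posz n => iter n g | Negz n => iter n.+1 gV end.

(* L^2(X, mu) (x) l^2(Z) is realized as L^2(Z x X), with [(xi n) x] written
   [xi (n, x)]. *)
Definition crossed_measure : {measure set (int * X) -> \bar R} :=
  (counting \x mu)%E.

Definition cp_pi (phi phiV : X -> X) (f : X -> R[i]) :
    operator crossed_measure :=
  fun xi => toL2 crossed_measure
    (fun p => f (ziter phi phiV (- p.1) p.2) * xi p).

Definition cp_U : operator crossed_measure :=
  fun xi => toL2 crossed_measure (fun p => xi (p.1 - 1, p.2)).

Definition crossed_product (phi phiV : X -> X) :
    set (operator crossed_measure) :=
  vN_generated ([set A | exists2 f, Linf mu f & A = cp_pi phi phiV f]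
                `|` [set cp_U]).

Definition is_canonical_trace (phi phiV : X -> X)
    (tau : operator crossed_measure -> R[i]) : Prop :=
  normal_state (crossed_product phi phiV) tau /\
  forall (k : int) (f : X -> R[i]), Linf mu f ->
    tau (ziter cp_U (adjoint cp_U) k \o cp_pi phi phiV f) =
    if k == 0 then cintegral mu f else 0.

Definition canonical_trace (phi phiV : X -> X) :
    operator crossed_measure -> R[i] :=
  xget (fun=> 0) [set tau | is_canonical_trace phi phiV tau].

Definition norm2 (phi phiV : X -> X) (A : operator crossed_measure) : R :=
  Num.sqrt (complex.Re (canonical_trace phi phiV (adjoint A \o A))).

End CrossedProduct.

Arguments cp_pi {d X R} mu phi phiV f _ : rename.
Arguments cp_U {d X R} mu _ : rename.
Arguments crossed_product {d X R} mu phi phiV _ : rename.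
Arguments norm2 {d X R} mu phi phiV A.

Section CondExp.
Context d (X : measurableType d) (R : realType).
Variable mu : probability X R.

Definition invariant_Linf (phi : X -> X) (h : X -> R[i]) : Prop :=
  Linf mu h /\ h \o phi = h %[ae mu].

Record is_cond_exp (phi : X -> X) (E : (X -> R[i]) -> (X -> R[i])) : Prop := {
  cond_exp_ae : forall f g, Linf mu f -> Linf mu g ->
    f = g %[ae mu] -> E f = E g %[ae mu];
  cond_exp_invariant : forall f, Linf mu f -> invariant_Linf phi (E f);
  cond_exp_id : forall h, invariant_Linf phi h -> E h = h %[ae mu];
  cond_exp_linear : forall (c : R[i]) f g, Linf mu f -> Linf mu g ->
    E (fun x => c * f x + g x) = (fun x => c * E f x + E g x) %[ae mu];
  cond_exp_ge0 : forall f, Linf mu f -> {ae mu, forall x, 0 <= f x} ->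
    {ae mu, forall x, 0 <= E f x};
  cond_exp_module : forall f h, Linf mu f -> invariant_Linf phi h ->
    E (fun x => h x * f x) = (fun x => h x * E f x) %[ae mu];
  cond_exp_preserving : forall f, Linf mu f ->
    cintegral mu (E f) = cintegral mu f
}.

Definition cond_exp (phi : X -> X) : (X -> R[i]) -> (X -> R[i]) :=
  xget (id : (X -> R[i]) -> (X -> R[i])) [set E | is_cond_exp phi E].

(* The power [f ^ p] of a function that is nonnegative almost everywhere. *)
Definition fun_pow (f : X -> R[i]) (p : R) : X -> R[i] :=
  fun x => (complex.Re (f x) `^ p)%:C.

End CondExp.

(* Main.v *)
(* On L^2(Z x X) the operator T is a weighted shift U pi(b), where b is a
   measurable function with values in a compact interval of (0, +oo). Its polar
   and spectral decompositions are given by multiplication operators and are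
   unique, and separating the variables of the kernel s f(t / s) shows that its
   Aluthge transform is U pi(b'), where
     b' ^ r = (1 - lam) (b o phi^-1) ^ r + lam b ^ r.
   Hence the r-th powers of the weights evolve under P = lam + (1 - lam) V,
   where V is the unitary h |-> h o phi^-1 of L^2(X). The contraction P is
   normal and has the same fixed vectors as V, so P^n h converges to the
   conditional expectation of h; the inner products of the iterates of P* P on
   h are the numbers |P^n h|^2, which decrease, and this makes these iterates a
   Cauchy sequence. As t |-> t ^ (1 / r) is Lipschitz on compact intervals of
   (0, +oo), the weights b_n converge to H in L^2(X), and the trace norm of
   U pi(b_n) - U pi(H) is the norm of b_n - H in L^2(X). *)

Require Import Defs.
From HB Require Import structures.
From mathcomp Require Import all_boot all_order all_algebra.
From mathcomp Require Import complex.
From mathcomp Require Import all_classical all_reals all_analysis.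
From mathcomp Require Import measurable_realfun.
From mathcomp Require Import ring lra.

Import Order.TTheory GRing.Theory Num.Theory.
Import numFieldNormedType.Exports.

Local Open Scope classical_set_scope.
Local Open Scope complex_scope.
Local Open Scope ring_scope.

Set Implicit Arguments.
Unset Strict Implicit.

(** * Complex-valued integration *)

Section ComplexIntegral.
Context d (T : measurableType d) (R : realType).
Variable m : {measure set T -> \bar R}.
Implicit Types (f g : T -> R[i]).
Local Notation Re := complex.Re.
Local Notation Im := complex.Im.

(** [aluthge], [canonical_trace], [cond_exp] and [adjoint] are choices by [xget], so each needs an
    existence proof, and [aluthge] also a uniqueness proof over all polar decompositions, all
    spectral decompositions and all separations of the kernel. The main obstacle is the spectral
    measure [E] of an arbitrary decomposition, known only through quadratic forms. It is compared
    with the projections [1_{b <= t}]: a vector in the range of [E ]-oo, t]] must vanish where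
    [t < b], by the growth of its products with powers of [b], and symmetrically for the complement;
    this fixes all distribution functions. The kernel is separated through its derivative in [s],
    which treats both signs of [r] alike. In the ergodic part the limit has to be a bounded
    function, because conditional expectations live on [Linf]. Hence the averages are also iterated
    pointwise, where convexity preserves a bound, and completeness is proved for uniformly bounded
    sequences. *)

Definition cintegrable f :=
  m.-integrable setT (EFin \o (fun x => Re (f x))) /\
  m.-integrable setT (EFin \o (fun x => Im (f x))).

Lemma cintegralE f : cintegral m f =
  Rintegral m setT (fun x => Re (f x)) +i* Rintegral m setT (fun x => Im (f x)).
Proof. by []. Qed.

Lemma ReD (z w : R[i]) : Re (z + w) = Re z + Re w.
Proof. by case: z; case: w. Qed.
Lemma ImD (z w : R[i]) : Im (z + w) = Im z + Im w.
Proof. by case: z; case: w. Qed.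
Lemma ReM (z w : R[i]) : Re (z * w) = Re z * Re w - Im z * Im w.
Proof. by case: z; case: w. Qed.
Lemma ImM (z w : R[i]) : Im (z * w) = Re z * Im w + Im z * Re w.
Proof. by case: z; case: w. Qed.
Lemma ReN (z : R[i]) : Re (- z) = - Re z.
Proof. by case: z. Qed.
Lemma ImN (z : R[i]) : Im (- z) = - Im z.
Proof. by case: z. Qed.
Lemma ReC (z : R[i]) : Re (z^*) = Re z.
Proof. by case: z. Qed.
Lemma ImC (z : R[i]) : Im (z^*) = - Im z.
Proof. by case: z. Qed.
Definition ReImE := (ReD, ImD, ReM, ImM, ReN, ImN, ReC, ImC).

Lemma eqCP (z w : R[i]) : Re z = Re w -> Im z = Im w -> z = w.
Proof. by case: z; case: w => a b c e /= -> ->. Qed.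

Lemma integrable_lin (a b : R) (f g : T -> R) :
  m.-integrable setT (EFin \o f) -> m.-integrable setT (EFin \o g) ->
  m.-integrable setT (EFin \o (fun x => a * f x + b * g x)).
Proof.
move=> fi gi.
have -> : EFin \o (fun x => a * f x + b * g x) =
    ((fun x => a%:E * (EFin \o f) x) \+ (fun x => b%:E * (EFin \o g) x))%E.
  by apply/funext => x.
by apply: integrableD => //; exact: integrableZl.
Qed.

Lemma Rintegral_lin (a b : R) (f g : T -> R) :
  m.-integrable setT (EFin \o f) -> m.-integrable setT (EFin \o g) ->
  Rintegral m setT (fun x => a * f x + b * g x) =
  a * Rintegral m setT f + b * Rintegral m setT g.
Proof.
move=> fi gi.
rewrite RintegralD//; last 2 first.
  exact: (integrableZl (measurableT) a fi).
  exact: (integrableZl (measurableT) b gi).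
by rewrite !RintegralZl.
Qed.

Lemma cintegrableZ a f : cintegrable f -> cintegrable (fun x => a * f x).
Proof.
move=> [f1 f2]; split.
- have := integrable_lin (Re a) (- Im a) f1 f2; congr (_.-integrable _ _).
  by apply/funext => x /=; rewrite ReM mulNr.
- have := integrable_lin (Re a) (Im a) f2 f1; congr (_.-integrable _ _).
  by apply/funext => x /=; rewrite ImM.
Qed.

Lemma cintegralD f g : cintegrable f -> cintegrable g ->
  cintegral m (fun x => f x + g x) = cintegral m f + cintegral m g.
Proof.
move=> [f1 f2] [g1 g2]; rewrite !cintegralE; apply: eqCP; rewrite !ReImE /=.
- rewrite -[in RHS](mul1r (Rintegral _ _ (fun x => Re (f x)))).
  rewrite -[X in _ + X]mul1r -Rintegral_lin//; congr Rintegral.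
  by apply/funext => x; rewrite ReD !mul1r.
- rewrite -[in RHS](mul1r (Rintegral _ _ (fun x => Im (f x)))).
  rewrite -[X in _ + X]mul1r -Rintegral_lin//; congr Rintegral.
  by apply/funext => x; rewrite ImD !mul1r.
Qed.

Lemma cintegralZ a f : cintegrable f ->
  cintegral m (fun x => a * f x) = a * cintegral m f.
Proof.
move=> [f1 f2]; rewrite !cintegralE; apply: eqCP; rewrite !ReImE /=.
- rewrite -mulNr -Rintegral_lin//; congr Rintegral.
  by apply/funext => x; rewrite ReM mulNr.
- rewrite -Rintegral_lin//; congr Rintegral.
  by apply/funext => x; rewrite ImM.
Qed.

Lemma cintegral_conj f : cintegrable f ->
  cintegral m (fun x => (f x)^*) = (cintegral m f)^*.
Proof.
move=> [f1 f2]; rewrite !cintegralE; apply: eqCP; rewrite !ReImE /=.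
- by congr Rintegral; apply/funext => x; rewrite ReC.
- rewrite -mulN1r -RintegralZl//; congr Rintegral.
  by apply/funext => x; rewrite ImC mulN1r.
Qed.

Lemma Rintegral_ae_eq (f g : T -> R) : measurable_fun setT f ->
  measurable_fun setT g -> f = g %[ae m] ->
  Rintegral m setT f = Rintegral m setT g.
Proof.
move=> mf mg fg; congr fine; apply: ae_eq_integral => //.
- exact/measurable_EFinP.
- exact/measurable_EFinP.
- by apply: filterS fg => x /= h /h ->.
Qed.

Lemma cintegral_ae_eq f g : cmeasurable f -> cmeasurable g ->
  f = g %[ae m] -> cintegral m f = cintegral m g.
Proof.
move=> [f1 f2] [g1 g2] fg; rewrite !cintegralE; congr (_ +i* _).
- by apply: Rintegral_ae_eq => //; apply: filterS fg => x /= h /h ->.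
- by apply: Rintegral_ae_eq => //; apply: filterS fg => x /= h /h ->.
Qed.

Lemma cmeasurableD f g : cmeasurable f -> cmeasurable g ->
  cmeasurable (fun x => f x + g x).
Proof.
move=> [f1 f2] [g1 g2]; split.
- by under eq_fun do rewrite ReD; exact: measurable_funD.
- by under eq_fun do rewrite ImD; exact: measurable_funD.
Qed.

Lemma cmeasurableM f g : cmeasurable f -> cmeasurable g ->
  cmeasurable (fun x => f x * g x).
Proof.
move=> [f1 f2] [g1 g2]; split.
- under eq_fun do rewrite ReM.
  by apply: measurable_funB; exact: measurable_funM.
- under eq_fun do rewrite ImM.
  by apply: measurable_funD; exact: measurable_funM.
Qed.

Lemma cmeasurable_conj f : cmeasurable f -> cmeasurable (fun x => (f x)^*).
Proof.
move=> [f1 f2]; split.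
- by under eq_fun do rewrite ReC.
- by under eq_fun do rewrite ImC; exact: measurableT_comp.
Qed.

Lemma cmeasurable_cst (a : R[i]) : cmeasurable (fun _ : T => a).
Proof. by split; exact: measurable_cst. Qed.

Lemma cmeasurable_real (f : T -> R) : measurable_fun setT f ->
  cmeasurable (fun x => (f x)%:C).
Proof. by move=> mf; split => //=; exact: measurable_cst. Qed.

Lemma Lfun2P (f : T -> R) : f \in Lfun m 2%:E <->
  measurable_fun setT f /\ m.-integrable setT (EFin \o (fun x => f x ^+ 2)).
Proof.
split=> [fL|[mf fi]].
  split; last exact: Lfun2_integrable_sqr.
  by move: fL; rewrite inE => /andP[]; rewrite inE.
rewrite inE; apply/andP; split; rewrite inE //=.
rewrite /finite_norm unlock /Lnorm.
apply: poweR_lty.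
move/integrableP : fi => [_]; apply: le_lt_trans.
apply: ge0_le_integral => //.
- by move=> x _; exact: poweR_ge0.
- apply/measurable_EFinP.
  apply/(@measurableT_comp _ _ _ _ _ _ (fun x : R => x `^ 2)%R) => //.
  exact/measurableT_comp.
- apply: measurableT_comp => //; apply/measurable_EFinP.
  exact: measurable_funX.
- by move=> x _ /=; rewrite lee_fin normrX powR_mulrn.
Qed.

(** Polynomial and real-valued: multiplicativity is an identity of polynomials, and no square root
    enters the estimates. *)
Definition sqmod (z : R[i]) : R := Re z ^+ 2 + Im z ^+ 2.

Lemma sqmod_ge0 z : 0 <= sqmod z.
Proof. by rewrite addr_ge0// sqr_ge0. Qed.

Lemma sqmodM z w : sqmod (z * w) = sqmod z * sqmod w.
Proof. by rewrite /sqmod !ReImE; ring. Qed.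

Lemma measurable_sqmod f : cmeasurable f ->
  measurable_fun setT (fun x => sqmod (f x)).
Proof.
by move=> [f1 f2]; apply: measurable_funD; exact: measurable_funX.
Qed.

Lemma integrable_bound (f g : T -> R) : measurable_fun setT f ->
  (forall x, `|f x| <= `|g x|) -> m.-integrable setT (EFin \o g) ->
  m.-integrable setT (EFin \o f).
Proof.
move=> mf fg; apply: le_integrable => //; first exact/measurable_EFinP.
by move=> x _ /=; rewrite lee_fin.
Qed.

Lemma square_integrableP f : square_integrable m f <->
  cmeasurable f /\ m.-integrable setT (EFin \o (fun x => sqmod (f x))).
Proof.
split.
  move=> /andP[/Lfun2P[m1 i1] /Lfun2P[m2 i2]]; split => //.
  have := integrable_lin 1 1 i1 i2; congr (_.-integrable _ _).
  by apply/funext => x /=; rewrite !mul1r.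
move=> [[m1 m2] fi]; apply/andP; split; apply/Lfun2P; split => //.
- apply: integrable_bound fi; first exact: measurable_funX.
  move=> x; rewrite !ger0_norm ?sqmod_ge0// ?sqr_ge0//.
  by rewrite lerDl sqr_ge0.
- apply: integrable_bound fi; first exact: measurable_funX.
  move=> x; rewrite !ger0_norm ?sqmod_ge0// ?sqr_ge0//.
  by rewrite lerDr sqr_ge0.
Qed.

Lemma square_integrable_mul f g : square_integrable m f ->
  square_integrable m g -> cintegrable (fun x => f x * g x).
Proof.
move=> /square_integrableP[mf fi] /square_integrableP[mg gi].
have [mr mi] := cmeasurableM mf mg.
split.
- apply: integrable_bound (integrable_lin 1 1 fi gi) => // x.
  rewrite !mul1r [leRHS]ger0_norm; last exact: addr_ge0 (sqmod_ge0 _) (sqmod_ge0 _).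
  case: (f x) (g x) => [a b] [c e]; rewrite /sqmod /= ler_norml.
  (* [2 |Re (z w)|] and [2 |Im (z w)|] are both at most [|z| ^ 2 + |w| ^ 2]; the eight squares cover
     either part. *)
  have := (sqr_ge0 (a + c), sqr_ge0 (a - c), sqr_ge0 (b + e), sqr_ge0 (b - e)).
  have := (sqr_ge0 (a + e), sqr_ge0 (a - e), sqr_ge0 (b + c), sqr_ge0 (b - c)).
  by move=> [[[h1 h2] h3] h4] [[[h5 h6] h7] h8]; apply/andP; split; nra.
- apply: integrable_bound (integrable_lin 1 1 fi gi) => // x.
  rewrite !mul1r [leRHS]ger0_norm; last exact: addr_ge0 (sqmod_ge0 _) (sqmod_ge0 _).
  case: (f x) (g x) => [a b] [c e]; rewrite /sqmod /= ler_norml.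
  have := (sqr_ge0 (a + c), sqr_ge0 (a - c), sqr_ge0 (b + e), sqr_ge0 (b - e)).
  have := (sqr_ge0 (a + e), sqr_ge0 (a - e), sqr_ge0 (b + c), sqr_ge0 (b - c)).
  by move=> [[[h1 h2] h3] h4] [[[h5 h6] h7] h8]; apply/andP; split; nra.
Qed.

Lemma square_integrable_conj f : square_integrable m f ->
  square_integrable m (fun x => (f x)^*).
Proof.
move=> /square_integrableP[mf fi]; apply/square_integrableP; split.
  exact: cmeasurable_conj.
move: fi; congr (_.-integrable _ _); apply/funext => x /=.
by rewrite /sqmod !ReImE sqrrN.
Qed.

(** The bound holds everywhere, so products and compositions carry no exceptional sets;
    [bounded_representative] reduces [Linf] to this case. *)
Definition cbounded f := cmeasurable f /\ exists K : R, forall x, sqmod (f x) <= K.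

Lemma cboundedM f g : cbounded f -> cbounded g -> cbounded (fun x => f x * g x).
Proof.
move=> [mf [K fK]] [mg [L gL]]; split; first exact: cmeasurableM.
exists (K * L) => x; rewrite sqmodM; apply: ler_pM => //; exact: sqmod_ge0.
Qed.

Lemma cbounded_cst a : cbounded (fun=> a).
Proof. by split; [exact: cmeasurable_cst|exists (sqmod a)]. Qed.

Lemma cbounded_conj f : cbounded f -> cbounded (fun x => (f x)^*).
Proof.
move=> [mf [K fK]]; split; first exact: cmeasurable_conj.
by exists K => x; rewrite /sqmod ReC ImC sqrrN; exact: fK.
Qed.

Lemma cbounded_real (f : T -> R) (K : R) : measurable_fun setT f ->
  (forall x, `|f x| <= K) -> cbounded (fun x => (f x)%:C).
Proof.
move=> mf fK; split; first exact: cmeasurable_real.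
exists (K ^+ 2) => x; rewrite /sqmod /= expr0n addr0.
by rewrite -[leLHS]ger0_norm ?sqr_ge0// normrX lerXn2r// ?nnegrE// (le_trans _ (fK x)).
Qed.

Lemma square_integrable_bounded f g : cbounded f ->
  square_integrable m g -> square_integrable m (fun x => f x * g x).
Proof.
move=> [mf [K fK]] /square_integrableP[mg gi].
apply/square_integrableP; split; first exact: cmeasurableM.
apply: integrable_bound (integrable_lin K 0 gi gi).
  by apply: measurable_sqmod; exact: cmeasurableM.
move=> x; rewrite mul0r addr0 sqmodM.
have K0 : 0 <= K by rewrite (le_trans _ (fK x))// sqmod_ge0.
by rewrite !ger0_norm ?mulr_ge0 ?sqmod_ge0// ler_wpM2r ?sqmod_ge0.
Qed.

Lemma square_integrable_ae f g : cmeasurable f -> square_integrable m g ->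
  f = g %[ae m] -> square_integrable m f.
Proof.
move=> mf /square_integrableP[mg /integrableP[mi gi]] fg.
apply/square_integrableP; split => //; apply/integrableP; split.
  by apply/measurable_EFinP; exact: measurable_sqmod.
suff <- : (\int[m]_x `|(EFin \o (fun x => sqmod (g x))) x| =
   \int[m]_x `|(EFin \o (fun x => sqmod (f x))) x|)%E by [].
apply: ae_eq_integral => //.
- exact: measurableT_comp.
- apply: measurableT_comp => //.
  by apply/measurable_EFinP; exact: measurable_sqmod.
- by apply: filterS fg => x /= h /h ->.
Qed.

End ComplexIntegral.

(** * The Hilbert space of square integrable functions *)

Section Dot.
Context d (T : measurableType d) (R : realType).
Variable m : {measure set T -> \bar R}.
Local Notation Re := complex.Re.
Implicit Types (u v w : L2 m) (A B : operator m).

Lemma conjD (z w : R[i]) : (z + w)^* = z^* + w^*.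
Proof. by apply: eqCP; rewrite !ReImE //; ring. Qed.

Lemma conjM (z w : R[i]) : (z * w)^* = z^* * w^*.
Proof. by apply: eqCP; rewrite !ReImE; ring. Qed.

Lemma conjK (z : R[i]) : (z^*)^* = z.
Proof. by apply: eqCP; rewrite !ReImE // opprK. Qed.

Lemma L2_addE u v : (u + v : L2 m) = (fun x => u x + v x) %[ae m].
Proof. by apply: toL2K; apply: square_integrableD; exact: L2P. Qed.

Lemma L2_scaleE (a : R[i]) u : (a *: u : L2 m) = (fun x => a * u x) %[ae m].
Proof. by apply: toL2K; apply: square_integrableZ; exact: L2P. Qed.

Lemma L2_zeroE : (0 : L2 m) = (fun=> 0) %[ae m].
Proof. exact: (toL2K (square_integrable0 m)). Qed.

Lemma L2_measurable u : cmeasurable u.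
Proof. by have /square_integrableP[] := L2P u. Qed.

Lemma cintegrable_dot u v : cintegrable m (fun x => u x * (v x)^*).
Proof.
apply: square_integrable_mul; first exact: L2P.
by apply: square_integrable_conj; exact: L2P.
Qed.

Lemma dotE u v (f g : T -> R[i]) : cmeasurable f -> cmeasurable g ->
  u = f %[ae m] -> v = g %[ae m] ->
  dot u v = cintegral m (fun x => f x * (g x)^*).
Proof.
move=> mf mg uf vg; apply: cintegral_ae_eq.
- by apply: cmeasurableM; [|apply: cmeasurable_conj]; exact: L2_measurable.
- by apply: cmeasurableM => //; exact: cmeasurable_conj.
- by apply: filterS2 uf vg => x h1 h2 _; rewrite h1// h2.
Qed.

Lemma dotDl u v w : dot (u + v) w = dot u w + dot v w.
Proof.
rewrite -cintegralD; [|exact: cintegrable_dot..].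
rewrite (dotE _ _ (L2_addE u v) (ae_eq_refl _ _ _)); last 2 first.
- by apply: cmeasurableD; exact: L2_measurable.
- exact: L2_measurable.
by congr cintegral; apply/funext => x; rewrite mulrDl.
Qed.

Lemma dotZl (a : R[i]) u v : dot (a *: u) v = a * dot u v.
Proof.
rewrite -cintegralZ; last exact: cintegrable_dot.
rewrite (dotE _ _ (L2_scaleE a u) (ae_eq_refl _ _ _)); last 2 first.
- by apply: cmeasurableM; [exact: cmeasurable_cst|exact: L2_measurable].
- exact: L2_measurable.
by congr cintegral; apply/funext => x; rewrite mulrA.
Qed.

Lemma dotC u v : dot v u = (dot u v)^*.
Proof.
rewrite -cintegral_conj; last exact: cintegrable_dot.
by congr cintegral; apply/funext => x; rewrite conjM conjK mulrC.
Qed.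

Definition nsq u : R := Rintegral m setT (fun x => sqmod (u x)).

Lemma integrable_nsq u : m.-integrable setT (EFin \o (fun x => sqmod (u x))).
Proof. by have /square_integrableP[] := L2P u. Qed.

Lemma mul_conj (z : R[i]) : z * z^* = (sqmod z)%:C.
Proof. by case: z => a b; apply: eqCP; rewrite !ReImE /sqmod /=; ring. Qed.

Lemma dot_nsq u : dot u u = (nsq u)%:C.
Proof.
rewrite /dot; under eq_fun do rewrite mul_conj.
by rewrite cintegralE /= Rintegral_cst // mul0r.
Qed.

Lemma nsq_ge0 u : 0 <= nsq u.
Proof. by apply: Rintegral_ge0 => x _; exact: sqmod_ge0. Qed.

Lemma sqmod_eq0 (z : R[i]) : sqmod z = 0 -> z = 0.
Proof.
move/eqP; rewrite paddr_eq0 ?sqr_ge0// !sqrf_eq0 => /andP[/eqP h1 /eqP h2].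
exact: eqCP.
Qed.

Lemma Rintegral_eq0 (f : T -> R) : (forall x, 0 <= f x) ->
  m.-integrable setT (EFin \o f) -> Rintegral m setT f = 0 ->
  f = cst 0 %[ae m].
Proof.
move=> f0 fi /eqP; rewrite fine_eq0; last exact: integrable_fin_num.
move/eqP => h; have mf := measurable_int _ fi.
have : (\int[m]_x `|(EFin \o f) x| = 0)%E.
  by rewrite -h; apply: eq_integral => x _; rewrite /= ger0_norm.
move=> /(ae_eq_integral_abs _ measurableT mf).
by apply: filterS => x /= h1 /h1 [].
Qed.

Lemma nsq_eq0 u : nsq u = 0 -> u = 0.
Proof.
move=> /(Rintegral_eq0 (fun x => sqmod_ge0 _) (integrable_nsq u)) h.
apply/L2_eqP; apply: filterS2 h L2_zeroE => x h1 h2 _; rewrite h2//.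
by apply: sqmod_eq0; exact: h1.
Qed.

Lemma dotDr u v w : dot u (v + w) = dot u v + dot u w.
Proof. by rewrite dotC dotDl conjD -!dotC. Qed.

Lemma dotZr (a : R[i]) u v : dot u (a *: v) = a^* * dot u v.
Proof. by rewrite dotC dotZl conjM -dotC. Qed.

Lemma dot0l u : dot 0 u = 0.
Proof. by rewrite -(scale0r (0 : L2 m)) dotZl mul0r. Qed.

Lemma dot0r u : dot u 0 = 0.
Proof. by rewrite -(scale0r (0 : L2 m)) dotZr rmorph0 mul0r. Qed.

Lemma dotNl u v : dot (- u) v = - dot u v.
Proof. by rewrite -scaleN1r dotZl mulN1r. Qed.

Lemma dotNr u v : dot u (- v) = - dot u v.
Proof. by rewrite -scaleN1r dotZr rmorphN rmorph1 mulN1r. Qed.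

Lemma dotBl u v w : dot (u - v) w = dot u w - dot v w.
Proof. by rewrite dotDl dotNl. Qed.

Lemma nsqE u : nsq u = Re (dot u u).
Proof. by rewrite dot_nsq. Qed.

Lemma nsqZ (a : R[i]) u : nsq (a *: u) = sqmod a * nsq u.
Proof.
by rewrite nsqE dotZl dotZr mulrA mul_conj dot_nsq ReM /= mul0r subr0.
Qed.

Lemma nsqD u v : nsq (u + v) = nsq u + nsq v + 2 * Re (dot u v).
Proof.
rewrite !nsqE dotDl !dotDr !ReD (dotC u v) ReC; ring.
Qed.

Lemma nsqB u v : nsq (u - v) = nsq u + nsq v - 2 * Re (dot u v).
Proof. by rewrite nsqD dotNr ReN (nsqE (- v)) dotNl dotNr opprK -nsqE mulrN. Qed.

Lemma nsqB_le u v : nsq (u - v) <= 2 * (nsq u + nsq v).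
Proof.
have := nsq_ge0 (u + v); rewrite nsqB nsqD; lra.
Qed.

Lemma dot_ext u v : (forall w, dot u w = dot v w) -> u = v.
Proof.
move=> h; apply/eqP; rewrite -subr_eq0; apply/eqP; apply: nsq_eq0.
by rewrite nsqE dotBl h subrr.
Qed.

Lemma L2norm_le K u v : L2norm u <= K * L2norm v -> nsq u <= K ^+ 2 * nsq v.
Proof.
rewrite /L2norm -!nsqE => h.
have n0 := nsq_ge0.
rewrite -(sqr_sqrtr (n0 u)) -(sqr_sqrtr (n0 v)) -exprMn.
by rewrite lerXn2r// nnegrE ?sqrtr_ge0// (le_trans _ h)// sqrtr_ge0.
Qed.

Lemma L2norm_leE K u v : 0 <= K -> nsq u <= K * nsq v ->
  L2norm u <= Num.sqrt K * L2norm v.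
Proof.
move=> K0 h; rewrite /L2norm -!nsqE -sqrtrM//.
by rewrite ler_sqrt// mulr_ge0// nsq_ge0.
Qed.

Lemma opD A u v : linear A -> A (u + v) = A u + A v.
Proof. by move=> lA; have := lA 1 u v; rewrite !scale1r. Qed.

Lemma op0 A : linear A -> A 0 = 0.
Proof.
by move=> lA; apply: (addrI (A 0)); rewrite -opD// !addr0.
Qed.

Lemma opZ A (a : R[i]) u : linear A -> A (a *: u) = a *: A u.
Proof. by move=> lA; have := lA a u 0; rewrite !addr0 op0// addr0. Qed.

Lemma opN A u : linear A -> A (- u) = - A u.
Proof. by move=> lA; rewrite -scaleN1r opZ// scaleN1r. Qed.

Lemma opB A u v : linear A -> A (u - v) = A u - A v.
Proof. by move=> lA; rewrite opD// opN. Qed.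

Lemma linear_opB A B : linear A -> linear B -> linear (fun u => A u - B u).
Proof.
by move=> lA lB a u v; rewrite lA lB scalerBr opprD addrACA.
Qed.

Lemma linear_opD A B : linear A -> linear B -> linear (fun u => A u + B u).
Proof. by move=> lA lB a u v; rewrite lA lB scalerDr addrACA. Qed.

Lemma linear_opZ A (c : R[i]) : linear A -> linear (fun u => c *: A u).
Proof.
by move=> lA a u v; rewrite lA scalerDr !scalerA mulrC.
Qed.

Lemma linear_comp A B : linear A -> linear B -> linear (fun u => A (B u)).
Proof. by move=> lA lB a u v; rewrite lB lA. Qed.

Lemma linear_id : linear (fun u : L2 m => u).
Proof. by []. Qed.

Lemma bounded_opP A : bounded_op A <->
  linear A /\ exists2 K, 0 <= K & forall u, nsq (A u) <= K * nsq u.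
Proof.
split=> [[lA [K h]]|[lA [K K0 h]]]; split => //.
  by exists (K ^+ 2) => [|u]; [exact: sqr_ge0|exact: L2norm_le].
by exists (Num.sqrt K) => u; exact: L2norm_leE.
Qed.

Lemma bounded_op_comp A B : bounded_op A -> bounded_op B ->
  bounded_op (A \o B).
Proof.
move=> /bounded_opP[lA [K K0 h]] /bounded_opP[lB [L L0 k]].
apply/bounded_opP; split; first exact: linear_comp.
exists (K * L) => [|u /=]; first exact: mulr_ge0.
by apply: (le_trans (h _)); rewrite -mulrA ler_wpM2l.
Qed.

(** Polarization: [u + v] and [u + i v] give two relations between [dot (A u) v] and [dot (A v) u]
    that only zero satisfies. Through [op_ext] an operator is determined by its quadratic form. *)
Lemma dot_polar0 A : linear A -> (forall u, dot (A u) u = 0) ->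
  forall u v, dot (A u) v = 0.
Proof.
move=> lA A0 u v.
have h1 : dot (A u) v + dot (A v) u = 0.
  by have := A0 (u + v); rewrite opD// !dotDl !dotDr !A0 add0r addr0.
have h2 : - 'i%C * dot (A u) v + 'i%C * dot (A v) u = 0.
  have := A0 (u + 'i%C *: v); rewrite opD// opZ// !dotDl !dotDr.
  rewrite !dotZl !dotZr !A0 !mulr0 add0r addr0.
  suff -> : ('i%C : R[i])^* = - 'i%C by [].
  by apply: eqCP; rewrite !ReImE //= oppr0.
have h3 : 'i%C * (dot (A u) v + dot (A u) v) = 0.
  have h1' : dot (A v) u = - dot (A u) v.
    by apply/eqP; rewrite -addr_eq0 addrC h1.
  move: h2; rewrite h1' mulrN mulNr -opprD -mulrDr => /eqP.
  by rewrite oppr_eq0 => /eqP.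
have i0 : ('i%C : R[i]) != 0.
  by rewrite eq_complex /= oner_eq0 andbF.
move/eqP: h3; rewrite mulf_eq0 (negbTE i0) /= -mulr2n mulrn_eq0 /=.
by move/eqP.
Qed.

Lemma op_ext A B : linear A -> linear B ->
  (forall u, dot (A u) u = dot (B u) u) -> A = B.
Proof.
move=> lA lB h; apply/funext => u; apply: dot_ext => w.
apply/eqP; rewrite -subr_eq0 -dotBl; apply/eqP.
apply: (dot_polar0 (linear_opB lA lB)) => v.
by rewrite dotBl h subrr.
Qed.

Lemma adjointP A B : (forall u v, dot (A u) v = dot u (B v)) -> adjoint A = B.
Proof.
move=> h; rewrite /adjoint; case: xgetP => [C _ /= hC|/(_ B)]; last by [].
apply/funext => v; apply: dot_ext => u.
by rewrite dotC -hC h -dotC.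
Qed.

Lemma selfadjointP A : adjoint A = A -> forall u v, dot (A u) v = dot u (A v).
Proof.
move=> AA u v; move: AA; rewrite /adjoint.
(* Without an adjoint, [adjoint A] is the default zero map; then [A] is zero as well and the
   identity is trivial. *)
case: xgetP => [C _ /= hC CA|_ <-]; first by rewrite hC CA.
by rewrite dot0l dot0r.
Qed.

End Dot.

(** * Change of variables under measure preserving maps *)

Section MeasurePreserving.
Context d1 d2 (T1 : measurableType d1) (T2 : measurableType d2) (R : realType).
Variables (m1 : {measure set T1 -> \bar R}) (m2 : {measure set T2 -> \bar R}).

Definition measure_preserving (th : T1 -> T2) :=
  measurable_fun setT th /\ forall A, measurable A -> m1 (th @^-1` A) = m2 A.

Variable th : T1 -> T2.
Hypothesis hth : measure_preserving th.

Let mth : measurable_fun setT th. Proof. by case: hth. Qed.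

Lemma integral_pushforward_mp (D : set T2) (f : T2 -> \bar R) :
  (\int[m2]_(y in D) f y = \int[pushforward m1 th]_(y in D) f y)%E.
Proof.
apply: (eq_measure_integral (pushforward m1 th)) => // A mA _.
by rewrite /= /pushforward hth.2.
Qed.

Lemma ge0_integral_mp (f : T2 -> \bar R) : measurable_fun setT f ->
  (forall y, 0 <= f y)%E ->
  (\int[m1]_x f (th x) = \int[m2]_y f y)%E.
Proof.
move=> mf f0; rewrite integral_pushforward_mp ge0_integral_pushforward//.
Qed.

Lemma integrable_mp (f : T2 -> R) : m2.-integrable setT (EFin \o f) ->
  m1.-integrable setT (EFin \o (f \o th)).
Proof.
move=> /integrableP[mf fi]; apply/integrableP; split.
  exact: (measurableT_comp mf).
rewrite (_ : (\int[m1]_x _ = \int[m2]_y `|(EFin \o f) y|)%E)//.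
rewrite -(ge0_integral_mp (f := fun y => `|(EFin \o f) y|%E))//.
exact: measurableT_comp.
Qed.

Lemma Rintegral_mp (f : T2 -> R) : m2.-integrable setT (EFin \o f) ->
  Rintegral m1 setT (f \o th) = Rintegral m2 setT f.
Proof.
move=> fi; rewrite /Rintegral integral_pushforward_mp.
rewrite (integral_pushforward mth (f := EFin \o f))//.
- exact: measurable_int fi.
- by rewrite preimage_setT; exact: integrable_mp.
Qed.

Lemma ae_mp (P : T2 -> Prop) : (\forall y \ae m2, P y) ->
  \forall x \ae m1, P (th x).
Proof.
move=> [N [mN N0 PN]]; exists (th @^-1` N); split.
- by rewrite -[_ @^-1` _]setTI; exact: mth.
- by rewrite -N0 -hth.2.
- by move=> x /= Px; exact: PN.
Qed.

Lemma cmeasurable_comp (f : T2 -> R[i]) : cmeasurable f -> cmeasurable (f \o th).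
Proof. by move=> [f1 f2]; split; [exact: (measurableT_comp f1 mth)|exact: (measurableT_comp f2 mth)]. Qed.

Lemma cbounded_comp (f : T2 -> R[i]) : cbounded f -> cbounded (f \o th).
Proof.
move=> [mf [K fK]]; split; first exact: cmeasurable_comp.
by exists K => x; exact: fK.
Qed.

Lemma cintegral_mp (f : T2 -> R[i]) : cintegrable m2 f ->
  cintegral m1 (f \o th) = cintegral m2 f.
Proof.
move=> [f1 f2]; rewrite !cintegralE; congr (_ +i* _).
- exact: (Rintegral_mp f1).
- exact: (Rintegral_mp f2).
Qed.

Lemma square_integrable_mp (f : T2 -> R[i]) : square_integrable m2 f ->
  square_integrable m1 (f \o th).
Proof.
move=> /square_integrableP[mf fi]; apply/square_integrableP; split.
  exact: cmeasurable_comp.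
exact: (integrable_mp fi).
Qed.

End MeasurePreserving.

(** * Multiplication and composition operators *)

Section MulComp.
Context d (T : measurableType d) (R : realType).
Variable m : {measure set T -> \bar R}.
Implicit Types (u v w : L2 m) (f g : T -> R[i]) (a b : T -> R).

Definition mulop f : operator m := fun u => toL2 m (fun x => f x * u x).

Lemma mulopE f u : cbounded f -> mulop f u = (fun x => f x * u x) %[ae m].
Proof. by move=> bf; apply: toL2K; exact: square_integrable_bounded (L2P u). Qed.

(** [f] may be unbounded on a null set; [f u] is still square integrable because it agrees almost
    everywhere with [g u]. *)
Lemma mulop_ae_eq f g : cmeasurable f -> cbounded g -> f = g %[ae m] ->
  mulop f = mulop g.
Proof.
move=> mf bg fg; apply/funext => u.
have fgu : (fun x => f x * u x) = (fun x => g x * u x) %[ae m].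
  by apply: filterS fg => x /= h /h ->.
have sg := square_integrable_bounded bg (L2P u).
apply: toL2_eq => //; apply: square_integrable_ae fgu => //.
by apply: cmeasurableM => //; exact: L2_measurable.
Qed.

Lemma mulop_linear f : cbounded f -> linear (mulop f).
Proof.
move=> bf a u v; apply/L2_eqP.
apply: filter_app (mulopE (a *: u + v) bf); apply: filter_app (mulopE u bf).
apply: filter_app (mulopE v bf); apply: filter_app (L2_addE (a *: u) v).
apply: filterS3 (L2_scaleE a u) (L2_addE (a *: mulop f u) (mulop f v))
  (L2_scaleE a (mulop f u)) => x h1 h2 h3 h4 h5 h6 h7 _.
rewrite h7// h4// h1// h2// h3// h5// h6//; ring.
Qed.

Lemma mulop_comp f g u : cbounded f -> cbounded g ->
  mulop f (mulop g u) = mulop (fun x => f x * g x) u.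
Proof.
move=> bf bg; apply/L2_eqP.
have := mulopE (mulop g u) bf; have := mulopE u bg.
have := mulopE u (cboundedM bf bg).
by apply: filterS3 => x h1 h2 h3 _; rewrite h3// h2// h1// mulrA.
Qed.

Lemma dot_mulop f u v : cbounded f ->
  dot (mulop f u) v = cintegral m (fun x => f x * u x * (v x)^*).
Proof.
move=> bf; apply: dotE; [|exact: L2_measurable|exact: mulopE|exact: ae_eq_refl].
by apply: cmeasurableM; [case: bf|exact: L2_measurable].
Qed.

Lemma mulop_adj f u v : cbounded f ->
  dot (mulop f u) v = dot u (mulop (fun x => (f x)^*) v).
Proof.
move=> bf; rewrite [RHS]dotC dot_mulop; last by [].
rewrite dot_mulop; last exact: cbounded_conj.
rewrite -cintegral_conj.
  by congr cintegral; apply/funext => x; rewrite !conjM !conjK; ring.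
apply: square_integrable_mul; last by apply: square_integrable_conj; exact: L2P.
by apply: square_integrable_bounded; [exact: cbounded_conj|exact: L2P].
Qed.

Lemma nsq_mulop f u : cbounded f ->
  nsq (mulop f u) = Rintegral m setT (fun x => sqmod (f x) * sqmod (u x)).
Proof.
move=> bf; apply: Rintegral_ae_eq.
- by apply: measurable_sqmod; exact: L2_measurable.
- apply: measurable_funM; apply: measurable_sqmod; last exact: L2_measurable.
  by case: bf.
- by apply: filterS (mulopE u bf) => x h _; rewrite h// sqmodM.
Qed.

Lemma le_Rintegral_sqmod (h1 h2 : T -> R) : measurable_fun setT h1 ->
  m.-integrable setT (EFin \o h2) -> (forall x, 0 <= h1 x <= h2 x) ->
  Rintegral m setT h1 <= Rintegral m setT h2.
Proof.
move=> mh hi h12; apply: le_Rintegral => //; last first.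
  by move=> x _; case/andP: (h12 x).
apply: integrable_bound hi => // x; have /andP[h0 h3] := h12 x.
by rewrite !ger0_norm// (le_trans h0).
Qed.

Lemma nsq_mulop_le f u K : cbounded f -> (forall x, sqmod (f x) <= K) ->
  nsq (mulop f u) <= K * nsq u.
Proof.
move=> bf fK; rewrite nsq_mulop// /nsq -RintegralZl//; last exact: integrable_nsq.
apply: le_Rintegral_sqmod.
- apply: measurable_funM; apply: measurable_sqmod; last exact: L2_measurable.
  by case: bf.
- by have := integrableZl measurableT K (integrable_nsq u).
- by move=> x; rewrite mulr_ge0 ?sqmod_ge0//= ler_wpM2r ?sqmod_ge0.
Qed.

Lemma mulop_bounded f : cbounded f -> bounded_op (mulop f).
Proof.
move=> bf; have [_ [K fK]] := bf; apply/bounded_opP; split.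
  exact: mulop_linear.
exists (Num.max K 0) => [|u]; first by rewrite le_max lexx orbT.
by apply: nsq_mulop_le => // x; rewrite le_max fK.
Qed.

Lemma mulop1 : mulop (fun=> 1) = idfun.
Proof.
apply/funext => u; apply/L2_eqP.
by apply: filterS (mulopE u (cbounded_cst _ 1)) => x h _; rewrite h// mul1r.
Qed.

Definition rbounded a := measurable_fun setT a /\ exists K : R, forall x, `|a x| <= K.

Lemma rbounded_cbounded a : rbounded a -> cbounded (fun x => (a x)%:C).
Proof. by move=> [ma [K aK]]; apply: cbounded_real aK. Qed.

Lemma rboundedM a b : rbounded a -> rbounded b -> rbounded (fun x => a x * b x).
Proof.
move=> [ma [K aK]] [mb [L bL]]; split; first exact: measurable_funM.
by exists (K * L) => x; rewrite normrM ler_pM.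
Qed.

Lemma rboundedD a b : rbounded a -> rbounded b -> rbounded (fun x => a x + b x).
Proof.
move=> [ma [K aK]] [mb [L bL]]; split; first exact: measurable_funD.
by exists (K + L) => x; apply: (le_trans (ler_normD _ _)); exact: lerD.
Qed.

Lemma rbounded_cst (c : R) : rbounded (fun=> c).
Proof. by split; [exact: measurable_cst|exists `|c|]. Qed.

Lemma rboundedN a : rbounded a -> rbounded (fun x => - a x).
Proof.
move=> [ma [K aK]]; split; first exact: measurableT_comp.
by exists K => x; rewrite normrN.
Qed.

Lemma rboundedB a b : rbounded a -> rbounded b -> rbounded (fun x => a x - b x).
Proof. by move=> ba bb; apply: rboundedD => //; exact: rboundedN. Qed.

Lemma cbounded_Re_Im (f : T -> R[i]) (K : R) : cmeasurable f ->
  (forall x, sqmod (f x) <= K) ->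
  (forall x, `|complex.Re (f x)| <= K + 1) /\ (forall x, `|complex.Im (f x)| <= K + 1).
Proof.
(* From [|x| <= x ^ 2 + 1], which avoids a square root and accounts for the [+ 1] in the bound. *)
have h (x y : R) : x ^+ 2 + y ^+ 2 <= K -> `|x| <= K + 1.
  rewrite -[x ^+ 2]real_normK ?num_real//; have := normr_ge0 x; have := sqr_ge0 y.
  by move: (y ^+ 2) `|x| => z w; nra.
move=> _ fK; split=> x; have := fK x; rewrite /sqmod; first exact: h.
by rewrite addrC; exact: h.
Qed.

Lemma cbounded_rbounded (f : T -> R[i]) : cbounded f ->
  rbounded (fun x => complex.Re (f x)) /\ rbounded (fun x => complex.Im (f x)).
Proof.
move=> [[m1 m2] [K fK]]; have [h1 h2] := cbounded_Re_Im (conj m1 m2) fK.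
by split; split => //; exists (K + 1).
Qed.

Definition rmul a : operator m := mulop (fun x => (a x)%:C).

Lemma rmulE a u : rbounded a -> rmul a u = (fun x => (a x)%:C * u x) %[ae m].
Proof. by move=> ba; apply: mulopE; exact: rbounded_cbounded. Qed.

Lemma rmul_comp a b u : rbounded a -> rbounded b ->
  rmul a (rmul b u) = rmul (fun x => a x * b x) u.
Proof.
move=> ba bb; rewrite /rmul mulop_comp; [|exact: rbounded_cbounded..].
by congr mulop; apply/funext => x; rewrite rmorphM.
Qed.

Lemma rmul_adj a u v : rbounded a -> dot (rmul a u) v = dot u (rmul a v).
Proof.
move=> ba; rewrite /rmul mulop_adj; last exact: rbounded_cbounded.
by congr (dot u (mulop _ v)); apply/funext => x; apply: eqCP; rewrite !ReImE //= oppr0.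
Qed.

Lemma rmul_linear a : rbounded a -> linear (rmul a).
Proof. by move=> ba; apply: mulop_linear; exact: rbounded_cbounded. Qed.

Lemma rmul_bounded a : rbounded a -> bounded_op (rmul a).
Proof. by move=> ba; apply: mulop_bounded; exact: rbounded_cbounded. Qed.

Lemma sqmod_real (x : R) : sqmod (x%:C) = x ^+ 2.
Proof. by rewrite /sqmod /= expr0n addr0. Qed.

Lemma integrable_rmul a u : rbounded a ->
  m.-integrable setT (EFin \o (fun x => a x * sqmod (u x))).
Proof.
move=> [ma [K aK]].
apply: integrable_bound (integrable_lin K 0 (integrable_nsq u) (integrable_nsq u)).
  by apply: measurable_funM => //; apply: measurable_sqmod; exact: L2_measurable.
move=> x; rewrite mul0r addr0 !normrM ler_wpM2r// (le_trans (aK x))//.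
exact: ler_norm.
Qed.

Lemma dot_rmul a u : rbounded a ->
  dot (rmul a u) u = (Rintegral m setT (fun x => a x * sqmod (u x)))%:C.
Proof.
move=> ba; rewrite dot_mulop; last exact: rbounded_cbounded.
rewrite cintegralE; apply: eqCP => /=.
- congr Rintegral; apply/funext => x.
  by rewrite -mulrA mul_conj !ReImE /= mulr0 subr0.
- rewrite (_ : (fun x => _) = cst 0) ?Rintegral_cst ?mul0r//.
  by apply/funext => x; rewrite -mulrA mul_conj !ReImE /= mulr0 mul0r addr0.
Qed.

Lemma nsq_rmul a u : rbounded a ->
  nsq (rmul a u) = Rintegral m setT (fun x => a x ^+ 2 * sqmod (u x)).
Proof.
move=> ba; rewrite nsq_mulop; last exact: rbounded_cbounded.
by congr Rintegral; apply/funext => x; rewrite sqmod_real.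
Qed.

Lemma rmul_ae_eq a b : measurable_fun setT a -> rbounded b -> a = b %[ae m] ->
  rmul a = rmul b.
Proof.
move=> ma bb ab; apply: mulop_ae_eq; [|exact: rbounded_cbounded|].
  exact: cmeasurable_real.
by apply: filterS ab => x /= h /h ->.
Qed.

Lemma rmul_scale a (c : R) u : rbounded a ->
  rmul a u - c%:C *: u = rmul (fun x => a x - c) u.
Proof.
move=> ba; apply/L2_eqP.
have bc := rboundedB ba (rbounded_cst c).
rewrite -scaleNr; apply: filter_app (rmulE u ba).
apply: filterS3 (rmulE u bc) (L2_addE (rmul a u) ((- c%:C) *: u))
  (L2_scaleE (- c%:C) u) => x h1 h2 h3 h4 _.
rewrite h1// h2// h3// h4// -mulrDl.
by congr (_ * _); rewrite rmorphB.
Qed.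

Definition compop (th : T -> T) : operator m := fun u => toL2 m (fun x => u (th x)).

Section Comp.
Variables (th thV : T -> T).
Hypotheses (hth : measure_preserving m m th) (hthV : measure_preserving m m thV).
Hypotheses (thK : cancel th thV) (thVK : cancel thV th).

Lemma compopE u : compop th u = (fun x => u (th x)) %[ae m].
Proof. by apply: toL2K; apply: (square_integrable_mp hth); exact: L2P. Qed.

Lemma compop_linear : linear (compop th).
Proof.
move=> a u v; apply/L2_eqP.
apply: filter_app (compopE (a *: u + v)); apply: filter_app (compopE u).
apply: filter_app (compopE v); apply: filter_app (ae_mp hth (L2_addE (a *: u) v)).
apply: filterS3 (ae_mp hth (L2_scaleE a u))
  (L2_addE (a *: compop th u) (compop th v)) (L2_scaleE a (compop th u))
  => x h1 h2 h3 h4 h5 h6 h7 _.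
by rewrite h7// h4// h1// h2// h3// h5// h6.
Qed.

Lemma dot_compop u v : dot (compop th u) (compop th v) = dot u v.
Proof.
rewrite (dotE _ _ (compopE u) (compopE v)); last 2 first.
- by apply: (cmeasurable_comp hth); exact: L2_measurable.
- by apply: (cmeasurable_comp hth); exact: L2_measurable.
exact: (cintegral_mp hth (cintegrable_dot u v)).
Qed.

Lemma nsq_compop u : nsq (compop th u) = nsq u.
Proof. by rewrite !nsqE dot_compop. Qed.

Lemma compop_bounded : bounded_op (compop th).
Proof.
apply/bounded_opP; split; first exact: compop_linear.
by exists 1 => // u; rewrite nsq_compop mul1r.
Qed.

Lemma compop_mulop f u : cbounded f ->
  compop th (mulop f u) = mulop (f \o th) (compop th u).
Proof.
move=> bf; apply/L2_eqP.
apply: filter_app (compopE (mulop f u)); apply: filterS3 (ae_mp hth (mulopE u bf))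
  (mulopE (compop th u) (cbounded_comp hth bf)) (compopE u) => x h1 h2 h3 h4 _.
by rewrite h4// h1// h2//= h3.
Qed.

Lemma compop_rmul a u : rbounded a ->
  compop th (rmul a u) = rmul (a \o th) (compop th u).
Proof. by move=> ba; rewrite /rmul compop_mulop//; exact: rbounded_cbounded. Qed.

End Comp.

Section CompInv.
Variables (th thV : T -> T).
Hypotheses (hth : measure_preserving m m th) (hthV : measure_preserving m m thV).
Hypotheses (thK : cancel th thV) (thVK : cancel thV th).

Lemma compopK : cancel (compop thV) (compop th).
Proof.
move=> u; apply/L2_eqP.
have := compopE hth (compop thV u); have := ae_mp hth (compopE hthV u).
by apply: filterS2 => x h1 h2 _; rewrite h2// h1// thK.
Qed.

End CompInv.

Lemma compop_adj th thV : measure_preserving m m th ->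
  measure_preserving m m thV -> cancel th thV -> cancel thV th ->
  adjoint (compop th) = compop thV.
Proof.
move=> hth hthV thK thVK; apply: adjointP => u v.
by rewrite -(dot_compop hthV) compopK.
Qed.

End MulComp.

Arguments mulop {d T R} m f _.
Arguments rmul {d T R} m a _.
Arguments compop {d T R} m th _.
Arguments rbounded_cst {d T R} c.
Arguments rmul_linear {d T R} m [a] _.
Arguments rmul_bounded {d T R} m [a] _.
Arguments mulop_linear {d T R} m [f] _.
Arguments mulop_bounded {d T R} m [f] _.

(** * Polar and spectral decompositions of multiplication operators *)

Section SquareRoot.
Context d (T : measurableType d) (R : realType).
Variable m : {measure set T -> \bar R}.
Implicit Types (u v w : L2 m) (a b k : T -> R) (A : operator m).

(** Ends the iteration arguments: a quantity that gains a fixed factor below one at every round is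
    not positive. *)
Lemma geometric_bound_le0 (x C q : R) : 0 <= q < 1 ->
  (forall n, x <= C * q ^+ n) -> x <= 0.
Proof.
move=> /andP[q0 q1] h.
have cv : (fun n => C * q ^+ n) @ \oo --> C * 0.
  by apply: cvgMr; apply: cvg_expr; rewrite ger0_norm.
rewrite mulr0 in cv.
rewrite -(cvg_lim _ cv)//; apply: limr_ge; last exact: nearW.
by apply/cvg_ex; exists 0.
Qed.

Lemma rmul_shift a (c : R) u : rbounded a ->
  rmul m (fun x => c - a x) u = c%:C *: u - rmul m a u.
Proof.
move=> ba; rewrite -opprB rmul_scale// -scaleN1r.
apply/L2_eqP; have bc := rboundedB ba (rbounded_cst c).
have bc' := rboundedB (rbounded_cst c) ba.
apply: filterS3 (rmulE u bc) (rmulE u bc')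
  (L2_scaleE (- 1) (rmul m (fun x => a x - c) u)) => x h1 h2 h3 _.
rewrite h2// h3// h1// mulrA mulN1r; congr (_ * _).
by rewrite -rmorphN opprB.
Qed.

(* With [D = A - B] one has [(A + s) D = D (s - B)], where [A + s] is bounded
   below by [s] and [s - B] has norm at most [s - c < s]. *)
Lemma positive_sqrt_unique A b (c : R) : 0 < c -> bounded_op A ->
  (forall u, 0 <= dot (A u) u) -> rbounded b -> (forall x, c <= b x) ->
  (forall u, A (A u) = rmul m b (rmul m b u)) -> A = rmul m b.
Proof.
move=> c0 bA Apos bb cb AB.
have [lA _] := bA; have lB := rmul_linear m bb.
have [s [s0 bs cs]] : exists s, [/\ 0 < s, forall x, b x <= s & c <= s].
  have [_ [K bK]] := bb; exists (`|K| + c); split.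
  - by rewrite ltr_wpDl.
  - move=> x; apply: (le_trans (ler_norm _)); apply: (le_trans (bK x)).
    by rewrite ler_wpDr ?ler_norm// ltW.
  - by rewrite lerDr.
have [D DE] : exists D : operator m, forall u, D u = A u - rmul m b u.
  by exists (fun u => A u - rmul m b u).
have lD : linear D.
  by move=> a u v; rewrite !DE; exact: (linear_opB lA lB).
have AD u : A (D u) = - D (rmul m b u).
  by rewrite !DE (opB _ _ lA) AB opprB.
have ADs u : A (D u) + s%:C *: D u = D (rmul m (fun x => s - b x) u).
  by rewrite (rmul_shift _ _ bb) (opB _ _ lD) (opZ _ _ lD) AD addrC.
(* The cross term [2 s Re <A w, w>] of the expanded square is nonnegative by positivity of [A]. *)
have low w : s ^+ 2 * nsq w <= nsq (A w + s%:C *: w).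
  rewrite nsqD nsqZ sqmod_real dotZr.
  have -> : (s%:C)^* = s%:C by apply: eqCP; rewrite !ReImE //= oppr0.
  have := Apos w; have := nsq_ge0 (A w).
  case: (dot (A w) w) => p q; rewrite lecE /= mul0r subr0 => h /andP[_ p0].
  by have := mulr_ge0 (ltW s0) p0; lra.
have bsb : rbounded (fun x => s - b x) by apply: rboundedB => //; exact: rbounded_cst.
have /bounded_opP[_ [L L0 DL]] : bounded_op D.
  apply/bounded_opP; split => //.
  have /bounded_opP[_ [LA LA0 hA]] := bA.
  have /bounded_opP[_ [LB LB0 hB]] := rmul_bounded m bb.
  exists (2 * (LA + LB)) => [|u]; first by rewrite mulr_ge0 ?addr_ge0.
  rewrite DE; apply: (le_trans (nsqB_le _ _)); rewrite -mulrA ler_pM2l// mulrDl.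
  exact: lerD.
have sc : (s - c) ^+ 2 >= 0 by exact: sqr_ge0.
have small w : nsq (rmul m (fun x => s - b x) w) <= (s - c) ^+ 2 * nsq w.
  apply: nsq_mulop_le => [|x]; first exact: rbounded_cbounded.
  by rewrite sqmod_real lerXn2r ?nnegrE ?subr_ge0// lerB.
(* Each round trades a factor [s] on the left for a factor [s - c] on the right, at the price of
   replacing [v] by [(s - b) v]; the bound [L] of [D] closes the recursion. *)
have key n v : (s ^+ 2) ^+ n * nsq (D v) <= L * ((s - c) ^+ 2) ^+ n * nsq v.
  elim: n v => [|n IH] v; first by rewrite !expr0 mul1r mulr1.
  rewrite exprSr -mulrA.
  apply: (le_trans (ler_wpM2l (exprn_ge0 _ (sqr_ge0 _)) (low (D v)))).
  rewrite ADs; apply: (le_trans (IH _)).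
  have -> : L * (s - c) ^+ 2 ^+ n.+1 * nsq v =
      L * (s - c) ^+ 2 ^+ n * ((s - c) ^+ 2 * nsq v) by rewrite exprSr; ring.
  by apply: ler_wpM2l (small v); apply: mulr_ge0 => //; exact: exprn_ge0.
have D0 v : nsq (D v) = 0.
  apply/eqP; rewrite eq_le nsq_ge0 andbT.
  apply: (@geometric_bound_le0 _ (L * nsq v) (((s - c) / s) ^+ 2)) => [|n].
    rewrite sqr_ge0/= expr_lt1// ?divr_ge0 ?subr_ge0// ?(ltW s0)//.
    by rewrite ltr_pdivrMr// mul1r gtrBl.
  have sn : 0 < (s ^+ 2) ^+ n by rewrite !exprn_gt0.
  rewrite -(ler_pM2l sn); apply: (le_trans (key n v)).
  rewrite expr_div_n expr_div_n le_eqVlt; apply/orP; left; apply/eqP.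
  by field; exact: lt0r_neq0.
apply/funext => v; apply/eqP; rewrite -subr_eq0 -DE; apply/eqP.
exact: nsq_eq0.
Qed.

End SquareRoot.

Lemma integrable_rbounded d (T : measurableType d) (R : realType)
    (mu : {measure set T -> \bar R}) (f : T -> R) :
  (mu setT < +oo)%E -> rbounded f -> mu.-integrable setT (EFin \o f).
Proof.
move=> fin [mf [K fK]]; apply: (integrable_bound (g := cst K)) => //.
  by move=> x; rewrite (le_trans (fK x))//= ler_norm.
apply/integrableP; split; first exact/measurable_EFinP/measurable_cst.
rewrite (eq_integral (cst `|K|%:E))// integral_cst//.
by rewrite lte_mul_pinfty// lee_fin.
Qed.

(** * Integration against the image of a measure with density *)

Section Density.
Context d d' (T : measurableType d) (U : measurableType d') (R : realType).
Variables (m : {measure set T -> \bar R}) (mu : {measure set U -> \bar R}).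
Variables (b : T -> U) (g : T -> R).
Hypotheses (mb : measurable_fun setT b) (mg : measurable_fun setT g).
Hypothesis g0 : forall x, 0 <= g x.
Hypothesis muE : forall B, measurable B ->
  mu B = (\int[m]_(x in b @^-1` B) (g x)%:E)%E.
Import HBNNSimple.

Let integral_nnsfun_density (h : {nnsfun U >-> R}) :
  (\int[mu]_y (h y)%:E = \int[m]_x (h (b x) * g x)%:E)%E.
Proof.
transitivity (\int[m]_x (\sum_(y \in range h)
    (y * (\1_(h @^-1` [set y]) (b x) * g x))%:E))%E; last first.
  apply: eq_integral => x _; rewrite (fimfunE h (b x)) fsumEFin//.
  congr EFin; rewrite !fsbig_finite//= mulr_suml.
  by apply: eq_bigr => i _; rewrite mulrA.
rewrite integralT_nnsfun sintegralE ge0_integral_fsum//; last 2 first.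
- move=> y; apply/measurable_EFinP; apply: measurable_funM => //.
  by apply: measurable_funM => //; exact: (measurableT_comp _ mb).
- move=> y x _; rewrite mulrA EFinM mule_ge0 ?lee_fin//.
  by have := nnfun_muleindic_ge0 h y (b x); rewrite -EFinM lee_fin.
apply: eq_fsbigr => y; rewrite inE => -[t _ hty].
have y0 : 0 <= y by rewrite -hty.
under eq_integral do rewrite EFinM.
rewrite ge0_integralZl_EFin//; last 2 first.
- by move=> x _; rewrite lee_fin mulr_ge0.
- apply/measurable_EFinP; apply: measurable_funM => //.
  exact: (measurableT_comp _ mb).
rewrite muE// integral_mkcond; congr (_ * _)%E.
apply: eq_integral => x _; rewrite patchE /= indicE.
by case: ifPn => xh; rewrite /= ?mul1r ?mul0r//;
  move: xh; rewrite ?inE ?notin_setE /= => xh;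
  [rewrite mem_set//= mul1r|rewrite memNset//= mul0r].
Qed.

Lemma ge0_integral_density (f : U -> R) : measurable_fun setT f ->
  (forall y, 0 <= f y) ->
  (\int[mu]_y (f y)%:E = \int[m]_x (f (b x) * g x)%:E)%E.
Proof.
move=> mf f0; have mEf := (measurable_EFinP _ _).2 mf.
pose h := nnsfun_approx measurableT mEf.
have cvh y : (h n y)%:E @[n --> \oo] --> (f y)%:E.
  by apply: cvg_nnsfun_approx => // z _; rewrite lee_fin.
have -> : (\int[mu]_y (f y)%:E = lim (\int[mu]_y (EFin \o h n) y @[n --> \oo]))%E.
  under eq_integral => y _ do rewrite -(cvg_lim _ (cvh y))//.
  apply: monotone_convergence => //.
  - by move=> n; exact/measurable_EFinP.
  - by move=> n y _; rewrite lee_fin.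
  - by move=> y _ a c ac; rewrite lee_fin; exact/lefP/nd_nnsfun_approx.
have -> : (\int[m]_x (f (b x) * g x)%:E =
    lim (\int[m]_x (h n (b x) * g x)%:E @[n --> \oo]))%E.
  have fg x : ((f (b x) * g x)%:E = lim ((h n (b x) * g x)%:E @[n --> \oo]))%E.
    apply/esym/cvg_lim => //; rewrite EFinM.
    by under eq_fun do rewrite EFinM; apply: cvgeZr.
  under eq_integral => x _ do rewrite fg.
  apply: monotone_convergence => //.
  - move=> n; apply/measurable_EFinP; apply: measurable_funM => //.
    exact: (measurableT_comp _ mb).
  - by move=> n x _; rewrite lee_fin mulr_ge0.
  - move=> x _ a c ac; rewrite lee_fin ler_wpM2r//.
    exact/lefP/nd_nnsfun_approx.
by under eq_fun do rewrite integral_nnsfun_density.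
Qed.

Hypothesis gi : m.-integrable setT (EFin \o g).

Lemma density_fin : (mu setT < +oo)%E.
Proof.
rewrite muE// preimage_setT; move/integrableP: gi => [_].
by under eq_integral do rewrite /= ger0_norm//.
Qed.

(** [mu] is the image under [b] of the measure with density [g]. It is used for spectral measures,
    where [g] is [|u| ^ 2], and for [X] seen as level zero of the product, where [g] is an
    indicator. *)
Lemma Rintegral_density (f : U -> R) : rbounded f ->
  Rintegral mu setT f = Rintegral m setT (fun x => f (b x) * g x).
Proof.
move=> bf; have [mf [K fK]] := bf.
have bK : rbounded (fun y => f y + K).
  by apply: rboundedD => //; exact: rbounded_cst.
have intf (h : U -> R) : rbounded h ->
    m.-integrable setT (EFin \o (fun x => h (b x) * g x)).
  move=> [mh [L hL]].
  apply: integrable_bound (integrable_lin L 0 gi gi).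
    by apply: measurable_funM => //; exact: (measurableT_comp mh mb).
  move=> x; rewrite mul0r addr0 !normrM ler_wpM2r// (le_trans (hL _))//.
  exact: ler_norm.
(* Nonnegative functions come first; [f] is then recovered from [f + |K|] by cancelling the
   constant, the total mass being finite. *)
have pos (h : U -> R) : rbounded h -> (forall y, 0 <= h y) ->
    Rintegral mu setT h = Rintegral m setT (fun x => h (b x) * g x).
  by move=> [mh _] h0; rewrite /Rintegral ge0_integral_density.
have n1 : forall y : U, (0 : R) <= `|K| by [].
have n2 y : 0 <= f y + `|K|.
  have /ler_normlP[h _] := le_trans (fK y) (ler_norm K).
  by rewrite addrC -[f y]opprK subr_ge0.
have bK' : rbounded (fun y => f y + `|K|).
  by apply: rboundedD => //; exact: rbounded_cst.
have := pos _ bK' n2; have := pos _ (rbounded_cst `|K|) n1.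
have fin := density_fin.
rewrite RintegralD//; try exact: integrable_rbounded.
  have -> : (fun x => (f (b x) + `|K|) * g x) =
      (fun x => 1 * (f (b x) * g x) + 1 * (`|K| * g x)).
    by apply/funext => x; rewrite !mul1r mulrDl.
  rewrite Rintegral_lin; [|exact: intf|exact: (intf _ (rbounded_cst `|K|))].
  by rewrite !mul1r => <- /addIr.
exact/integrable_rbounded/rbounded_cst.
Qed.

End Density.

Import HBNNSimple.

(** Stated for bare set functions, because [spectral_measure_at] is one: it agrees with a genuine
    measure on measurable sets only. *)
Lemma eq_integral_measurable d (T : measurableType d) (R : realType)
    (m1 m2 : set T -> \bar R) (D : set T) (f : T -> \bar R) :
  (forall A, measurable A -> m1 A = m2 A) ->
  (\int[m1]_(x in D) f x = \int[m2]_(x in D) f x)%E.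
Proof.
move=> m12; rewrite /integral; congr (ereal_sup _ - ereal_sup _)%E;
  by apply/seteqP; split => _ [h hf <-]; exists h => //;
    apply: eq_fsbigr => r _; rewrite m12.
Qed.

Section Support.
Context d (T : measurableType d) (R : realType).
Variable m : {measure set T -> \bar R}.
Local Notation Re := complex.Re.
Implicit Types (u v w : L2 m) (a b k : T -> R) (A : operator m).

Lemma rboundedX k n : rbounded k -> rbounded (fun x => k x ^+ n).
Proof.
move=> bk; elim: n => [|n IH].
  by under eq_fun do rewrite expr0; exact: rbounded_cst.
by under eq_fun do rewrite exprS; exact: rboundedM.
Qed.

Lemma rbounded_indic (B : set T) : measurable B -> rbounded (\1_B : T -> R).
Proof.
move=> mB; split; first exact: measurable_indic.
by exists 1 => x; rewrite indicE; case: (_ \in _); rewrite ?normr1 ?normr0.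
Qed.

Lemma preimage_measurable b (B : set R) : measurable_fun setT b ->
  measurable B -> measurable (b @^-1` B).
Proof. by move=> mb mB; rewrite -[_ @^-1` _]setTI; exact: mb. Qed.

(* Iterating the hypothesis gives
   [\int k ^ (2 n + 1) |u| ^ 2 <= q \int k ^ (2 n) |u| ^ 2] for all [n], which
   forces [u] to vanish where [q < k]. *)
Lemma support_bound (V : L2 m -> Prop) k (q : R) u : rbounded k ->
  (forall x, 0 <= k x) -> 0 <= q ->
  (forall w, V w -> V (rmul m k w)) ->
  (forall w, V w -> Re (dot (rmul m k w) w) <= q * nsq w) ->
  V u -> \forall x \ae m, q < k x -> u x = 0.
Proof.
move=> bk k0 q0 Vk Vq Vu.
have [mk _] := bk.
have Vn n : V (rmul m (fun x => k x ^+ n) u).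
  elim: n => [|n IH].
    suff -> : rmul m (fun x => k x ^+ 0) u = u by [].
    rewrite /rmul (_ : (fun x => _) = (fun=> 1)); first by rewrite mulop1.
    by apply/funext => x; rewrite expr0.
  have -> : rmul m (fun x => k x ^+ n.+1) u =
      rmul m k (rmul m (fun x => k x ^+ n) u).
    rewrite (rmul_comp _ bk (rboundedX n bk)); congr (rmul m _ u).
    by apply/funext => x; rewrite exprS.
  exact: Vk.
have gap (e : R) : 0 < e -> \forall x \ae m, q + e <= k x -> u x = 0.
  move=> e0; pose G := k @^-1` `[q + e, +oo[%classic.
  have mG : measurable G by exact: preimage_measurable.
  have bG := rbounded_indic mG.
  have GE x : G x = (q + e <= k x) :> Prop by rewrite /G /= in_itv /= andbT.
  have iG : Rintegral m setT (fun x => \1_G x * sqmod (u x)) = 0.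
    apply/eqP; rewrite eq_le; apply/andP; split; last first.
      by apply: Rintegral_ge0 => x _; rewrite mulr_ge0 ?sqmod_ge0// indicE.
    have qe : 0 < q + e by rewrite ltr_wpDl.
    rewrite -(pmulr_rle0 _ e0).
    apply: (@geometric_bound_le0 _ _ (q * nsq u) ((q / (q + e)) ^+ 2)) => [|n].
      rewrite sqr_ge0/= expr_lt1// ?divr_ge0// ?(ltW qe)//.
      by rewrite ltr_pdivrMr// mul1r ltrDl.
    have bkn := rboundedX n bk.
    have := Vq _ (Vn n).
    rewrite (dot_rmul _ bk) /= (nsq_rmul _ bkn).
    have -> : Rintegral m setT
        (fun x => k x * sqmod (rmul m (fun x => k x ^+ n) u x)) =
      Rintegral m setT (fun x => (k x * (k x ^+ n) ^+ 2) * sqmod (u x)).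
      apply: Rintegral_ae_eq.
      - apply: measurable_funM => //; apply: measurable_sqmod.
        exact: L2_measurable.
      - apply: measurable_funM; last by apply: measurable_sqmod; exact: L2_measurable.
        by case: (rboundedM bk (rboundedX 2 bkn)).
      - apply: filterS (rmulE u bkn) => x h _.
        by rewrite h// sqmodM sqmod_real mulrA.
    have i1 := integrable_rmul u (rboundedM bk (rboundedX 2 bkn)).
    have i2 := integrable_rmul u (rboundedX 2 bkn).
    have i3 := integrable_rmul u bG.
    have i4 := integrable_nsq u.
    rewrite -subr_ge0 -[X in _ - X]mul1r -mulNr -Rintegral_lin// => h.
    (* Pointwise [k ^ (2 n) (q - k) <= q ^ (2 n + 1) - C e 1_G]: on [G] the left side is at most
       [- C e], and elsewhere it is at most [q ^ (2 n + 1)]. Integrating against [|u| ^ 2] and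
       dividing by [C] gives the rate [(q / (q + e)) ^ 2]. *)
    pose C := (q + e) ^+ (2 * n).
    have C0 : 0 < C by rewrite exprn_gt0.
    rewrite -(ler_pM2l C0).
    have -> : C * (q * nsq u * (q / (q + e)) ^+ 2 ^+ n) =
        q * q ^+ (2 * n) * nsq u.
      rewrite -exprM expr_div_n -/C; field; exact: lt0r_neq0.
    rewrite mulrA -subr_ge0 -mulNr.
    rewrite -[nsq u]/(Rintegral m setT (fun x => sqmod (u x))) -Rintegral_lin//.
    apply: (le_trans h); apply: le_Rintegral => //.
    - exact: (integrable_lin q (-1) i2 i1).
    - exact: (integrable_lin _ _ i4 i3).
    move=> x _; have s0 := sqmod_ge0 (u x).
    have XE : k x ^+ n ^+ 2 = k x ^+ (2 * n) by rewrite -exprM mulnC.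
    rewrite XE; have kn0 : 0 <= k x ^+ (2 * n) by rewrite exprn_ge0.
    have qn0 : 0 <= q * q ^+ (2 * n) by rewrite mulr_ge0 ?exprn_ge0.
    have -> : q * (k x ^+ (2 * n) * sqmod (u x)) +
        -1 * (k x * k x ^+ (2 * n) * sqmod (u x)) =
        k x ^+ (2 * n) * (q - k x) * sqmod (u x) by ring.
    have -> : q * q ^+ (2 * n) * sqmod (u x) +
        - (C * e) * (\1_G x * sqmod (u x)) =
        (q * q ^+ (2 * n) - C * e * \1_G x) * sqmod (u x) by ring.
    apply: ler_wpM2r => //.
    rewrite indicE; case: (boolP (x \in G)) => xG.
      rewrite inE GE in xG; rewrite mulr1.
      have h1 : C * e <= k x ^+ (2 * n) * (k x - q).
        apply: ler_pM => //; [exact: ltW|exact: ltW| |by rewrite lerBrDl].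
        by rewrite lerXn2r ?nnegrE// ltW.
      by rewrite -(opprB (k x)) mulrN; lra.
    rewrite mulr0 subr0.
    have [kq|kq] := leP q (k x).
      by apply: le_trans qn0; rewrite mulr_ge0_le0// subr_le0.
    rewrite [leRHS]mulrC; apply: ler_pM => //; [by rewrite subr_ge0 ltW| |by rewrite gerBl].
    by rewrite lerXn2r ?nnegrE// ltW.
  have := Rintegral_eq0 _ (integrable_rmul u bG) iG.
  have gn x : 0 <= \1_G x * sqmod (u x).
    by rewrite mulr_ge0 ?sqmod_ge0// indicE.
  move=> /(_ gn); apply: filterS => x /= /(_ I) h qk; apply: sqmod_eq0.
  by move: h; rewrite indicE mem_set ?mul1r// GE.
have : \forall x \ae m, forall n : nat, q + n.+1%:R^-1 <= k x -> u x = 0.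
  by apply: ae_foralln => n; apply: gap; rewrite invr_gt0 ltr0n.
apply: filterS => x h qk.
have d0 : 0 < k x - q by rewrite subr_gt0.
have [n _ /(_ n (leqnn n)) hn] := near_infty_natSinv_lt (PosNum d0).
by apply: (h n); rewrite -lerBrDl ltW.
Qed.

End Support.

Section FiniteIntegral.
Context d (T : measurableType d) (R : realType).
Variable mu : {measure set T -> \bar R}.
Hypothesis mufin : (mu setT < +oo)%E.

Lemma Rintegral_le_ae (f : T -> R) (N : set T) (q : R) : rbounded f ->
  measurable N -> mu N = 0%E -> (forall x, ~ N x -> f x <= q) ->
  Rintegral mu setT f <= q * fine (mu setT).
Proof.
move=> bf mN N0 fq; have [mf [K fK]] := bf.
have bN := rbounded_indic R mN.
have iN := integrable_rbounded mufin bN.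
have iq := integrable_rbounded mufin (rbounded_cst q).
(* The extra term dominates [f] on the null set [N] without changing the integral. *)
have -> : q * fine (mu setT) =
    Rintegral mu setT (fun x => 1 * cst q x + (`|K| + `|q|) * \1_N x).
  rewrite Rintegral_lin// mul1r Rintegral_cst//.
  rewrite [X in _ + _ * X](_ : _ = 0) ?mulr0 ?addr0//.
  by rewrite /Rintegral integral_indic// setIT N0.
apply: le_Rintegral => //; first exact: integrable_rbounded.
  exact: integrable_lin.
move=> x _; rewrite mul1r /cst indicE; case: (boolP (x \in N)) => xN.
  rewrite mulr1 (le_trans (ler_norm _))// (le_trans (fK x))//.
  have := ler_norm K; have := ler_norm (- q); rewrite normrN => h1 h2.
  by rewrite addrCA -[leLHS]addr0 lerD// addrC -[q in _ + q]opprK subr_ge0.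
by rewrite mulr0 addr0; apply: fq; rewrite notin_setE in xN.
Qed.

End FiniteIntegral.

(** * Identification of an arbitrary spectral measure of a multiplication operator *)

Section PVM.
Context d (T : measurableType d) (R : realType).
Variable m : {measure set T -> \bar R}.
Local Notation Re := complex.Re.
Implicit Types (u v w : L2 m) (a b k : T -> R) (B J : set R).
Variable E : set R -> operator m.
Hypothesis hE : projection_valued_measure E.

Lemma pvm_linear B : measurable B -> linear (E B).
Proof. by case: hE => h _ _ _ /h[[]]. Qed.

Lemma pvm_adj B u v : measurable B -> dot (E B u) v = dot u (E B v).
Proof. by case: hE => h _ _ _ /h[_ AA _]; exact: selfadjointP. Qed.

Lemma pvm_comp B J u : measurable B -> measurable J ->
  E B (E J u) = E (B `&` J) u.
Proof. by move=> mB mJ; case: hE => _ _ h _; rewrite h. Qed.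

Lemma pvm_setT u : E setT u = u.
Proof. by case: hE => _ -> _ _. Qed.

Lemma pvm_nsq B u : measurable B -> dot (E B u) u = (nsq (E B u))%:C.
Proof.
by move=> mB; rewrite -dot_nsq [RHS]pvm_adj// pvm_comp// setIid -pvm_adj.
Qed.

Lemma spectral_measure_atE B u : measurable B ->
  spectral_measure_at E u B = (nsq (E B u))%:E.
Proof. by move=> mB; rewrite /spectral_measure_at pvm_nsq. Qed.

(** [E] is unconstrained outside the measurable sets, whereas a measure must be nonnegative on every
    set; hence the value zero there. *)
Definition spectral_measure u B : \bar R :=
  if `[< measurable B >] then (nsq (E B u))%:E else 0%E.

Lemma spectral_measureE u B : measurable B ->
  spectral_measure u B = (nsq (E B u))%:E.
Proof. by move=> mB; rewrite /spectral_measure asboolT. Qed.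

(** Additivity along the constant sequence of empty sets: the partial sums [n c] converge, so their
    increments [c] tend to zero. *)
Lemma pvm_set0 u : E set0 u = 0.
Proof.
apply: nsq_eq0; case: hE => _ _ _ /(_ u (fun=> set0)).
move=> /(_ (fun=> measurable0)).
have t0 : trivIset setT (fun _ : nat => set0 : set R).
  by apply/trivIsetP => i j _ _ _; rewrite setI0.
rewrite bigcup0// => /(_ t0 measurable0).
rewrite spectral_measure_atE//.
under eq_fun => n do rewrite sumEFin big_const_nat subn0 iter_addr_0.
move/fine_cvgP => [_] /= cv.
have cv1 : (fun n => nsq (E set0 u) *+ n.+1) @ \oo --> nsq (E set0 u).
  by have := cv; rewrite -(cvg_shiftn 1); under eq_fun do rewrite /= addn1.
have cv2 : (fun n => nsq (E set0 u) *+ n.+1 - nsq (E set0 u) *+ n) @ \oo -->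
    (0 : R).
  by rewrite -(subrr (nsq (E set0 u))); exact: cvgB cv1 cv.
have e : (fun n => nsq (E set0 u) *+ n.+1 - nsq (E set0 u) *+ n) =
    cst (nsq (E set0 u)).
  by apply/funext => n /=; rewrite mulrS addrK.
by rewrite e in cv2; rewrite -(cvg_lim _ cv2)// lim_cst.
Qed.

Let sm0 u : spectral_measure u set0 = 0%E.
Proof.
rewrite spectral_measureE// pvm_set0; congr EFin.
by rewrite nsqE dot0l.
Qed.

Let sm_ge0 u B : (0 <= spectral_measure u B)%E.
Proof. by rewrite /spectral_measure; case: ifP => // _; rewrite lee_fin nsq_ge0. Qed.

Let sm_sigma u : semi_sigma_additive (spectral_measure u).
Proof.
move=> F mF tF mUF; case: hE => _ _ _ /(_ u F mF tF mUF).
rewrite spectral_measure_atE// -spectral_measureE//.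
by under eq_fun => n do under eq_bigr => i _ do
  rewrite spectral_measure_atE// -spectral_measureE//.
Qed.

HB.instance Definition _ u := isMeasure.Build _ _ _ (spectral_measure u)
  (sm0 u) (sm_ge0 u) (@sm_sigma u).

Definition pvm_measure u : {measure set R -> \bar R} := spectral_measure u.

Lemma pvm_measureE u B : measurable B -> pvm_measure u B = (nsq (E B u))%:E.
Proof. exact: spectral_measureE. Qed.

Lemma pvm_measure_setT u : pvm_measure u setT = (nsq u)%:E.
Proof. by rewrite pvm_measureE// pvm_setT. Qed.

Lemma pvm_measure_fin u : (pvm_measure u setT < +oo)%E.
Proof. by rewrite pvm_measure_setT ltry. Qed.

(** Additivity is assumed for the scalar measures only; polarization lifts it to the operators. *)
Lemma pvmC B u : measurable B -> E B u + E (~` B) u = u.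
Proof.
move=> mB; have mCB := measurableC mB.
suff h : (fun v => E B v + E (~` B) v) = (fun v => v).
  exact: (congr1 (fun f => f u) h).
apply: op_ext; [|exact: linear_id|move=> v].
  by apply: linear_opD; exact: pvm_linear.
rewrite dotDl !pvm_nsq// dot_nsq.
have : pvm_measure v setT =
    (pvm_measure v B + pvm_measure v (~` B))%E.
  by rewrite -(setUv B) measureU//; rewrite setICr.
by rewrite !pvm_measureE// pvm_setT -EFinD => -[->]; rewrite rmorphD.
Qed.

Section Identification.
Variables (D : set R) (b : T -> R) (c K : R).
Hypotheses (mD : measurable D) (ED : E D = idfun).
Hypotheses (c0 : 0 < c) (DcK : forall s, D s -> c <= s <= K).
Hypotheses (bb : rbounded b) (b0 : forall x, c <= b x) (bK : forall x, b x <= K).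
Hypothesis Eb : is_spectral_integral E D id (rmul m b).

Lemma rbounded_patch (f : R -> R) (L : R) : measurable_fun D f ->
  (forall s, D s -> `|f s| <= L) -> rbounded (f \_ D).
Proof.
move=> mf fL; split; first by apply/(measurable_restrictT _ mD).
exists `|L| => s; rewrite patchE; case: ifPn => sD; last by rewrite normr0.
by rewrite inE in sD; apply: (le_trans (fL s sD)); exact: ler_norm.
Qed.

Lemma bid : rbounded (id \_ D : R -> R).
Proof.
apply: (@rbounded_patch _ K) => // s /DcK/andP[cs sK].
by rewrite ger0_norm// (le_trans (ltW c0)).
Qed.

Lemma spectral_integralE (f : R -> R) (A : operator m) u :
  is_spectral_integral E D f A ->
  dot (A u) u = (Rintegral (pvm_measure u) setT (f \_ D))%:C.
Proof.
move=> [_ ->]; congr (_%:C); rewrite -Rintegral_mkcond; congr fine.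
apply: eq_integral_measurable => B mB.
by rewrite spectral_measure_atE//; exact/esym/pvm_measureE.
Qed.

Lemma dot_b u : dot (rmul m b u) u =
  (Rintegral (pvm_measure u) setT (id \_ D))%:C.
Proof. exact: spectral_integralE. Qed.

Lemma spectral_measureC0 J u : measurable J -> E J u = u ->
  pvm_measure u (~` (D `&` J)) = 0%E.
Proof.
move=> mJ Ju; have mDJ := measurableI _ _ mD mJ.
rewrite pvm_measureE; last exact: measurableC.
have -> : u = E (D `&` J) u by rewrite -pvm_comp// Ju ED.
rewrite pvm_comp//; last exact: measurableC.
by rewrite setICl pvm_set0 nsqE dot0l.
Qed.

Lemma dot_b_le J u (q : R) : measurable J -> E J u = u ->
  (forall s, J s -> s <= q) -> Re (dot (rmul m b u) u) <= q * nsq u.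
Proof.
move=> mJ Ju Jq; rewrite dot_b /=.
have -> : nsq u = fine (pvm_measure u setT) by rewrite pvm_measure_setT.
apply: (Rintegral_le_ae (pvm_measure_fin u) bid
  (measurableC (measurableI _ _ mD mJ)) (spectral_measureC0 mJ Ju)).
by move=> s /contrapT[Ds Js]; rewrite patchE mem_set//; exact: Jq.
Qed.

Lemma dot_b_ge J u (q : R) : measurable J -> E J u = u ->
  (forall s, J s -> q <= s) -> q * nsq u <= Re (dot (rmul m b u) u).
Proof.
move=> mJ Ju Jq; rewrite dot_b /= -lerN2 -mulNr.
have -> : nsq u = fine (pvm_measure u setT) by rewrite pvm_measure_setT.
have -> : - Rintegral (pvm_measure u) setT (id \_ D) =
    Rintegral (pvm_measure u) setT (fun s => -1 * (id \_ D) s).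
  rewrite RintegralZl ?mulN1r//.
  exact: (integrable_rbounded (pvm_measure_fin u) bid).
apply: (Rintegral_le_ae (pvm_measure_fin u) _
  (measurableC (measurableI _ _ mD mJ)) (spectral_measureC0 mJ Ju)).
  by apply: rboundedM; [exact: rbounded_cst|exact: bid].
move=> s /contrapT[Ds Js]; rewrite patchE mem_set// mulN1r lerN2; exact: Jq.
Qed.

(** The cross terms [dot (E B u) (E B v)] vanish because [J] and its complement are disjoint, so the
    spectral measure of [u + v] is the sum of those of [u] and [v]. *)
Lemma spectral_measureD J u v : measurable J -> E J u = u -> E (~` J) v = v ->
  dot (rmul m b (u + v)) (u + v) = dot (rmul m b u) u + dot (rmul m b v) v.
Proof.
move=> mJ Ju Jv; have mCJ := measurableC mJ; rewrite !dot_b -rmorphD.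
congr (_%:C); have f0 s : (0 <= ((id \_ D) s)%:E)%E.
  rewrite lee_fin patchE; case: ifPn => // sD; rewrite inE in sD.
  by have /andP[cs _] := DcK sD; rewrite (le_trans (ltW c0)).
have i1 := integrable_rbounded (pvm_measure_fin u) bid.
have i2 := integrable_rbounded (pvm_measure_fin v) bid.
rewrite /Rintegral -fineD; [|exact: integrable_fin_num..].
congr fine; rewrite -ge0_integral_measure_add//; last first.
  by apply/measurable_EFinP; case: bid.
apply: eq_measure_integral => B mB _.
rewrite /= /msum !big_ord_recr big_ord0 /= add0e.
rewrite !pvm_measureE// -EFinD; congr EFin.
rewrite (opD _ _ (pvm_linear mB)) nsqD.
suff -> : dot (E B u) (E B v) = 0 by rewrite /= mulr0 addr0.
rewrite -Ju -Jv -pvm_adj// !pvm_comp//; last exact: measurableI.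
rewrite -pvm_adj// pvm_comp//; last by do 2 apply: measurableI => //.
rewrite (_ : _ `&` _ = set0) ?pvm_set0 ?dot0l//.
by apply/seteqP; split => s //= -[h [_ /h]].
Qed.

(** Additivity of the quadratic form kills the real part of the cross term; the same argument with
    [i v] kills the imaginary part. *)
Lemma dot_b_orth J u v : measurable J -> E J u = u -> E (~` J) v = v ->
  dot (rmul m b u) v = 0.
Proof.
move=> mJ Ju Jv; have mCJ := measurableC mJ.
have re0 w : E (~` J) w = w -> Re (dot (rmul m b u) w) = 0.
  move=> Jw; have := spectral_measureD mJ Ju Jw.
  rewrite (opD _ _ (rmul_linear m bb)) dotDl !dotDr.
  rewrite (rmul_adj w u bb) (dotC (rmul m b u) w) => h.
  have : dot (rmul m b u) w + (dot (rmul m b u) w)^* = 0.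
    have alg (p q z y : R[i]) : p + z + (y + q) = p + q -> z + y = 0.
      by move=> e; apply: (addrI (p + q)); rewrite addr0 -[RHS]e; ring.
    exact: alg h.
  by move=> /(congr1 (@complex.Re R)); rewrite ReD ReC /=; lra.
apply: eqCP; first exact: re0.
have := re0 ('i%C *: v); rewrite (opZ _ _ (pvm_linear mCJ)) Jv => /(_ erefl).
by rewrite dotZr !ReImE /= mul0r add0r mulN1r opprK.
Qed.

(** Stands in for the commutation of [E J] with multiplication by [b], which the quadratic form of
    the spectral integral does not give directly: [b u] is orthogonal to the range of the
    complementary projection. *)
Lemma pvm_invariant J u : measurable J -> E J u = u ->
  E J (rmul m b u) = rmul m b u.
Proof.
move=> mJ Ju; have mCJ := measurableC mJ.
suff h : E (~` J) (rmul m b u) = 0.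
  by rewrite -[RHS](pvmC (rmul m b u) mJ) h addr0.
apply: dot_ext => w; rewrite dot0l (pvm_adj _ _ mCJ).
by apply: (dot_b_orth mJ Ju); rewrite pvm_comp// setIid.
Qed.

(** On the range of [E ]-oo, t]], which multiplication by [b] preserves, the form of [b] is at most
    [t]; [support_bound] turns this into a statement on supports. *)
Lemma pvm_support_le (t : R) u : E `]-oo, t]%classic u = u ->
  \forall x \ae m, t < b x -> u x = 0.
Proof.
move=> tu; have mJ : measurable (`]-oo, t]%classic : set R) by [].
have b00 x : 0 <= b x by rewrite (le_trans (ltW c0)).
(* [support_bound] asks for a nonnegative threshold; since [b] is positive, [t < b x] still implies
   [Num.max t 0 < b x]. *)
have : \forall x \ae m, Num.max t 0 < b x -> u x = 0.
  apply: (@support_bound _ _ _ _ (fun w => E `]-oo, t]%classic w = w)) => //.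
  - by rewrite le_max lexx orbT.
  - by move=> w; exact: pvm_invariant.
  - move=> w tw; apply: (dot_b_le mJ tw) => s /=.
    by rewrite in_itv/= le_max => ->.
by apply: filterS => x h tb; apply: h; rewrite gt_max tb (lt_le_trans c0).
Qed.

Lemma pvm_support_ge (t : R) u : E (~` `]-oo, t]%classic) u = u ->
  \forall x \ae m, b x < t -> u x = 0.
Proof.
move=> tu; have mJ : measurable (~` (`]-oo, t]%classic : set R)).
  exact: measurableC.
(* Reflecting [b] to [L - b] reverses the order; [L] exceeds both [K] and [t], so the multiplier and
   the threshold [L - t] stay nonnegative. *)
pose L := Num.max t K + 1.
have LK x : b x <= K + 0 <= L.
  by rewrite addr0 bK /L/= ler_wpDr// le_max lexx orbT.
have tL : t < L by rewrite /L ltr_pwDr// le_max lexx.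
have bL : rbounded (fun x => L - b x).
  by apply: rboundedB => //; exact: rbounded_cst.
have : \forall x \ae m, L - t < L - b x -> u x = 0.
  apply: (@support_bound _ _ _ _ (fun w => E (~` `]-oo, t]%classic) w = w)) => //.
  - by move=> x; have := LK x; rewrite addr0 subr_ge0 => /andP[]; exact: le_trans.
  - by rewrite subr_ge0 ltW.
  - move=> w tw; rewrite (rmul_shift _ _ bb) (opB _ _ (pvm_linear mJ)).
    by rewrite (opZ _ _ (pvm_linear mJ)) tw pvm_invariant.
  - move=> w tw; rewrite (rmul_shift _ _ bb) dotBl dotZl dot_nsq !ReImE /=.
    rewrite mul0r subr0 mulrBl lerD2l lerN2.
    apply: (dot_b_ge mJ tw) => s /= /negP.
    by rewrite in_itv/= -ltNge => /ltW.
by apply: filterS => x h tb; apply: h; rewrite ltrD2l ltrN2.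
Qed.

Let F (t : R) : operator m := rmul m (\1_(b @^-1` `]-oo, t]%classic)).

Let mF (t : R) : measurable (b @^-1` `]-oo, t]%classic).
Proof. by apply: preimage_measurable => //; case: bb. Qed.

Let bF t : rbounded (\1_(b @^-1` `]-oo, t]%classic) : T -> R).
Proof. exact: rbounded_indic. Qed.

Let F_id t u : (\forall x \ae m, t < b x -> u x = 0) -> F t u = u.
Proof.
move=> h; apply/L2_eqP; apply: filterS2 h (rmulE u (bF t)) => x h1 h2 _.
rewrite h2// indicE; case: (boolP (x \in _)) => xt; first by rewrite mul1r.
rewrite h1 ?mulr0//; move: xt; rewrite notin_setE /= in_itv/= => /negP.
by rewrite -ltNge.
Qed.

Let F_0 (s t : R) u : s < t -> (\forall x \ae m, b x < t -> u x = 0) -> F s u = 0.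
Proof.
move=> st h; apply/L2_eqP.
apply: filterS3 h (rmulE u (bF s)) (L2_zeroE m) => x h1 h2 h3 _.
rewrite h2// h3// indicE; case: (boolP (x \in _)) => xt; last by rewrite mul0r.
rewrite h1 ?mulr0//; move: xt; rewrite inE /= in_itv/= => xs.
exact: le_lt_trans st.
Qed.

Let F_D t u v : F t (u + v) = F t u + F t v.
Proof. by apply: opD; exact: rmul_linear. Qed.

Let F_adj t u v : dot (F t u) v = dot u (F t v).
Proof. exact: rmul_adj. Qed.

Let nsqF_le t u : nsq (F t u) <= nsq u.
Proof.
rewrite -[leRHS]mul1r; apply: nsq_mulop_le => [|x]; first exact: rbounded_cbounded.
by rewrite sqmod_real indicE; case: (_ \in _); rewrite ?expr1n ?expr0n.
Qed.

(** [F t] fixes [E ]-oo, t] u], and what [F t] adds from the complementary component is orthogonal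
    to it. *)
Let nsq_lower t u : nsq (E `]-oo, t]%classic u) <= nsq (F t u).
Proof.
have mJ : measurable (`]-oo, t]%classic : set R) by [].
have mCJ := measurableC mJ.
have He : F t (E `]-oo, t]%classic u) = E `]-oo, t]%classic u.
  by apply/F_id/pvm_support_le; rewrite pvm_comp// setIid.
rewrite -{2}(pvmC u mJ) F_D He nsqD -F_adj He.
rewrite (pvm_adj _ _ mJ) pvm_comp// setICr pvm_set0 dot0r mulr0 addr0.
by rewrite lerDl nsq_ge0.
Qed.

(** The gap [s < t] is forced by the set [{b = t}]: vectors in the range of the complement of
    [E ]-oo, t]] are only known to vanish where [b < t]. *)
Let nsq_upper s t u : s < t -> nsq (F s u) <= nsq (E `]-oo, t]%classic u).
Proof.
move=> st; have mJ : measurable (`]-oo, t]%classic : set R) by [].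
have mCJ := measurableC mJ.
rewrite -{1}(pvmC u mJ) F_D.
rewrite [F s (E (~` _) u)](F_0 st) ?addr0; first exact: nsqF_le.
by apply: pvm_support_ge; rewrite pvm_comp// setIid.
Qed.

(** Continuity from above of the spectral measure along []-oo, t + 1 / (n + 1)]] closes the gap left
    by [nsq_upper]. *)
Lemma pvm_cdf t u : nsq (E `]-oo, t]%classic u) = nsq (F t u).
Proof.
apply/eqP; rewrite eq_le nsq_lower /=.
pose J n := (`]-oo, t + n.+1%:R^-1]%classic : set R).
have mJ n : measurable (J n) by exact: measurable_itv.
have JE : \bigcap_n J n = `]-oo, t]%classic.
  apply/seteqP; split => [s Js|s /=]; last first.
    by rewrite !in_itv/= => st n _; rewrite /J/= in_itv/= (le_trans st)// lerDl.
  rewrite /= in_itv/=; apply/ler_addgt0Pr => e e0.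
  have [n _ /(_ n (leqnn n)) hn] := near_infty_natSinv_lt (PosNum e0).
  have := Js n I; rewrite /J /= in_itv/= => /le_trans; apply.
  by rewrite lerD2l ltW.
have cv : (pvm_measure u \o J) @ \oo --> pvm_measure u `]-oo, t]%classic.
  rewrite -JE; apply: nonincreasing_cvg_mu => //.
  - apply: (le_lt_trans _ (pvm_measure_fin u)).
    by apply: le_measure; rewrite ?inE.
  - by rewrite JE.
  - move=> n p np; apply/subsetPset => s; rewrite /J /= !in_itv/= => /le_trans; apply.
    by rewrite lerD2l lef_pV2 ?posrE// ler_nat.
have lim_ge : ((nsq (F t u))%:E <= pvm_measure u `]-oo, t]%classic)%E.
  rewrite -(cvg_lim _ cv)//; apply: lime_ge; first by apply/cvg_ex; eexists; exact: cv.
  apply: nearW => n /=; rewrite pvm_measureE// lee_fin.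
  by apply: nsq_upper; rewrite ltrDl.
by rewrite pvm_measureE// lee_fin in lim_ge.
Qed.

End Identification.
End PVM.

Section MulPVM.
Context d (T : measurableType d) (R : realType).
Variable m : {measure set T -> \bar R}.
Implicit Types (u v w : L2 m) (B J : set R).
Variable b : T -> R.
Hypothesis bb : rbounded b.

Let mb : measurable_fun setT b. Proof. by case: bb. Qed.

Definition mul_pvm B : operator m := rmul m (\1_(b @^-1` B)).

Let rb B : measurable B -> rbounded (\1_(b @^-1` B) : T -> R).
Proof. by move=> mB; apply: rbounded_indic; exact: preimage_measurable. Qed.

Lemma mul_pvmE u B : measurable B -> spectral_measure_at mul_pvm u B =
  (\int[m]_(x in b @^-1` B) (sqmod (u x))%:E)%E.
Proof.
move=> mB; rewrite /spectral_measure_at (dot_rmul u (rb mB)) /= /Rintegral fineK.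
  rewrite [RHS]integral_mkcond; apply: eq_integral => x _.
  rewrite patchE indicE; case: ifPn => xB.
    by rewrite mul1r.
  by rewrite mul0r.
by apply: integrable_fin_num => //; exact: (integrable_rmul u (rb mB)).
Qed.

Lemma mul_pvmP : projection_valued_measure mul_pvm.
Proof.
split.
- move=> B mB; split; first exact: (rmul_bounded m (rb mB)).
    by apply: adjointP => u v; exact: rmul_adj (rb mB).
  apply/funext => u /=; rewrite /mul_pvm (rmul_comp _ (rb mB) (rb mB)).
  congr (rmul m _ u); apply/funext => x.
  by rewrite indicE; case: (_ \in _); rewrite ?mulr1 ?mulr0.
- rewrite /mul_pvm preimage_setT -mulop1; congr mulop; apply/funext => x.
  by rewrite indicE in_setT.
- move=> B J mB mJ; apply/funext => u /=.
  rewrite /mul_pvm (rmul_comp _ (rb mB) (rb mJ)); congr (rmul m _ u).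
  by rewrite preimage_setI indicI.
move=> u F mF tF mUF; rewrite mul_pvmE// preimage_bigcup.
under eq_fun => n do under eq_bigr => i _ do rewrite mul_pvmE//.
have mbF i : measurable (b @^-1` F i) by exact: preimage_measurable.
have ms : measurable_fun setT (fun x => (sqmod (u x))%:E).
  by apply/measurable_EFinP; apply: measurable_sqmod; exact: L2_measurable.
rewrite ge0_integral_bigcup//.
- apply: is_cvg_ereal_nneg_natsum => n _.
  by apply: integral_ge0 => x _; rewrite lee_fin sqmod_ge0.
- exact: measurable_funTS.
- by move=> x _; rewrite lee_fin sqmod_ge0.
- apply/trivIsetP => i j _ _ ij; rewrite -preimage_setI.
  by move/trivIsetP : tF => ->//; rewrite preimage_set0.
Qed.

Lemma mul_pvm_integral (f : R -> R) u : rbounded f ->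
  Rintegral (pvm_measure mul_pvmP u) setT f =
  Rintegral m setT (fun x => f (b x) * sqmod (u x)).
Proof.
move=> bf; apply: Rintegral_density => //.
- by apply: measurable_sqmod; exact: L2_measurable.
- by move=> x; exact: sqmod_ge0.
- move=> B mB; rewrite -mul_pvmE// spectral_measure_atE//; last exact: mul_pvmP.
  exact: pvm_measureE.
- exact: integrable_nsq.
Qed.

Section Unique.
Variables (E : set R -> operator m) (D : set R) (c K : R).
Hypothesis hE : projection_valued_measure E.
Hypotheses (mD : measurable D) (ED : E D = idfun).
Hypotheses (c0 : 0 < c) (DcK : forall s, D s -> c <= s <= K).
Hypotheses (b0 : forall x, c <= b x) (bK : forall x, b x <= K).
Hypothesis Eb : is_spectral_integral E D id (rmul m b).

(** Equal distribution functions and equal total mass give equality on the rays []t, +oo[], an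
    intersection-stable class that generates the Borel sets. *)
Lemma pvm_measure_unique u B : measurable B ->
  pvm_measure hE u B = pvm_measure mul_pvmP u B.
Proof.
move=> mB.
have agree (t : R) : pvm_measure hE u `]t, +oo[%classic =
    pvm_measure mul_pvmP u `]t, +oo[%classic.
  have mJ : measurable (`]-oo, t]%classic : set R) by exact: measurable_itv.
  have -> : `]t, +oo[%classic = ~` (`]-oo, t]%classic : set R).
    by rewrite setCitvl.
  have mCJ := measurableC mJ.
  have split_ (m' : {measure set R -> \bar R}) : (m' setT = (nsq u)%:E ->
      m' `]-oo, t]%classic = (nsq (mul_pvm `]-oo, t]%classic u))%:E ->
      m' (~` `]-oo, t]%classic) =
        (nsq u - nsq (mul_pvm `]-oo, t]%classic u))%:E)%E.
    move=> mT mt; have : m' setT = (m' `]-oo, t]%classic + m' (~` `]-oo, t]%classic))%E.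
      by rewrite -(setUv `]-oo, t]%classic) measureU//; rewrite setICr.
    rewrite mT mt => h.
    have fn : m' (~` `]-oo, t]%classic) \is a fin_num.
      move: h; case: (m' (~` _)) => [//| |]; by [].
    move: h; rewrite -(fineK fn) -EFinD => -[->].
    by congr EFin; rewrite addrAC subrr add0r.
  rewrite (split_ (pvm_measure hE u))//; last 2 first.
  - exact: pvm_measure_setT.
  - by rewrite -(pvm_cdf hE mD ED c0 DcK bb b0 bK Eb); exact: pvm_measureE.
  rewrite (split_ (pvm_measure mul_pvmP u))//.
  - exact: pvm_measure_setT.
  - exact: pvm_measureE.
pose g (n : nat) : set R := `]- n%:R, +oo[%classic.
have mG : @measurable _ (measurableTypeR R) = <<s @RGenOInfty.G R >>.
  exact: RGenOInfty.measurableE.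
apply: (measure_unique _ g mG) mB => //.
- move=> _ _ [x ->] [y ->]; exists (Num.max x y).
  by apply/seteqP; split => s /=; rewrite !in_itv/= !andbT gt_max => /andP.
- by move=> n; exists (- n%:R).
- apply/seteqP; split => // s _; exists (Num.bound `|- s|) => //=.
  rewrite /g /= in_itv/= andbT ltrNl.
  by rewrite (le_lt_trans (ler_norm _))// archi_boundP.
- by move=> _ [x ->]; exact: agree.
- move=> n; apply: (le_lt_trans _ (pvm_measure_fin hE u)).
  by apply: le_measure; rewrite ?inE//; exact: measurable_itv.
Qed.

(** A spectral integral depends on [E] only through the scalar measures, which are those of
    [mul_pvm]; polarization does the rest. *)
Lemma spectral_integral_unique (f : R -> R) (A : operator m) :
  rbounded (f \_ D) -> is_spectral_integral E D f A ->
  A = rmul m (fun x => (f \_ D) (b x)).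
Proof.
move=> bf fA; have [[lA _] _] := fA.
have bfb : rbounded (fun x => (f \_ D) (b x)).
  have [mf [L fL]] := bf; split; first exact: (measurableT_comp mf mb).
  by exists L => x; exact: fL.
apply: op_ext => //; first exact: rmul_linear.
move=> u; have -> := spectral_integralE hE u fA.
rewrite (dot_rmul u bfb) -(mul_pvm_integral u bf); congr (_%:C).
rewrite /Rintegral; congr fine.
by apply: eq_integral_measurable => B; exact: pvm_measure_unique.
Qed.

End Unique.

Lemma mul_pvm_spectral_integral (D : set R) (f : R -> R) :
  rbounded (f \_ D) ->
  is_spectral_integral mul_pvm D f (rmul m (fun x => (f \_ D) (b x))).
Proof.
move=> bf.
have bfb : rbounded (fun x => (f \_ D) (b x)).
  have [mf [L fL]] := bf; split; first exact: (measurableT_comp mf mb).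
  by exists L => x; exact: fL.
split; first exact: rmul_bounded.
move=> u; rewrite (dot_rmul _ bfb) -mul_pvm_integral//; congr (_%:C).
rewrite -Rintegral_mkcond; congr fine; apply: eq_integral_measurable => B mB.
rewrite pvm_measureE// spectral_measure_atE//; exact: mul_pvmP.
Qed.

End MulPVM.

(** * The spectrum of a multiplication operator as essential range *)

Section Spectrum.
Context d (T : measurableType d) (R : realType).
Variable m : {measure set T -> \bar R}.
Implicit Types (u v w : L2 m) (a b : T -> R).

(** Squaring makes the base nonnegative, where [powR] at exponent [-1] is the inverse; at a zero of
    [a] both sides vanish. *)
Lemma measurable_funV a : measurable_fun setT a ->
  measurable_fun setT (fun x => (a x)^-1).
Proof.
move=> ma; have -> : (fun x => (a x)^-1) = (fun x => a x * (a x ^+ 2) `^ (- 1)).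
  apply/funext => x; rewrite powR_inv1 ?sqr_ge0//.
  have [->|a0] := eqVneq (a x) 0; first by rewrite mul0r invr0.
  by field.
apply: measurable_funM => //; apply: (measurableT_comp (measurable_powR _)).
exact: measurable_funX.
Qed.

Lemma rmul_inverse a (e : R) : rbounded a -> 0 < e ->
  (\forall x \ae m, e <= `|a x|) ->
  exists2 k, rbounded k & cancel (rmul m a) (rmul m k) /\
                          cancel (rmul m k) (rmul m a).
Proof.
move=> ba e0 ea; have [ma _] := ba.
pose G := [set x | e <= `|a x|].
have mG : measurable G.
  have -> : G = (fun x => `|a x|) @^-1` `[e, +oo[%classic.
    by apply/seteqP; split => x; rewrite /G /= in_itv/= andbT.
  by apply: preimage_measurable => //; exact: measurableT_comp.
pose k x := \1_G x * (a x)^-1.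
have bk : rbounded k.
  split.
    by apply: measurable_funM; [exact: measurable_indic|exact: measurable_funV].
  exists e^-1 => x; rewrite /k indicE; case: (boolP (x \in G)) => xG.
    rewrite inE in xG; rewrite mul1r normfV lef_pV2 ?posrE//.
    exact: lt_le_trans xG.
  by rewrite mul0r normr0 invr_ge0 ltW.
have bak := rboundedM ba bk.
have akE : rmul m (fun x => a x * k x) = idfun.
  rewrite -mulop1 /rmul; apply: mulop_ae_eq.
  - by apply: cmeasurable_real; case: bak.
  - exact: cbounded_cst.
  - apply: filterS ea => x eax _; rewrite /k indicE mem_set// mul1r divff//.
    by apply/eqP => a0; move: eax; rewrite a0 normr0 leNgt e0.
exists k => //; split => u.
- rewrite (rmul_comp _ bk ba).
  have -> : (fun x => k x * a x) = (fun x => a x * k x).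
    by apply/funext => x; rewrite mulrC.
  by rewrite akE.
- by rewrite (rmul_comp _ ba bk) akE.
Qed.

Hypothesis msf : sigma_finite setT m.

(** The test vectors are the indicators of a sigma-finite exhaustion: each is nonzero on its piece,
    and countably many null sets suffice. *)
Lemma ae_of_L2 (P : T -> Prop) :
  (forall u, \forall x \ae m, P x -> u x = 0) -> \forall x \ae m, ~ P x.
Proof.
move=> h; have [F TF Ffin] := msf.
have : \forall x \ae m, forall n : nat, F n x -> ~ P x.
  apply: ae_foralln => n; have [mF Foo] := Ffin n.
  pose g x := (\1_(F n) x : R)%:C.
  have sF : square_integrable m g.
    apply/square_integrableP; split.
      by apply: cmeasurable_real; exact: measurable_indic.
    have -> : (fun x => sqmod (g x)) = \1_(F n).
      apply/funext => x; rewrite /g sqmod_real indicE.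
      by case: (_ \in _); rewrite ?expr1n ?expr0n.
    apply/integrableP; split.
      exact/measurable_EFinP/measurable_indic.
    rewrite (eq_integral (fun x => (\1_(F n) x)%:E)); last first.
      by move=> x _ /=; rewrite ger0_norm// indicE.
    by rewrite integral_indic// setIT.
  apply: filterS2 (toL2K sF) (h (toL2 m g)) => x h1 h2 Fx Px.
  move: (h1 I); rewrite (h2 Px) /g indicE mem_set// => /(congr1 (@complex.Re R)) /=.
  by move/eqP; rewrite eq_sym oner_eq0.
apply: filterS => x hx; have : setT x by [].
by rewrite TF => -[n _ Fx]; exact: hx Fx.
Qed.

Lemma ae_bounded_below f (L : R) : cbounded f ->
  (forall u, nsq u <= L * nsq (mulop m f u)) ->
  exists2 e : R, 0 < e & \forall x \ae m, e <= sqmod (f x).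
Proof.
(* Chosen so that [|L| e < 1]: a vector [w] supported where [|f| ^ 2 < e] satisfies
   [nsq w <= |L| e nsq w], hence vanishes. *)
move=> bf hL; pose e := (`|L| + 1)^-1.
have L1 : 0 < `|L| + 1 by rewrite ltr_wpDl.
have e0 : 0 < e by rewrite invr_gt0.
exists e => //; pose G := [set x | sqmod (f x) < e].
have mG : measurable G.
  have -> : G = (fun x => sqmod (f x)) @^-1` `]-oo, e[%classic.
    by apply/seteqP; split => x; rewrite /G /= in_itv/=.
  apply: preimage_measurable => //; apply: measurable_sqmod; by case: bf.
have bG := rbounded_indic R mG; have cG := rbounded_cbounded bG.
suff : \forall x \ae m, ~ G x.
  by apply: filterS => x /negP; rewrite /G /= -leNgt.
apply: ae_of_L2 => u.
pose w := rmul m (\1_G) u.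
have fw : nsq (mulop m f w) <= e * nsq w.
  rewrite /w /rmul (mulop_comp _ bf cG) (nsq_mulop _ (cboundedM bf cG)).
  rewrite (nsq_mulop _ cG) -RintegralZl//; last first.
    under [X in _.-integrable _ X]eq_fun do rewrite sqmod_real.
    exact: (integrable_rmul u (rboundedX 2 bG)).
  apply: le_Rintegral_sqmod.
  - apply: measurable_funM; apply: measurable_sqmod; last exact: L2_measurable.
    by case: (cboundedM bf cG).
  - have := integrable_lin e 0 (integrable_rmul u (rboundedX 2 bG))
      (integrable_nsq u); congr (_.-integrable _ _); apply/funext => x /=.
    by rewrite mul0r addr0 sqmod_real.
  - move=> x; rewrite mulr_ge0 ?sqmod_ge0//= mulrA; apply: ler_wpM2r.
      exact: sqmod_ge0.
    rewrite sqmodM sqmod_real indicE; case: (boolP (x \in G)) => xG.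
      by rewrite expr1n !mulr1; rewrite inE in xG; exact: ltW.
    by rewrite expr0n !mulr0.
have w0 : nsq w = 0.
  apply/eqP; rewrite eq_le nsq_ge0 andbT.
  have h1 : nsq w <= `|L| * e * nsq w.
    apply: (le_trans (hL w)); apply: (@le_trans _ _ (`|L| * nsq (mulop m f w))).
      by rewrite ler_wpM2r ?nsq_ge0// ler_norm.
    by rewrite -mulrA ler_wpM2l.
  have h2 : `|L| * e < 1 by rewrite ltr_pdivrMr// mul1r ltrDl.
  have := nsq_ge0 w; nra.
have := nsq_eq0 w0; rewrite /w => w00.
have := rmulE u bG; rewrite w00 => h.
apply: filterS2 h (L2_zeroE m) => x h1 h2 Gx.
by move: (h1 I); rewrite h2// indicE mem_set// mul1r => <-.
Qed.

Section RealMultiplier.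
Variable b : T -> R.
Hypothesis bb : rbounded b.

(** A bounded inverse of a multiplication operator bounds its symbol away from zero, so the spectrum
    is the essential range. *)
Lemma notin_spectrum (s : R) : ~ spectrum (rmul m b) s <->
  exists2 e : R, 0 < e & \forall x \ae m, e <= `|b x - s|.
Proof.
have bs := rboundedB bb (rbounded_cst s).
have -> : spectrum (rmul m b) s = ~ invertible_op (rmul m (fun x => b x - s)).
  rewrite /spectrum /=; congr (~ invertible_op _); apply/funext => u.
  exact: rmul_scale.
split=> [/contrapT[_ [B [/bounded_opP[_ [L L0 hL]] BK _]]]|[e e0 he]].
  have [|e e0 he] := @ae_bounded_below (fun x => (b x - s)%:C) L
      (rbounded_cbounded bs).
    by move=> u; have := hL (rmul m (fun x => b x - s) u); rewrite BK.
  exists (Num.sqrt e); first by rewrite sqrtr_gt0.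
  apply: filterS he => x; rewrite sqmod_real => h.
  by rewrite -sqrtr_sqr ler_sqrt// (le_trans _ h)// ltW.
apply; split; first exact: rmul_bounded.
have [k bk [h1 h2]] := rmul_inverse bs e0 he.
by exists (rmul m k); split => //; exact: rmul_bounded.
Qed.

Lemma spectrum_sub (c K : R) : (forall x, c <= b x <= K) ->
  forall s, spectrum (rmul m b) s -> c <= s <= K.
Proof.
move=> bcK s sp; apply: contrapT => /negP; rewrite negb_and -!ltNge => h.
suff : ~ spectrum (rmul m b) s by [].
apply/notin_spectrum; case/orP: h => h.
  exists (c - s); first by rewrite subr_gt0.
  apply: aeW => x; have /andP[cb _] := bcK x.
  by rewrite (le_trans _ (ler_norm _))// lerB.
exists (s - K); first by rewrite subr_gt0.
apply: aeW => x; have /andP[_ bK] := bcK x.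
by rewrite distrC (le_trans _ (ler_norm _))// lerB.
Qed.

Lemma spectrum_measurable : measurable (spectrum (rmul m b)).
Proof.
rewrite -[spectrum _]setCK; apply: measurableC; apply: open_measurable.
rewrite openE => s /notin_spectrum[e e0 he].
exists (e / 2) => /=; first by rewrite divr_gt0.
move=> t; rewrite /ball /= => st; apply/notin_spectrum; exists (e / 2).
  by rewrite divr_gt0.
apply: filterS he => x h.
have : `|b x - s| <= `|b x - t| + `|t - s|.
  by rewrite -[b x - s](subrKA t) ler_normD.
by rewrite (distrC t s); move: h st; lra.
Qed.

(** Only countably many null sets are discarded, one for each rational [q] and level [n] with
    [P q n]. A value [b x] outside the spectrum has a rational [q] so close that [P q n] holds for a
    suitable [n], which contradicts the distance of [b x] to [q]. *)
Lemma ae_in_spectrum : \forall x \ae m, spectrum (rmul m b) (b x).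
Proof.
pose P (q : R) (n : nat) := \forall x \ae m, n.+1%:R^-1 <= `|b x - q|.
have : \forall x \ae m, forall (j n : nat),
    if unpickle j is Some q then
      P (ratr q) n -> n.+1%:R^-1 <= `|b x - ratr q| else True.
  apply: ae_foralln => j; apply: ae_foralln => n.
  case: (unpickle j) => [q|]; last exact: aeW.
  have [h|h] := pselect (P (ratr q) n); first by apply: filterS h.
  by apply: aeW.
apply: filterS => x hx; apply: contrapT => /notin_spectrum[e e0 he].
have e2 : 0 < e / 2 by rewrite divr_gt0.
have [n _ /(_ n (leqnn n)) hn] := near_infty_natSinv_lt (PosNum e2).
rewrite /= in hn; have n0 : 0 < n.+1%:R^-1 :> R by rewrite invr_gt0.
have /rat_in_itvoo[q] : b x < b x + n.+1%:R^-1 by rewrite ltrDl.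
rewrite in_itv/= => /andP[q1 q2].
have := hx (pickle q) n; rewrite pickleK => hq.
have close : `|b x - ratr q| < n.+1%:R^-1.
  by rewrite ltr0_norm ?subr_lt0// opprB ltrBlDl.
suff /hq : P (ratr q) n by rewrite leNgt close.
apply: filterS he => y h.
have : `|b y - b x| <= `|b y - ratr q| + `|ratr q - b x|.
  by rewrite -[b y - b x](subrKA (ratr q)) ler_normD.
rewrite (distrC (ratr q)); move: h close hn; move: (n.+1%:R^-1 : R) => e1.
by lra.
Qed.

End RealMultiplier.
End Spectrum.

(** * Power means *)

Section PowerMean.
Context (R : realType).
Variables (r lam : R).
Hypotheses (r0 : r != 0) (lam01 : 0 < lam < 1).

Definition wmean (s t : R) : R := ((1 - lam) * s `^ r + lam * t `^ r) `^ r^-1.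

(** The partial derivative of [wmean] in its first variable. *)
Definition dwmean (s t : R) : R :=
  (1 - lam) * s `^ (r - 1) * ((1 - lam) * s `^ r + lam * t `^ r) `^ (r^-1 - 1).

Let lam0 : 0 < lam. Proof. by case/andP: lam01. Qed.
Let lam1 : 0 < 1 - lam. Proof. by rewrite subr_gt0; case/andP: lam01. Qed.

Lemma power_meanE s t : 0 < s -> 0 < t ->
  s * power_mean r lam (t / s) = wmean s t.
Proof.
move=> s0 t0; rewrite /power_mean /wmean.
have -> : (1 - lam) * s `^ r + lam * t `^ r =
    s `^ r * (1 - lam + lam * (t / s) `^ r).
  have -> : (t / s) `^ r = t `^ r / s `^ r.
    rewrite powRM ?invr_ge0; [|exact: ltW..].
    by rewrite -(powR_inv1 (ltW s0)) powRAC powR_inv1// powR_ge0.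
  field.
  by rewrite gt_eqF// powR_gt0.
rewrite powRM ?powR_ge0//; last first.
  by rewrite addr_ge0 ?mulr_ge0 ?powR_ge0// ltW.
by rewrite -powRrM divff// powRr1// ltW.
Qed.

(** One endpoint dominates for each sign of [p]; the sum serves both. *)
Lemma powR_itv (c K x p : R) : 0 < c -> c <= x <= K -> x `^ p <= c `^ p + K `^ p.
Proof.
move=> c0 /andP[cx xK]; have x0 := lt_le_trans c0 cx.
have K0 := lt_le_trans x0 xK.
have [p0|/ltW p0] := leP 0 p.
  apply: (@le_trans _ _ (K `^ p)); last by rewrite lerDr powR_ge0.
  by apply: ge0_ler_powR => //; rewrite nnegrE ltW.
apply: (@le_trans _ _ (c `^ p)); last by rewrite lerDl powR_ge0.
rewrite -[p]opprK [x `^ _]powRN [c `^ _]powRN lef_pV2 ?posrE ?powR_gt0//.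
by apply: ge0_ler_powR; rewrite ?nnegrE ?oppr_ge0// ltW.
Qed.

Lemma powRK x : 0 < x -> (x `^ r) `^ r^-1 = x.
Proof. by move=> x0; rewrite -powRrM divff// powRr1// ltW. Qed.

Lemma powRVK x : 0 < x -> (x `^ r^-1) `^ r = x.
Proof. by move=> x0; rewrite -powRrM mulVf// powRr1// ltW. Qed.

Lemma le_powRV (x y : R) : 0 < x -> 0 < y -> 0 < r -> (x `^ r <= y `^ r) = (x <= y).
Proof.
move=> x0 y0 r00; apply/idP/idP => h.
  rewrite -(powRK x0) -(powRK y0).
  by apply: ge0_ler_powR => //; rewrite ?nnegrE ?powR_ge0// invr_ge0 ltW.
by apply: ge0_ler_powR => //; rewrite ?nnegrE ltW.
Qed.

Lemma lt_powRN (x y : R) : 0 < x -> r < 0 -> x < y -> y `^ r < x `^ r.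
Proof.
move=> x0 rn xy; have y0 := lt_trans x0 xy.
have h : x `^ (- r) < y `^ (- r).
  by apply: gt0_ltr_powR; rewrite ?nnegrE ?oppr_gt0// ltW.
have -> : y `^ r = (y `^ (- r))^-1 by rewrite powRN invrK.
have -> : x `^ r = (x `^ (- r))^-1 by rewrite powRN invrK.
by rewrite ltf_pV2// posrE powR_gt0.
Qed.

Lemma le_powRN (x y : R) : 0 < x -> 0 < y -> r < 0 ->
  (x `^ r <= y `^ r) = (y <= x).
Proof.
move=> x0 y0 rn; apply/idP/idP => [|].
  by apply: contraTT; rewrite -!ltNge; exact: lt_powRN.
by rewrite le_eqVlt => /predU1P[->//|yx]; apply: ltW; exact: lt_powRN.
Qed.

Lemma wmean_arg_gt0 s t : 0 < s -> 0 < t -> 0 < (1 - lam) * s `^ r + lam * t `^ r.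
Proof. by move=> s0 t0; rewrite addr_gt0// mulr_gt0// powR_gt0. Qed.

(** [Num.min] and [Num.max] are needed because [x |-> x ^ r] reverses the order when [r < 0]. *)
Lemma wmean_arg_itv (c K s t : R) : 0 < c -> c <= s <= K -> c <= t <= K ->
  Num.min (c `^ r) (K `^ r) <= (1 - lam) * s `^ r + lam * t `^ r <=
  Num.max (c `^ r) (K `^ r).
Proof.
move=> c0 sI tI.
have one x : c <= x <= K ->
    Num.min (c `^ r) (K `^ r) <= x `^ r <= Num.max (c `^ r) (K `^ r).
  move=> /andP[cx xK]; have x0 := lt_le_trans c0 cx.
  have K0 := lt_le_trans x0 xK.
  rewrite ge_min le_max; have [p0|/ltW p0] := leP 0 r.
    apply/andP; split; apply/orP; [left|right];
      by apply: ge0_ler_powR => //; rewrite ?nnegrE ltW.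
  have rn : r < 0 by rewrite lt_neqAle r0.
  by apply/andP; split; apply/orP; [right|left]; rewrite le_powRN.
have /andP[s1 s2] := one _ sI; have /andP[t1 t2] := one _ tI.
move: (Num.min _ _) (Num.max _ _) s1 s2 t1 t2 => p q.
move: (s `^ r) (t `^ r) => x y s1 s2 t1 t2.
have e z : z = (1 - lam) * z + lam * z by ring.
by apply/andP; split; [rewrite [leLHS]e|rewrite [leRHS]e];
  apply: lerD; rewrite ler_pM2l.
Qed.

(** Keeps one pair [c], [K] valid for all iterated weights. For [r < 0] the order is reversed twice,
    by the power and by its inverse. *)
Lemma wmean_itv (c K s t : R) : 0 < c -> c <= s <= K -> c <= t <= K ->
  c <= wmean s t <= K.
Proof.
move=> c0 sI tI; have := wmean_arg_itv c0 sI tI; rewrite /wmean.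
have cK : c <= K by case/andP: sI => h1 h2; exact: le_trans h1 h2.
have K0 := lt_le_trans c0 cK.
have s0 : 0 < s by case/andP: sI => h _; exact: lt_le_trans h.
have t0 : 0 < t by case/andP: tI => h _; exact: lt_le_trans h.
have := wmean_arg_gt0 s0 t0.
move: (_ + _) => z z0; have [r1|r1] := ltP 0 r.
  have cKr : c `^ r <= K `^ r by rewrite le_powRV.
  rewrite (min_idPl cKr) (max_idPr cKr) -{1}(powRVK z0) -{2}(powRVK z0).
  by rewrite !le_powRV// powR_gt0.
have {}r1 : r < 0 by rewrite lt_neqAle r0.
have anti (x y : R) : 0 < x -> 0 < y -> (x `^ r <= y `^ r) = (y <= x).
  by move=> x0 y0; exact: le_powRN.
have cKr : K `^ r <= c `^ r by rewrite anti.
rewrite (min_idPr cKr) (max_idPl cKr) -{1}(powRVK z0) -{2}(powRVK z0).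
by rewrite !anti ?powR_gt0// andbC.
Qed.

Lemma dwmean_ge0 s t : 0 <= dwmean s t.
Proof. by rewrite /dwmean mulr_ge0 ?mulr_ge0 ?powR_ge0// ltW. Qed.

Lemma dwmean_bounded (c K : R) : 0 < c ->
  exists L, forall s t, c <= s <= K -> c <= t <= K -> dwmean s t <= L.
Proof.
move=> c0; set p := Num.min (c `^ r) (K `^ r); set q := Num.max (c `^ r) (K `^ r).
exists ((1 - lam) * (c `^ (r - 1) + K `^ (r - 1)) *
  (p `^ (r^-1 - 1) + q `^ (r^-1 - 1))) => s t sI tI.
have cK : c <= K by case/andP: sI => h1 h2; exact: le_trans h1 h2.
have K0 := lt_le_trans c0 cK.
have p0 : 0 < p by rewrite /p lt_min !powR_gt0.
rewrite /dwmean; apply: ler_pM; rewrite ?powR_ge0//.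
- by rewrite mulr_ge0 ?powR_ge0// ltW.
- by rewrite ler_pM2l//; exact: powR_itv.
- by apply: powR_itv => //; exact: wmean_arg_itv.
Qed.

Lemma continuous_powR (p x : R) : 0 < x -> {for x, continuous (fun y => y `^ p)}.
Proof.
move=> x0; apply: differentiable_continuous; apply/derivable1_diffP.
exact: (@ex_derive _ _ _ _ _ _ _ (is_derive1_powR p x0)).
Qed.

Lemma continuous_wmean_arg (s t : R) : 0 < s ->
  {for s, continuous (fun y => (1 - lam) * y `^ r + lam * t `^ r)}.
Proof.
move=> s0; apply: cvgD; last exact: cvg_cst.
by apply: cvgMr; exact: continuous_powR.
Qed.

Lemma continuous_dwmean (s t : R) : 0 < s -> 0 < t ->
  {for s, continuous (fun y => dwmean y t)}.
Proof.
move=> s0 t0.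
have h1 : {for s, continuous (fun y => (1 - lam) * y `^ (r - 1))}.
  by apply: cvgMr; exact: continuous_powR.
have h2 : {for s, continuous ((fun z => z `^ (r^-1 - 1)) \o
    (fun y => (1 - lam) * y `^ r + lam * t `^ r))}.
  apply: continuous_comp; first exact: continuous_wmean_arg.
  by apply: continuous_powR; exact: wmean_arg_gt0.
exact: (continuousM h1 h2).
Qed.

Lemma is_derive_wmean (s t : R) : 0 < s -> 0 < t ->
  is_derive s 1 (fun y => wmean y t) (dwmean s t).
Proof.
move=> s0 t0.
have h1 := is_derive1_powR r s0.
have h2 : is_derive s 1 (fun y => (1 - lam) * y `^ r + lam * t `^ r)
    ((1 - lam) * (r * s `^ (r - 1)) + 0).
  exact: is_deriveD.
have h3 := is_derive1_powR r^-1 (wmean_arg_gt0 s0 t0).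
have h4 := @is_derive1_comp _ (fun z => z `^ r^-1)
  (fun y => (1 - lam) * y `^ r + lam * t `^ r) s _ _ h3 h2.
apply: is_derive_eq h4 _.
rewrite /dwmean addr0; field; exact: r0.
Qed.

Lemma integral_dwmean (c s t : R) : 0 < c -> c <= s -> 0 < t ->
  (\int[lebesgue_measure]_(x in `[c, s]) (dwmean x t)%:E =
   (wmean s t - wmean c t)%:E)%E.
Proof.
move=> c0 cs t0; move: cs; rewrite le_eqVlt => /predU1P[<-|cs].
  by rewrite set_itv1 integral_set1 subrr.
have pos x : x \in `[c, s] -> 0 < x.
  by rewrite in_itv/= => /andP[cx _]; exact: lt_le_trans cx.
have s0 : 0 < s by exact: lt_trans cs.
have cw x : 0 < x -> {for x, continuous (fun y => wmean y t)}.
  move=> x0; apply: differentiable_continuous; apply/derivable1_diffP.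
  exact: (@ex_derive _ _ _ _ _ _ _ (is_derive_wmean x0 t0)).
rewrite (@continuous_FTC2 _ _ (fun y => wmean y t))//.
- apply: continuous_in_subspaceT => x; rewrite inE /= => xI.
  by apply: continuous_dwmean => //; exact: pos.
- split.
  + move=> x; rewrite in_itv/= => /andP[cx _].
    exact: (@ex_derive _ _ _ _ _ _ _ (is_derive_wmean (lt_trans c0 cx) t0)).
  + by apply: cvg_at_right_filter; exact: cw.
  + by apply: cvg_at_left_filter; exact: cw.
- move=> x; rewrite in_itv/= => /andP[cx _].
  rewrite derive1E.
  exact: (@derive_val _ _ _ _ _ _ _ (is_derive_wmean (lt_trans c0 cx) t0)).
Qed.

End PowerMean.

(** * Separation of variables for the kernel *)

Section Separation.
Context (R : realType).
Variables (r lam : R).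
Hypotheses (r0 : r != 0) (lam01 : 0 < lam < 1).
Local Notation wmean := (wmean r lam).
Local Notation dwmean := (dwmean r lam).

Lemma measurable_powR_comp d (T : measurableType d) (f : T -> R) (p : R) :
  measurable_fun setT f -> measurable_fun setT (fun x => f x `^ p).
Proof. by move=> mf; apply: (measurableT_comp (measurable_powR p)). Qed.

Lemma measurable_wmean d (T : measurableType d) (f g : T -> R) :
  measurable_fun setT f -> measurable_fun setT g ->
  measurable_fun setT (fun x => wmean (f x) (g x)).
Proof.
move=> mf mg; apply: measurable_powR_comp; apply: measurable_funD.
  by apply: measurable_funM => //; exact: measurable_powR_comp.
by apply: measurable_funM => //; exact: measurable_powR_comp.
Qed.

Lemma measurable_dwmean d (T : measurableType d) (f g : T -> R) :
  measurable_fun setT f -> measurable_fun setT g ->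
  measurable_fun setT (fun x => dwmean (f x) (g x)).
Proof.
move=> mf mg; apply: measurable_funM.
  by apply: measurable_funM => //; exact: measurable_powR_comp.
apply: measurable_powR_comp; apply: measurable_funD.
  by apply: measurable_funM => //; exact: measurable_powR_comp.
by apply: measurable_funM => //; exact: measurable_powR_comp.
Qed.

Variables (c K : R).
Hypotheses (c0 : 0 < c) (cK : c <= K).

(** The factor [K - c + 1] is the length of [[c - 1, K]] and cancels the density of the uniform
    probability on it. *)
Let alpha (s x : R) : R := (K - c + 1) * (if x <= s then 1 else 0).

(** The branch [x < c] carries the constant of integration; the value zero beyond [K] keeps [beta]
    bounded for all [x]. *)
Let beta (t x : R) : R :=
  if x < c then wmean c t else if x <= K then dwmean x t else 0.

Let K0 : 0 < K. Proof. exact: lt_le_trans cK. Qed.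

Let malpha : measurable_fun setT (fun p : R * R => alpha p.1 p.2).
Proof.
apply: measurable_funM => //; apply: measurable_fun_ifT => //.
exact: measurable_fun_ler.
Qed.

Let mbeta : measurable_fun setT (fun p : R * R => beta p.1 p.2).
Proof.
apply: measurable_fun_ifT => //.
- exact: measurable_fun_ltr.
- exact: measurable_wmean.
- apply: measurable_fun_ifT => //; first exact: measurable_fun_ler.
  exact: measurable_dwmean.
Qed.

Let beta_ge0 t x : 0 <= beta t x.
Proof.
rewrite /beta; case: ifP => _; first exact: powR_ge0.
by case: ifP => // _; exact: dwmean_ge0.
Qed.

Let Kc1 : 0 < K - c + 1. Proof. by rewrite ltr_wpDl// subr_ge0. Qed.

Let alpha_ge0 s x : 0 <= alpha s x.
Proof. by rewrite /alpha mulr_ge0 ?(ltW Kc1)//; case: ifP. Qed.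

Let bounded : exists L : R, forall s x, c <= s <= K ->
  `|alpha s x| <= L /\ `|beta s x| <= L.
Proof.
have [L hL] : exists L : R, forall s t, c <= s <= K -> c <= t <= K ->
    dwmean s t <= L by exact: dwmean_bounded.
exists (Num.max (K - c + 1) (Num.max K L)) => s x sI; split.
  rewrite le_max; apply/orP; left; rewrite /alpha normrM gtr0_norm//.
  by case: ifP => _; rewrite ?normr1 ?normr0 ?mulr1// mulr0 ltW.
rewrite ger0_norm// /beta; case: ltP => xc.
  rewrite !le_max; apply/orP; right; apply/orP; left.
  have cc : c <= c <= K by rewrite lexx.
  by have /andP[] := wmean_itv r0 lam01 c0 cc sI.
case: (leP x K) => xK.
  rewrite !le_max; apply/orP; right; apply/orP; right.
  by apply: hL => //; rewrite xc.
by rewrite !le_max; apply/orP; right; apply/orP; left; exact: ltW.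
Qed.

Let integral_beta s t : c <= s <= K -> 0 < t ->
  (\int[lebesgue_measure]_(x in `[(c - 1)%R, K]) (alpha s x * beta t x)%:E =
   ((K - c + 1) * wmean s t)%:E)%E.
Proof.
move=> /andP[cs sK] t0; pose h (x : R) : \bar R := (alpha s x * beta t x)%:E.
transitivity (\int[lebesgue_measure]_(x in `[(c - 1)%R, K]) h x)%E => //.
have h0 x : (0 <= h x)%E.
  by rewrite lee_fin mulr_ge0.
have mb : measurable_fun setT (beta t).
  exact: (measurableT_comp mbeta (measurable_pair1 t)).
have mh : measurable_fun setT h.
  apply/measurable_EFinP; apply: measurable_funM => //.
  exact: (measurableT_comp malpha (measurable_pair1 s)).
(* The three pieces contribute [wmean c t], the integral of the derivative from [c] to [s], and
   zero, up to the common factor. *)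
have -> : `[c - 1, K]%classic = `[c - 1, c[%classic `|` `[c, s]%classic `|` `]s, K]%classic.
  apply/seteqP; split => x /=; rewrite !in_itv/=.
    move=> /andP[x1 x2]; case: (ltP x c) => xc; first by left; left; rewrite x1.
    by case: (leP x s) => xs; [left; right|right; rewrite x2].
  move=> [[/andP[x1 x2]|/andP[x1 x2]]|/andP[x1 x2]].
  - by rewrite x1 (le_trans (ltW x2)).
  - by rewrite (le_trans x2)// andbT (le_trans _ x1)// gerBl.
  - by rewrite x2 andbT (le_trans _ (ltW x1))// (le_trans _ cs)// gerBl.
rewrite ge0_integral_setU//=; last 3 first.
- exact: measurableU.
- exact: measurable_funTS.
- apply/disj_setPS => x [[/=|/=]]; rewrite !in_itv/= => /andP[x1 x2] /andP[x3 _].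
    by move: (lt_trans x3 x2); rewrite ltNge cs.
  by move: (lt_le_trans x3 x2); rewrite ltxx.
rewrite ge0_integral_setU//=; last 2 first.
- exact: measurable_funTS.
- apply/disj_setPS => x [/=]; rewrite !in_itv/= => /andP[x1 x2] /andP[x3 _].
  by move: (le_lt_trans x3 x2); rewrite ltxx.
rewrite [X in (_ + X)%E]integral0_eq ?adde0; last first.
  move=> x /=; rewrite in_itv/= => /andP[sx _].
  by rewrite /h /alpha leNgt sx /= mulr0 mul0r.
rewrite (eq_integral (fun=> ((K - c + 1) * wmean c t)%:E)); last first.
  move=> x; rewrite inE /= in_itv/= => /andP[x1 x2].
  by rewrite /h /alpha /beta x2 (ltW (lt_le_trans x2 cs)) mulr1.
rewrite integral_cst//= lebesgue_measure_itv/= lte_fin gtrBl ltr01.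
rewrite -EFinD (_ : c - (c - 1) = 1) ?mule1; last by ring.
rewrite (eq_integral (fun x : measurableTypeR R => ((K - c + 1)%:E * (dwmean x t)%:E)%E)); last first.
  move=> x; rewrite inE /= in_itv/= => /andP[x1 x2].
  by rewrite /h /alpha /beta x2 ltNge x1 /= (le_trans x2 sK) mulr1 EFinM.
rewrite ge0_integralZl_EFin//; last 3 first.
- by move=> x _; rewrite lee_fin dwmean_ge0.
- apply/measurable_funTS/measurable_EFinP.
  by apply: measurable_dwmean.
- exact: ltW.
rewrite (integral_dwmean r0 lam01 c0 cs t0) -EFinM -EFinD; congr EFin.
by move: (wmean s t) (wmean c t) => x y; ring.
Qed.

(* Separation of variables by the fundamental theorem of calculus:
   [wmean s t = wmean c t + \int_c^s dwmean x t dx], the constant term being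
   the integral over [[c - 1, c[]. *)
Lemma wmean_separation : exists (sigma : probability (measurableTypeR R) R)
    (alpha beta : R -> R -> R),
  [/\ measurable_fun setT (fun p : R * R => alpha p.1 p.2),
      measurable_fun setT (fun p : R * R => beta p.1 p.2),
      exists L : R, forall s x, c <= s <= K -> `|alpha s x| <= L /\ `|beta s x| <= L &
      forall s t, c <= s <= K -> c <= t <= K ->
        wmean s t = Rintegral sigma setT (fun x => alpha s x * beta t x)].
Proof.
have c1K : c - 1 < K by rewrite (lt_le_trans _ cK)// gtrBl.
exists (uniform_prob c1K), alpha, beta; split => // s t sI tI.
have t0 : 0 < t by case/andP: tI => h _; exact: lt_le_trans h.
rewrite /Rintegral integral_uniform.
- have -> : K - (c - 1) = K - c + 1 by ring.
  by rewrite integral_beta// -EFinM /= mulrA mulVf ?mul1r// gt_eqF.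
- apply/measurable_EFinP; apply: measurable_funM.
    exact: (measurableT_comp malpha (measurable_pair1 s)).
  exact: (measurableT_comp mbeta (measurable_pair1 t)).
- by move=> x; rewrite lee_fin mulr_ge0.
Qed.

End Separation.

(** * The Aluthge transform of a weighted shift *)

Section Fubini.
Context d d' (T : measurableType d) (Om : measurableType d') (R : realType).
Variable m : {measure set T -> \bar R}.
Hypothesis msf : sigma_finite setT m.
Variable sigma : {finite_measure set Om -> \bar R}.
Local Notation Re := complex.Re.
Local Notation Im := complex.Im.
Variables (a : T -> Om -> R) (L : R).
Hypotheses (ma : measurable_fun setT (fun p : T * Om => a p.1 p.2))
  (aL : forall p x, `|a p x| <= L).

Let ma1 p : measurable_fun setT (a p).
Proof. exact: (measurableT_comp ma (measurable_pair1 p)). Qed.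

Let ma2 x : measurable_fun setT (a^~ x).
Proof. exact: (measurableT_comp ma (measurable_pair2 x)). Qed.

Let ba1 p : rbounded (a p).
Proof. by split => //; exists L. Qed.

Let sfin : (sigma setT < +oo)%E.
Proof. by rewrite ltey_eq fin_num_measure. Qed.

Lemma Rintegral_bounded_Fubini (g : T -> R) :
  m.-integrable setT (EFin \o g) ->
  Rintegral sigma setT (fun x => Rintegral m setT (fun p => a p x * g p)) =
  Rintegral m setT (fun p => Rintegral sigma setT (a p) * g p).
Proof.
move=> gi; have mg : measurable_fun setT g.
  by apply/measurable_EFinP; exact: measurable_int gi.
(* [m] with its proof of sigma-finiteness, bundled in the form that the Fubini theorem expects. *)
pose M : {sigma_finite_measure set T -> \bar R} :=
  HB.pack_for (SigmaFiniteMeasure.type T R) (Measure.sort m)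
    (isSFinite.Build _ _ _ _ (sfinite_measure_sigma_finite msf))
    (isSigmaFinite.Build _ _ _ _ msf).
have mM (f : T -> \bar R) : (\int[m]_p f p = \int[M]_p f p)%E by [].
have gM : M.-integrable setT (EFin \o g) by [].
clearbody M.
pose f (z : T * Om) : \bar R := (a z.1 z.2 * g z.1)%:E.
have mf : measurable_fun setT f.
  apply/measurable_EFinP; apply: measurable_funM => //.
  exact: (measurableT_comp mg measurable_fst).
have iag x : m.-integrable setT (EFin \o (fun p => a p x * g p)).
  apply: integrable_bound (integrable_lin L 0 gi gi).
    by apply: measurable_funM.
  move=> p; rewrite mul0r addr0 !normrM ler_wpM2r// (le_trans (aL _ _))//.
  exact: ler_norm.
have is_ p : sigma.-integrable setT (EFin \o a p).
  exact: integrable_rbounded.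
have fi : (M \x sigma)%E.-integrable setT f.
  apply/integrable12ltyP => //.
  apply: (@le_lt_trans _ _ (\int[M]_p (`|g p| * (`|L| * fine (sigma setT)))%:E)%E).
    apply: ge0_le_integral => //.
    - by move=> p _; apply: integral_ge0.
    - apply: (@measurable_fun_fubini_tonelli_F _ _ _ _ _ sigma
        (fun z => `|f z|%E)) => //.
      exact: measurableT_comp.
    - apply/measurable_EFinP; apply: measurable_funM => //.
      exact: measurableT_comp.
    - move=> p _ /=; rewrite /fubini_F.
      apply: (@le_trans _ _ (\int[sigma]_y (`|g p| * `|L|)%:E)%E).
        apply: ge0_le_integral => //.
        + apply/measurable_EFinP; apply: measurableT_comp => //.
          by apply: measurable_funM.
        + move=> y _ /=; rewrite lee_fin normrM mulrC ler_wpM2l//.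
          by rewrite (le_trans (aL _ _))// ler_norm.
      rewrite integral_cst// mulrA [leRHS]EFinM fineK ?fin_num_measure//.
  under eq_integral do rewrite EFinM muleC.
  rewrite integralZl//.
    apply: lte_mul_pinfty => //; first by rewrite lee_fin mulr_ge0// fine_ge0.
    by case/integrableP: gM.
  by have := integrable_abse gM; congr (_.-integrable _ _).
rewrite /Rintegral.
transitivity (fine (\int[sigma]_x \int[M]_p f (p, x))%E).
  congr fine; apply: eq_integral => x _ /=.
  by rewrite fineK//; apply: integrable_fin_num => //; exact: iag.
rewrite -(Fubini fi); congr fine; rewrite mM; apply: eq_integral => p _ /=.
rewrite -RintegralZr//; rewrite /Rintegral fineK//.
apply: integrable_fin_num => //.
have := integrable_lin (g p) 0 (is_ p) (is_ p); congr (_.-integrable _ _).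
by apply/funext => y /=; rewrite mul0r addr0 mulrC.
Qed.

Lemma cintegral_bounded_Fubini (g : T -> R[i]) : cintegrable m g ->
  cintegral sigma (fun x => cintegral m (fun p => (a p x)%:C * g p)) =
  cintegral m (fun p => (Rintegral sigma setT (a p))%:C * g p).
Proof.
move=> [g1 g2].
have ReZ (c : R) z : Re (c%:C * z) = c * Re z by rewrite ReM /= mul0r subr0.
have ImZ (c : R) z : Im (c%:C * z) = c * Im z by rewrite ImM /= mul0r addr0.
rewrite !cintegralE; congr (_ +i* _).
- under eq_fun do rewrite /=; under [in RHS]eq_fun do rewrite ReZ.
  rewrite -(Rintegral_bounded_Fubini g1); congr Rintegral; apply/funext => x.
  by congr Rintegral; apply/funext => p; rewrite ReZ.
- under eq_fun do rewrite /=; under [in RHS]eq_fun do rewrite ImZ.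
  rewrite -(Rintegral_bounded_Fubini g2); congr Rintegral; apply/funext => x.
  by congr Rintegral; apply/funext => p; rewrite ImZ.
Qed.

Lemma Rintegral_section_bounded :
  rbounded (fun p => Rintegral sigma setT (a p)).
Proof.
split.
  (* Shifting by [|L|] makes the integrand nonnegative, so that measurability in [p] follows from
     Tonelli. *)
  have b0 p x : 0 <= a p x + `|L|.
    have /ler_normlP[h _] := le_trans (aL p x) (ler_norm L).
    by rewrite addrC -[a p x]opprK subr_ge0.
  have -> : (fun p => Rintegral sigma setT (a p)) =
      (fun p => fine (\int[sigma]_x (a p x + `|L|)%:E)%E - `|L| * fine (sigma setT)).
    apply/funext => p.
    rewrite -[X in X - _]/(Rintegral sigma setT (fun x => a p x + `|L|)).
    rewrite RintegralD ?Rintegral_cst ?addrK//; first exact: integrable_rbounded.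
    by apply: integrable_rbounded => //; exact: rbounded_cst.
  apply: measurable_funB => //.
  apply: (measurableT_comp (@fine_measurable _ _ measurableT)) => //.
  apply: (@measurable_fun_fubini_tonelli_F _ _ _ _ _ sigma
    (fun z : T * Om => (a z.1 z.2 + `|L|)%:E)).
  - by apply/measurable_EFinP; apply: measurable_funD.
  - by move=> z; rewrite lee_fin.
exists (`|L| * fine (sigma setT)) => p.
apply: (le_trans (le_normr_Rintegral _ _)) => //; first exact: integrable_rbounded.
rewrite -(Rintegral_cst _ measurableT); apply: le_Rintegral => //.
- apply: integrable_rbounded => //; split; first exact: measurableT_comp.
  by exists L => x; rewrite normr_id.
- by apply: integrable_rbounded => //; exact: rbounded_cst.
- by move=> x _; rewrite (le_trans (aL p x))// ler_norm.
Qed.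

End Fubini.

Section WeightedShift.
Context d (T : measurableType d) (R : realType).
Variable m : {measure set T -> \bar R}.
Hypothesis msf : sigma_finite setT m.
Variables (th thV : T -> T).
Hypotheses (hth : measure_preserving m m th) (hthV : measure_preserving m m thV).
Hypotheses (thK : cancel th thV) (thVK : cancel thV th).
Implicit Types (u v w : L2 m).

Lemma dot_compopl u v : dot (compop m th u) v = dot u (compop m thV v).
Proof.
by rewrite -(dot_compop hthV (compop m th u) v) (compopK hthV hth thVK u).
Qed.

Lemma rmul_compop a u : rbounded a ->
  rmul m a (compop m th u) = compop m th (rmul m (a \o thV) u).
Proof.
move=> [ma [L aL]].
have ba : rbounded (a \o thV).
  by split; [exact: (measurableT_comp ma (proj1 hthV))|exists L => x; exact: aL].
rewrite (compop_rmul hth u ba); congr (rmul m _ _).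
by apply/funext => x /=; rewrite thK.
Qed.

(** A weak integral of weighted shifts is the shift whose weight is the integral of the weights;
    this is Fubini on [T] times [Om]. *)
Lemma cintegral_kernel d' (Om : measurableType d')
    (sigma : {finite_measure set Om -> \bar R}) (kap : T -> Om -> R) (L : R) u v :
  measurable_fun setT (fun p : T * Om => kap p.1 p.2) ->
  (forall p x, `|kap p x| <= L) ->
  cintegral sigma (fun x => dot (compop m th (rmul m (kap^~ x) u)) v) =
  dot (compop m th (rmul m (fun p => Rintegral sigma setT (kap p)) u)) v.
Proof.
move=> mk kL; rewrite dot_compopl.
have bk x : rbounded (kap^~ x).
  split; last by exists L.
  exact: (measurableT_comp mk (measurable_pair2 x)).
have bR := Rintegral_section_bounded sigma mk kL.
rewrite (dot_mulop _ _ (rbounded_cbounded bR)).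
pose g p := u p * (compop m thV v p)^*.
transitivity (cintegral m (fun p => (Rintegral sigma setT (kap p))%:C * g p)).
  rewrite -(cintegral_bounded_Fubini msf sigma mk kL (cintegrable_dot u _)).
  congr cintegral; apply/funext => x.
  rewrite dot_compopl (dot_mulop _ _ (rbounded_cbounded (bk x))).
  by congr cintegral; apply/funext => p; rewrite mulrA.
by congr cintegral; apply/funext => p; rewrite /g mulrA.
Qed.

Variables (b : T -> R) (c K r lam : R).
Hypotheses (mb : measurable_fun setT b) (c0 : 0 < c).
Hypothesis bcK : forall x, c <= b x <= K.
Hypotheses (r0 : r != 0) (lam01 : 0 < lam < 1).

Let S : operator m := compop m th \o rmul m b.
Let D : set R := spectrum (rmul m b).

Let b_gt0 x : 0 < b x.
Proof. by have /andP[h _] := bcK x; exact: lt_le_trans h. Qed.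

Let bb : rbounded b.
Proof.
by split => //; exists K => x; rewrite gtr0_norm//; have /andP[] := bcK x.
Qed.

Lemma adjoint_weighted_shift : adjoint S \o S = rmul m b \o rmul m b.
Proof.
have -> : adjoint S = rmul m b \o compop m thV.
  by apply: adjointP => u v /=; rewrite dot_compopl (rmul_adj _ _ bb).
by apply/funext => u /=; rewrite (compopK hthV hth thVK).
Qed.

Lemma polar_weighted_shift : polar_decomposition S (compop m th) (rmul m b).
Proof.
split => //.
- split; last by rewrite adjoint_weighted_shift.
  split; first exact: rmul_bounded.
  move=> u; rewrite (dot_rmul _ bb) lecE /= eqxx /=.
  by apply: Rintegral_ge0 => x _; rewrite mulr_ge0 ?sqmod_ge0// ltW.
- split; first exact: (compop_bounded hth).
  rewrite (compop_adj hth hthV thK thVK); apply/funext => u /=.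
  by rewrite (compopK hthV hth thVK).
- have [k bk [h1 h2]] := rmul_inverse bb c0 (aeW m (fun x =>
    le_trans (proj1 (andP (bcK x))) (ler_norm (b x)))).
  have SK : cancel S (rmul m k \o compop m thV).
    by move=> u; rewrite /S /= (compopK hthV hth thVK) h1.
  have CK := compopK hthV hth thVK.
  move=> u; split => [h|h].
    by rewrite -(CK u) h (op0 (compop_linear hthV)) /S /=
      (op0 (rmul_linear m bb)) (op0 (compop_linear hth)).
  rewrite -(SK u) h /= (op0 (compop_linear hthV)) (op0 (rmul_linear m bk)).
  by rewrite (op0 (compop_linear hth)).
Qed.

(** The modulus is fixed by uniqueness of the positive square root, and the isometric factor because
    multiplication by [b] is onto. *)
Lemma polar_weighted_shift_unique W A : polar_decomposition S W A ->
  W = compop m th /\ A = rmul m b.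
Proof.
move=> [[[bA A0] AA] SE _ _].
have AE : A = rmul m b.
  apply: (positive_sqrt_unique c0 bA A0 bb).
    by move=> x; have /andP[] := bcK x.
  by move=> u; have /(congr1 (fun F => F u)) := AA; rewrite adjoint_weighted_shift.
split => //; have [k bk [h1 h2]] := rmul_inverse bb c0 (aeW m (fun x =>
    le_trans (proj1 (andP (bcK x))) (ler_norm (b x)))).
apply/funext => u; rewrite -(h2 u).
by have /(congr1 (fun F => F (rmul m k u))) := SE; rewrite AE.
Qed.

Let DcK s : D s -> c <= s <= K. Proof. exact: spectrum_sub. Qed.

Let mD : measurable D. Proof. exact: spectrum_measurable. Qed.

Let aeD : \forall x \ae m, D (b x). Proof. exact: ae_in_spectrum. Qed.

Lemma spectral_decomposition_rmul :
  spectral_decomposition (rmul m b) (mul_pvm b).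
Proof.
have bid : rbounded (id \_ D : R -> R).
  apply: (rbounded_patch (L := K) mD) => // s /DcK /andP[cs sK].
  by rewrite ger0_norm// ltW// (lt_le_trans c0 cs).
split => //; first exact: mul_pvmP.
- rewrite -/D /mul_pvm -mulop1; apply: mulop_ae_eq.
  + by apply: cmeasurable_real; apply: measurable_indic; exact: preimage_measurable.
  + exact: cbounded_cst.
  + by apply: filterS aeD => x Dx _; rewrite indicE mem_set.
- have bE : rmul m b = rmul m (fun x => (id \_ D) (b x)).
    apply/esym/rmul_ae_eq => //.
      by have [h _] := bid; exact: (measurableT_comp h mb).
    by apply: filterS aeD => x Dx _; rewrite patchE mem_set.
  by rewrite -/D [X in is_spectral_integral _ _ _ X]bE;
    exact: (mul_pvm_spectral_integral m bb bid).
Qed.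

(** A multiplier [alpha (b)] to the left of the shift becomes [alpha (b o thV)] to its right, which
    explains the first argument. *)
Let wm p := wmean r lam (b (thV p)) (b p).

Let mwm : measurable_fun setT wm.
Proof.
apply: measurable_wmean => //; exact: (measurableT_comp mb (proj1 hthV)).
Qed.

Let bwm : rbounded wm.
Proof.
split => //; exists K => p.
have /andP[h1 h2] := wmean_itv r0 lam01 c0 (bcK (thV p)) (bcK p).
by rewrite ger0_norm// ltW// (lt_le_trans c0).
Qed.

(** The separation is arbitrary and disappears from the result, so the lemma serves existence, with
    [wmean_separation], and uniqueness, with an unknown separation. The kernel is evaluated at
    [(b (thV p), b p)], and both values lie in the spectrum for almost every [p]. *)
Lemma dot_separated_kernel d' (Om : measurableType d')
    (sigma : {finite_measure set Om -> \bar R}) (alpha beta : R -> Om -> R)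
    (L : R) u v :
  measurable_fun (D `*` [set: Om]) (fun p : R * Om => alpha p.1 p.2) ->
  measurable_fun (D `*` [set: Om]) (fun p : R * Om => beta p.1 p.2) ->
  (forall s x, D s -> `|alpha s x| <= L /\ `|beta s x| <= L) ->
  (forall s t, D s -> D t -> s * power_mean r lam (t / s) =
    Rintegral sigma setT (fun x => alpha s x * beta t x)) ->
  (forall x, rbounded ((alpha^~ x) \_ D) /\ rbounded ((beta^~ x) \_ D)) /\
  cintegral sigma (fun x =>
    dot (rmul m (fun p => ((alpha^~ x) \_ D) (b p))
          (compop m th (rmul m (fun p => ((beta^~ x) \_ D) (b p)) u))) v) =
  dot (compop m th (rmul m wm u)) v.
Proof.
move=> ma me abL psiE.
pose e (f : R -> Om -> R) (s : R) x := ((f^~ x) \_ D) s.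
have me_ (f : R -> Om -> R) :
    measurable_fun (D `*` [set: Om]) (fun p : R * Om => f p.1 p.2) ->
    measurable_fun setT (fun p : R * Om => e f p.1 p.2).
  move=> /measurable_restrictT-/(_ (measurableX mD measurableT)).
  congr measurable_fun; apply/funext => -[s x]; rewrite /e !patchE.
  by rewrite in_setX in_setT andbT.
have eL (f : R -> Om -> R) : (forall s x, D s -> `|f s x| <= L) ->
    forall s x, `|e f s x| <= `|L|.
  move=> h s x; rewrite /e patchE; case: ifPn => [|_]; last by rewrite normr0.
  by rewrite inE => Ds; rewrite (le_trans (h s x Ds))// ler_norm.
have aL := eL alpha (fun s x Ds => proj1 (abL s x Ds)).
have bL := eL beta (fun s x Ds => proj2 (abL s x Ds)).
have rb (f : R -> Om -> R) x :
    measurable_fun setT (fun p : R * Om => e f p.1 p.2) ->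
    (forall s x, `|e f s x| <= `|L|) -> rbounded (e f ^~ x).
  move=> h1 h2; split; last by exists `|L|.
  exact: (measurableT_comp h1 (measurable_pair2 x)).
have rbb (f : R -> R) (g : T -> R) : rbounded f -> measurable_fun setT g ->
    rbounded (fun p => f (g p)).
  move=> [h1 [N h2]] mg; split; first exact: (measurableT_comp h1 mg).
  by exists N => p; exact: h2.
have ra x := rb alpha x (me_ _ ma) aL.
have rbt x := rb beta x (me_ _ me) bL.
split; first by move=> x; split; [exact: ra|exact: rbt].
pose kap p x := e alpha (b (thV p)) x * e beta (b p) x.
have mbV : measurable_fun setT (b \o thV).
  exact: (measurableT_comp mb (proj1 hthV)).
have mpair (g : T -> R) : measurable_fun setT g ->
    measurable_fun setT (fun q : T * Om => (g q.1, q.2)).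
  move=> mg; apply: measurable_fun_pair => //.
  exact: (measurableT_comp mg measurable_fst).
have mkap : measurable_fun setT (fun p : T * Om => kap p.1 p.2).
  apply: measurable_funM.
    exact: (measurableT_comp (me_ _ ma) (mpair _ mbV)).
  exact: (measurableT_comp (me_ _ me) (mpair _ mb)).
have kapL p x : `|kap p x| <= `|L| * `|L|.
  by rewrite normrM ler_pM.
have kapE x : rmul m (fun p => ((alpha^~ x) \_ D) (b p))
    (compop m th (rmul m (fun p => ((beta^~ x) \_ D) (b p)) u)) =
    compop m th (rmul m (kap^~ x) u).
  rewrite rmul_compop; last exact: rbb (ra x) mb.
  rewrite rmul_comp//; last exact: rbb (rbt x) mb.
  exact: rbb (ra x) mbV.
under eq_fun => x do rewrite kapE.
rewrite (cintegral_kernel sigma u v mkap kapL).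
suff -> : rmul m (fun p => Rintegral sigma setT (kap p)) = rmul m wm by [].
apply: rmul_ae_eq => //.
  by case: (Rintegral_section_bounded sigma mkap kapL).
apply: filterS2 aeD (ae_mp hthV aeD) => p Dp Dq _.
rewrite /wm -power_meanE ?b_gt0// psiE//; congr Rintegral.
by apply/funext => x; rewrite /kap /e !patchE !mem_set.
Qed.

Lemma is_aluthge_weighted_shift :
  is_aluthge (power_mean r lam) S (compop m th \o rmul m wm).
Proof.
(* The inequality [c <= K] would require a point of [T]; [Num.max c K] avoids it. *)
have cK' : c <= Num.max c K by rewrite le_max lexx.
have DcK' s : D s -> c <= s <= Num.max c K.
  by move=> /DcK /andP[-> sK]; rewrite le_max sK orbT.
have [sigma [alpha [beta [ma me [L abL] wE]]]] :=
  wmean_separation r0 lam01 c0 cK'.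
have mDT : measurable (D `*` [set: R]) by exact: measurableX.
have ma' := measurable_funTS ma : measurable_fun (D `*` [set: R]) _.
have me' := measurable_funTS me : measurable_fun (D `*` [set: R]) _.
have abL' s x : D s -> `|alpha s x| <= L /\ `|beta s x| <= L.
  by move=> /DcK' h; exact: abL.
have psiE s t : D s -> D t -> s * power_mean r lam (t / s) =
    Rintegral sigma setT (fun x => alpha s x * beta t x).
  move=> /DcK' hs /DcK' ht; rewrite -wE// power_meanE//.
    by case/andP: hs => h _; exact: lt_le_trans h.
  by case/andP: ht => h _; exact: lt_le_trans h.
exists (compop m th), (rmul m b), (mul_pvm b); split.
- exact: polar_weighted_shift.
- exact: spectral_decomposition_rmul.
split; first exact: bounded_op_comp (compop_bounded hth) (rmul_bounded m bwm).
exists _, _, sigma, alpha, beta.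
exists (fun x => rmul m (fun p => ((alpha^~ x) \_ D) (b p))).
exists (fun x => rmul m (fun p => ((beta^~ x) \_ D) (b p))).
split => //.
- by exists L.
- move=> x; have [rb _] := dot_separated_kernel (sigma := sigma) 0 0 ma' me' abL' psiE.
  have [ra rbt] := rb x.
  by split; exact: mul_pvm_spectral_integral.
- move=> u v; have [_ hE] := dot_separated_kernel (sigma := sigma) u v ma' me' abL' psiE.
  by rewrite hE.
Qed.

(** For any admissible data, polar uniqueness fixes [W] and [A], and spectral uniqueness turns the
    factors of the weak integral into multiplication operators; the integral is then the one already
    computed. *)
Lemma aluthge_weighted_shift :
  aluthge (power_mean r lam) S = compop m th \o rmul m wm.
Proof.
apply: xget_unique; first exact: is_aluthge_weighted_shift.
move=> Y [W [A [E [pol [hE mDA EDA EA] [[lY _]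
  [d' [Om [sigma [alpha [beta [A' [B' [[ma me] [L abL] psiE AB YE]]]]]]]]]]]]].
have [WE AE] := polar_weighted_shift_unique pol.
rewrite AE -/D in mDA EDA EA ma me abL psiE AB; rewrite WE in YE.
apply/funext => u; apply: dot_ext => v; rewrite YE.
have [rb <-] := dot_separated_kernel u v ma me abL psiE.
congr cintegral; apply/funext => x; have [hA hB] := AB x; have [ra rbt] := rb x.
have b1 y : c <= b y by have /andP[] := bcK y.
have b2 y : b y <= K by have /andP[] := bcK y.
rewrite (spectral_integral_unique bb hE mDA EDA c0 DcK b1 b2 EA ra hA).
by rewrite (spectral_integral_unique bb hE mDA EDA c0 DcK b1 b2 EA rbt hB).
Qed.

End WeightedShift.

(** * The crossed product *)

Section IntProduct.
Context d (X : measurableType d) (R : realType).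
Variable mu : probability X R.
Local Notation m := (crossed_measure mu).

(** [int] is countable, so a preimage is a countable union of slices; maps such as
    [(n, x) |-> phi ^ (- n) x] are treated one [n] at a time. *)
Lemma measurable_fun_int_prod d' (Y : measurableType d') (g : int * X -> Y) :
  (forall n, measurable_fun setT (fun x => g (n, x))) -> measurable_fun setT g.
Proof.
move=> mg _ B mB; rewrite setTI.
have -> : g @^-1` B = \bigcup_n ([set n] `*` ((fun x => g (n, x)) @^-1` B)).
  apply/seteqP; split => [[n x] /= Bx|[n x] [k _ [/= -> //]]].
  by exists n.
apply: countable_bigcupT_measurable => [|n]; first exact: countableP.
by apply: measurableX => //; rewrite -[X in measurable X]setTI; exact: mg.
Qed.

Lemma crossed_measureE A : m A = (\int[counting]_n mu (xsection A n))%E.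
Proof. by []. Qed.

Lemma crossed_measureX (A : set int) (B : set X) : measurable B ->
  m (A `*` B) = (counting A * mu B)%E.
Proof. by move=> mB; exact: product_measure1E. Qed.

Lemma counting_preimage (f fV : int -> int) (A : set int) : cancel f fV ->
  cancel fV f -> counting (f @^-1` A) = counting A :> \bar R.
Proof.
move=> fK fVK.
have E : f @^-1` A = fV @` A.
  apply/seteqP; split => [x /= Ax|x [y Ay <-]]; last by rewrite /= fVK.
  by exists (f x).
have E2 : A = f @` (f @^-1` A).
  apply/seteqP; split => [x Ax|x [y Ay <-//]].
  by exists (fV x); rewrite /= fVK.
rewrite /counting; have [fA|fA] := pselect (finite_set A); last first.
  by rewrite !asboolF// => h; apply: fA; rewrite E2; exact: finite_image.
rewrite !asboolT//; last by rewrite E; exact: finite_image.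
rewrite E fset_set_image// finmap.card_imfset//.
exact: can_inj fVK.
Qed.

Lemma counting1 (k : int) : counting [set k] = 1%E :> \bar R.
Proof. by rewrite /counting asboolT// fset_set1 finmap.cardfs1. Qed.

Definition int_shift (k : int) (p : int * X) : int * X := (p.1 - k, p.2).

Lemma int_shiftK k : cancel (int_shift k) (int_shift (- k)).
Proof. by move=> [n x]; rewrite /int_shift /= opprK subrK. Qed.

Lemma int_shiftVK k : cancel (int_shift (- k)) (int_shift k).
Proof. by move=> [n x]; rewrite /int_shift /= opprK addrK. Qed.

Lemma int_shift_mp k : measure_preserving m m (int_shift k).
Proof.
split.
  by apply: measurable_fun_int_prod => n; exact: measurable_pair1.
move=> A mA; rewrite !crossed_measureE.
have hk : measure_preserving (counting : set int -> \bar R) counting (fun n => n - k).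
  split => // B _; apply: (@counting_preimage _ (fun n => n + k)).
    by move=> n; rewrite subrK.
  by move=> n; rewrite addrK.
by rewrite -[RHS](ge0_integral_mp hk).
Qed.

Lemma crossed_sigma_finite : sigma_finite setT m.
Proof.
exists (fun n => [set k : int | (`|k| <= n)%N] `*` setT).
  apply/seteqP; split => // -[k x] _; exists `|k|%N => //=; by split.
move=> n; split; first exact: measurableX.
rewrite crossed_measureX// probability_setT mule1 /counting asboolT ?ltry//.
apply: (@sub_finite_set _ _ ((fun i : nat => i%:Z) @` `I_n.+1 `|`
  (fun i : nat => - i%:Z) @` `I_n.+1)).
  move=> k /= kn; case: k kn => i kn; [left|right].
    by exists i.
  by exists i.+1; rewrite //= NegzE.
by rewrite finite_setU; split; apply: finite_image; exact: finite_II.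
Qed.

(** The copy of [X] over the integer zero, on which the crossed measure restricts to [mu]. *)
Definition level0 : set (int * X) := [set 0] `*` setT.

Lemma measurable_level0 : measurable level0.
Proof. exact: measurableX. Qed.

Lemma crossed_measure_level0 (B : set X) : measurable B ->
  m ([set 0] `*` B) = mu B.
Proof. by move=> mB; rewrite crossed_measureX// counting1 mul1e. Qed.

Lemma integrable_level0 : m.-integrable setT (EFin \o (\1_level0 : int * X -> R)).
Proof.
apply/integrableP; split.
  by apply/measurable_EFinP; apply: measurable_indic; exact: measurable_level0.
rewrite (eq_integral (fun p => (\1_level0 p)%:E)); last first.
  by move=> p _ /=; rewrite ger0_norm// indicE.
rewrite integral_indic//; last exact: measurable_level0.
by rewrite setIT crossed_measure_level0// probability_setT ltry.
Qed.

Lemma Rintegral_level0 (f : X -> R) : rbounded f ->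
  Rintegral mu setT f = Rintegral m setT (fun p => f p.2 * \1_level0 p).
Proof.
move=> bf; apply: Rintegral_density => //.
- exact: measurable_indic measurable_level0.
- move=> B mB; have mB2 : measurable (snd @^-1` B : set (int * X)).
    by rewrite -[X in measurable X]setTI; exact: measurable_snd.
  rewrite integral_indic//; last exact: measurable_level0.
  transitivity (m ([set 0] `*` B)); first by rewrite crossed_measure_level0.
  congr (m _); by apply/seteqP; split => [[n x] [/= -> Bx]|[n x] [[/= -> _] Bx]].
- exact: integrable_level0.
Qed.

Lemma cintegral_level0 (f : X -> R[i]) : cbounded f ->
  cintegral mu f = cintegral m (fun p => f p.2 * (\1_level0 p)%:C).
Proof.
move=> /cbounded_rbounded[b1 b2].
rewrite !cintegralE; congr (_ +i* _).
  rewrite Rintegral_level0//; congr Rintegral; apply/funext => p.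
  by rewrite ReM /= mulr0 subr0.
rewrite Rintegral_level0//; congr Rintegral; apply/funext => p.
by rewrite ImM /= mulr0 add0r.
Qed.

(** Each integer has counting mass one, so the slice at zero of a null set is null. *)
Lemma ae_level0 (Q : int * X -> Prop) : (\forall p \ae m, Q p) ->
  \forall x \ae mu, Q (0, x).
Proof.
move=> [N [mN N0 QN]]; exists (xsection N 0); split.
- exact: measurable_xsection.
- apply/eqP; rewrite eq_le measure_ge0 andbT -N0 -crossed_measure_level0; last first.
    exact: measurable_xsection.
  apply: le_measure; [apply: mem_set|exact: mem_set|].
    by apply: measurableX => //; exact: measurable_xsection.
  by move=> [n x] [/= ->] /xsectionP.
- by move=> x /= nQ; apply/xsectionP; exact: QN.
Qed.

End IntProduct.

Section CrossedOperators.
Context d (X : measurableType d) (R : realType).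
Variable mu : probability X R.
Local Notation m := (crossed_measure mu).
Variables phi phiV : X -> X.
Hypothesis hphi : invertible_measure_preserving mu phi phiV.
Implicit Types (u v w : L2 m) (f g : X -> R[i]) (a b : X -> R).

Lemma phi_mp : measure_preserving mu mu phi.
Proof. by case: hphi. Qed.

Lemma phiV_mp : measure_preserving mu mu phiV.
Proof.
have [mp mpV phiK phiVK hmu] := hphi; split => // A mA.
have mB : measurable (phiV @^-1` A).
  by rewrite -[X in measurable X]setTI; exact: mpV.
apply: etrans (esym (hmu _ mB)) _.
by congr (mu _); apply/seteqP; split => x /=; rewrite phiK.
Qed.

Lemma mp_id : measure_preserving mu mu id.
Proof. by []. Qed.

Lemma mp_comp (g h : X -> X) : measure_preserving mu mu g ->
  measure_preserving mu mu h -> measure_preserving mu mu (g \o h).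
Proof.
move=> [mg hg] [mh hh]; split; first exact: measurableT_comp.
move=> A mA; rewrite comp_preimage hh ?hg//.
by rewrite -[X in measurable X]setTI; exact: mg.
Qed.

Lemma iter_mp (g : X -> X) n : measure_preserving mu mu g ->
  measure_preserving mu mu (iter n g).
Proof.
move=> hg; elim: n => [|n IH]; first exact: mp_id.
have -> : iter n.+1 g = g \o iter n g by apply/funext.
exact: mp_comp.
Qed.

Lemma ziter_mp k : measure_preserving mu mu (ziter phi phiV k).
Proof. by case: k => n; apply: iter_mp; [exact: phi_mp|exact: phiV_mp]. Qed.

Lemma ziterB1 k x : ziter phi phiV (k - 1) x = phiV (ziter phi phiV k x).
Proof.
have [_ _ phiK _ _] := hphi.
case: k => [[|n]|n] //=; first by rewrite subn1 phiK.
by rewrite addn0.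
Qed.

(** The value type is arbitrary so that sets, being predicates, can be lifted as well as
    functions. *)
Definition lift (V : Type) (f : X -> V) (p : int * X) : V :=
  f (ziter phi phiV (- p.1) p.2).

Lemma cp_piE f : cp_pi mu phi phiV f = mulop m (lift f).
Proof. by []. Qed.

Lemma cp_UE : cp_U mu = compop m (@int_shift _ X 1).
Proof. by []. Qed.

Lemma measurable_lift d' (Y : measurableType d') (f : X -> Y) :
  measurable_fun setT f -> measurable_fun setT (lift f).
Proof.
move=> mf; apply: measurable_fun_int_prod => n.
exact: (measurableT_comp mf (proj1 (ziter_mp (- n)))).
Qed.

Lemma cbounded_lift f : cbounded f -> cbounded (lift f).
Proof.
move=> [[m1 m2] [K fK]]; split; last by exists K => p; exact: fK.
by split; [exact: (measurable_lift m1)|exact: (measurable_lift m2)].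
Qed.

Lemma rbounded_lift a : rbounded a -> rbounded (lift a).
Proof.
move=> [ma [K aK]]; split; first exact: measurable_lift.
by exists K => p; exact: aK.
Qed.

Lemma ae_lift (P : X -> Prop) : (\forall x \ae mu, P x) ->
  \forall p \ae m, P (ziter phi phiV (- p.1) p.2).
Proof.
move=> [N [mN N0 PN]]; exists (lift N); split.
- rewrite -[X in measurable X]setTI.
  exact: (measurable_lift (@measurable_id _ _ setT) measurableT mN).
- rewrite crossed_measureE; apply: integral0_eq => n _.
  apply: etrans (etrans _ (proj2 (ziter_mp (- n)) N mN)) N0.
  by congr (mu _); apply/seteqP; split => x; [move/xsectionP|move=> h; apply/xsectionP].
- by move=> p /= nP; exact: PN.
Qed.

Lemma cp_pi_ae f g : cmeasurable f -> cbounded g -> f = g %[ae mu] ->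
  cp_pi mu phi phiV f = cp_pi mu phi phiV g.
Proof.
move=> [m1 m2] bg fg; rewrite !cp_piE; apply: mulop_ae_eq.
- by split; [exact: (measurable_lift m1)|exact: (measurable_lift m2)].
- exact: cbounded_lift.
- by apply: filterS (ae_lift fg) => p h _; exact: h.
Qed.

(** The vector [1 (x) delta_0], whose vector functional realizes the canonical trace. *)
Definition vacuum : L2 m := toL2 m (fun p => (\1_(@level0 _ X) p : R)%:C).

Lemma vacuumE : vacuum = (fun p => (\1_(@level0 _ X) p : R)%:C) %[ae m].
Proof.
apply: toL2K; apply/square_integrableP; split.
  by apply: cmeasurable_real; apply: measurable_indic; exact: measurable_level0.
have -> : (fun p => sqmod ((\1_(@level0 _ X) p : R)%:C)) = \1_(@level0 _ X).
  apply/funext => p; rewrite sqmod_real indicE.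
  by case: (_ \in _); rewrite ?expr1n ?expr0n.
exact: integrable_level0.
Qed.

Lemma cp_U_ziter k u : ziter (cp_U mu) (adjoint (cp_U mu)) k u =
  compop m (@int_shift _ X k) u.
Proof.
have s0 : compop m (@int_shift _ X 0) u = u.
  apply/L2_eqP; apply: filterS (compopE (int_shift_mp mu 0) u) => -[n x] h _.
  by rewrite h//= /int_shift /= subr0.
have sh j k' : compop m (@int_shift _ X j) (compop m (@int_shift _ X k') u) =
    compop m (@int_shift _ X (k' + j)) u.
  apply/L2_eqP; apply: filterS3 (compopE (int_shift_mp mu (k' + j)) u)
    (compopE (int_shift_mp mu j) (compop m (@int_shift _ X k') u))
    (ae_mp (int_shift_mp mu j) (compopE (int_shift_mp mu k') u)) => -[n x] h1 h2 h3 _.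
  by rewrite h2// h3// h1// /int_shift /= opprD addrA addrAC.
have -> : adjoint (cp_U mu) = compop m (@int_shift _ X (- 1)).
  rewrite cp_UE; apply: (compop_adj (int_shift_mp mu 1) (int_shift_mp mu (- 1))).
    exact: int_shiftK.
  exact: int_shiftVK.
rewrite cp_UE; case: k => n /=.
  elim: n => [|n IH] /=; first by rewrite s0.
  by rewrite IH sh -PoszD addn1.
elim: n => [|n IH] /=; first by rewrite NegzE.
rewrite IH sh; congr (compop m (@int_shift _ X _) u).
by rewrite !NegzE -opprD -PoszD addn1.
Qed.

(** For [k != 0] the shift moves the support off level zero, so the product with the vacuum
    vanishes; for [k = 0] the lifted symbol is [f] on that level. *)
Lemma vacuum_expectation k f : cbounded f ->
  dot (ziter (cp_U mu) (adjoint (cp_U mu)) k (cp_pi mu phi phiV f vacuum)) vacuum =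
  if k == 0 then cintegral mu f else 0.
Proof.
move=> bf; rewrite cp_U_ziter cp_piE.
pose F p := lift f (int_shift k p) * (\1_(@level0 _ X) (int_shift k p) : R)%:C.
pose G p := (\1_(@level0 _ X) p : R)%:C : R[i].
have [mI1 mI2] : cmeasurable G.
  by apply: cmeasurable_real; apply: measurable_indic; exact: measurable_level0.
have mF : cmeasurable F.
  apply: (cmeasurable_comp (int_shift_mp mu k) (f := fun p => lift f p * G p)).
  by apply: cmeasurableM => //; case: (cbounded_lift bf).
rewrite (dotE mF (conj mI1 mI2) _ vacuumE); last first.
  apply: filterS3 (compopE (int_shift_mp mu k) (mulop m (lift f) vacuum))
    (ae_mp (int_shift_mp mu k) (mulopE vacuum (cbounded_lift bf)))
    (ae_mp (int_shift_mp mu k) vacuumE) => p h1 h2 h3 _.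
  by rewrite h1// h2// h3.
have FG p : F p * (G p)^* = if k == 0 then f p.2 * (\1_(@level0 _ X) p : R)%:C else 0.
  rewrite /F /G; case: p => n x; rewrite /int_shift /lift /= !indicE.
  have in0 (j : int) : ((j, x) \in @level0 _ X) = (j == 0).
    by apply/idP/idP => [|/eqP ->]; rewrite inE // /level0 /= => -[->].
  have conjR (c : R) : (c%:C)^* = c%:C.
    by apply: eqCP; rewrite ?ReC ?ImC /= ?oppr0.
  have c0 : ((false : nat)%:R : R)%:C = 0 :> R[i] by [].
  have c1 : ((true : nat)%:R : R)%:C = 1 :> R[i] by [].
  rewrite !in0 conjR; have [->|n0] := eqVneq n 0; last by rewrite c0 !mulr0 if_same.
  rewrite sub0r opprK oppr_eq0; have [->|k0] := eqVneq k 0.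
    by rewrite c1 !mulr1.
  by rewrite c0 mulr0 mul0r.
under eq_fun do rewrite FG.
have [k0|k0] := eqVneq k 0; first by rewrite (cintegral_level0 mu bf).
by rewrite cintegralE /= Rintegral_cst//= mul0r.
Qed.

Lemma nneseries_single (f : nat -> R) : (forall n, 0 <= f n) ->
  (forall n, f n.+1 = 0) -> (\sum_(0 <= k <oo) (f k)%:E < +oo)%E.
Proof.
move=> f0 fS; rewrite nneseries_recl//; last by move=> k _; rewrite lee_fin.
by rewrite eseries0 ?adde0 ?ltry// => -[//|k] _ _; rewrite fS.
Qed.

(** [f] is cut off to zero where its essential bound fails. *)
Lemma bounded_representative f : Linf mu f ->
  exists2 f', cbounded f' & f = f' %[ae mu].
Proof.
move=> [[m1 m2] [K fK]]; pose G := [set x | sqmod (f x) <= K ^+ 2].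
have mG : measurable G.
  have -> : G = (fun x => sqmod (f x)) @^-1` `]-oo, K ^+ 2]%classic.
    by apply/seteqP; split => x; rewrite /G /= in_itv/=.
  by apply: preimage_measurable => //; exact: measurable_sqmod.
exists (fun x => f x * (\1_G x : R)%:C).
  split.
    apply: cmeasurableM => //; apply: cmeasurable_real; exact: measurable_indic.
  exists (K ^+ 2) => x; rewrite sqmodM sqmod_real indicE.
  case: (boolP (x \in G)) => [|_]; last by rewrite expr0n mulr0 sqr_ge0.
  by rewrite inE expr1n mulr1.
apply: filterS fK => x fxK _; rewrite indicE mem_set ?mulr1//.
rewrite /G /=; move: fxK; case: (f x) => [p q]; rewrite /sqmod /= => h.
have pq0 : 0 <= p ^+ 2 + q ^+ 2 by rewrite addr_ge0 ?sqr_ge0.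
have {}h : Num.sqrt (p ^+ 2 + q ^+ 2) <= K by move: h; rewrite lecE /= => /andP[].
have K0 : 0 <= K := le_trans (sqrtr_ge0 _) h.
by rewrite -(sqr_sqrtr pq0) ler_sqr ?nnegrE ?sqrtr_ge0.
Qed.

(** The choice made by [xget] is accessible only through its specification; the vacuum functional
    shows that the specification can be met. *)
Lemma canonical_traceP :
  is_canonical_trace phi phiV (@canonical_trace _ _ _ mu phi phiV).
Proof.
apply: xgetPex; exists (fun A => dot (A vacuum) vacuum); split; last first.
  move=> k f lf; have [f' bf' ff'] := bounded_representative lf.
  have [mf _] := lf; rewrite /=.
  rewrite (cp_pi_ae mf bf' ff') vacuum_expectation//; case: eqP => // _.
  by apply: cintegral_ae_eq; [case: bf'|exact: mf|exact: ae_eq_sym].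
split.
- exists (fun n => if n == 0%N then vacuum else 0),
    (fun n => if n == 0%N then vacuum else 0).
  have n0 : L2norm (0 : L2 m) = 0 by rewrite /L2norm dot0l sqrtr0.
  split.
  + by apply: nneseries_single => n; rewrite ?sqr_ge0//= n0 expr0n.
  + by apply: nneseries_single => n; rewrite ?sqr_ge0//= n0 expr0n.
  + move=> A _; apply: cvg_near_cst; near=> n.
    have n1 : (0 < n)%N by near: n; exists 1%N.
    rewrite -(prednK n1) big_nat_recl//= big1 ?addr0 ?subrr.
      by rewrite /Normc.normc /= expr0n /= addr0 sqrtr0.
    by move=> k _; rewrite dot0r.
(* [adjoint A] is the zero map when [A] has no adjoint. *)
- move=> A _ /=; rewrite /adjoint; case: xgetP => [B _ hB|_]; last first.
    by rewrite dot0l.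
  by rewrite dotC -hB dot_nsq lecE ImC ReC /= oppr0 eqxx nsq_ge0.
- have := vacuum_expectation 0 (cbounded_cst X (1 : R[i])).
  rewrite /= cp_piE (mulop1 m) /= => ->; apply: eqCP; rewrite cintegralE /=.
    by rewrite Rintegral_cst// mul1r; exact: congr1 (probability_setT mu).
  by rewrite Rintegral_cst// mul0r.
Unshelve. all: by end_near. Qed.

Lemma cbounded_Linf f : cbounded f -> Linf mu f.
Proof.
move=> [mf [K fK]]; split => //; exists (Num.sqrt K); apply: aeW => x.
have := fK x; case: (f x) => [p q]; rewrite /sqmod /= => h.
by rewrite lecE /= eqxx /= ler_wsqrtr.
Qed.

(** The unitary cancels in the adjoint product, leaving the symbol [|f| ^ 2]. Only the values of the
    trace on symbols enter, and the specification fixes these. *)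
Lemma norm2_weighted_shift f : cbounded f ->
  norm2 mu phi phiV (cp_U mu \o cp_pi mu phi phiV f) =
  Num.sqrt (Rintegral mu setT (fun x => sqmod (f x))).
Proof.
move=> bf; have [_ tauE] := canonical_traceP.
have adjE : adjoint (cp_U mu \o cp_pi mu phi phiV f) \o
    (cp_U mu \o cp_pi mu phi phiV f) =
    cp_pi mu phi phiV (fun x => (f x)^* * f x).
  have -> : adjoint (cp_U mu \o cp_pi mu phi phiV f) =
      mulop m (fun p => (lift f p)^*) \o compop m (@int_shift _ X (- 1)).
    apply: adjointP => u v /=; rewrite cp_UE cp_piE.
    rewrite (dot_compopl (int_shift_mp mu 1) (int_shift_mp mu (- 1)) (@int_shiftVK _ X 1)).
    by rewrite (mulop_adj _ _ (cbounded_lift bf)).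
  apply/funext => u /=; rewrite cp_UE cp_piE.
  rewrite (compopK (int_shift_mp mu (- 1)) (int_shift_mp mu 1) (@int_shiftVK _ X 1)).
  have bl := cbounded_lift bf.
  by rewrite (mulop_comp _ (cbounded_conj bl) bl).
have lf := cbounded_Linf (cboundedM (cbounded_conj bf) bf).
rewrite /norm2 adjE; have := tauE 0 _ lf => /= ->.
rewrite cintegralE /=; congr Num.sqrt; congr Rintegral; apply/funext => x.
by rewrite mulrC mul_conj.
Qed.

End CrossedOperators.

(** * Symbols of positive multiplication operators *)

Section Positivity.
Context d (T : measurableType d) (R : realType).
Variable m : {measure set T -> \bar R}.
Hypothesis msf : sigma_finite setT m.
Implicit Types (u v w : L2 m).

(** Tested on vectors cut down to [{h > 0}], where the integrand is nonnegative and must therefore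
    vanish. *)
Lemma ae_le0 (h : T -> R) : rbounded h ->
  (forall u, Rintegral m setT (fun x => h x * sqmod (u x)) <= 0) ->
  \forall x \ae m, h x <= 0.
Proof.
move=> bh hle; pose G := [set x | 0 < h x].
have mG : measurable G.
  have -> : G = h @^-1` `]0, +oo[%classic.
    by apply/seteqP; split => x; rewrite /G /= in_itv/= andbT.
  by apply: preimage_measurable => //; case: bh.
have bG := rbounded_indic R mG.
suff : \forall x \ae m, ~ G x.
  by apply: filterS => x /negP; rewrite /G /= -leNgt.
apply: (ae_of_L2 msf) => u.
pose k x := \1_G x * (h x * \1_G x).
have bk : rbounded k by apply: rboundedM => //; exact: rboundedM.
have kE : Rintegral m setT (fun x => k x * sqmod (u x)) =
    Rintegral m setT (fun x => h x * sqmod (rmul m (\1_G) u x)).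
  suff : (Rintegral m setT (fun x => k x * sqmod (u x)))%:C =
    (Rintegral m setT (fun x => h x * sqmod (rmul m (\1_G) u x)))%:C :> R[i].
    by move/(congr1 (@complex.Re R)).
  rewrite -!dot_rmul// (rmul_comp _ bh bG) -(rmul_adj _ _ bG).
  by rewrite (rmul_comp _ bG (rboundedM bh bG)).
have k0 x : 0 <= k x.
  rewrite /k indicE; case: (boolP (x \in G)) => [|_]; last by rewrite mul0r.
  by rewrite inE mul1r mulr1 => /ltW.
have /Rintegral_eq0 : forall x, 0 <= k x * sqmod (u x).
  by move=> x; rewrite mulr_ge0// sqmod_ge0.
move=> /(_ _ (integrable_rmul u bk)) h0.
have {}h0 : (fun x => k x * sqmod (u x)) = cst 0 %[ae m].
  apply: h0; apply/eqP; rewrite eq_le {1}kE hle/=.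
  by apply: Rintegral_ge0 => x _; rewrite mulr_ge0// sqmod_ge0.
apply: filterS h0 => x /(_ I) /eqP + Gx; rewrite /k indicE mem_set// mul1r mulr1.
by rewrite mulf_eq0 gt_eqF//= => /eqP /sqmod_eq0.
Qed.

Lemma mulop_ge0 (f : T -> R[i]) : cbounded f ->
  (forall u, 0 <= dot (mulop m f u) u) ->
  \forall x \ae m, 0 <= complex.Re (f x) /\ complex.Im (f x) = 0.
Proof.
move=> bf f0; have [b1 b2] := cbounded_rbounded bf.
have fE u : dot (mulop m f u) u =
    (Rintegral m setT (fun x => complex.Re (f x) * sqmod (u x))) +i*
    (Rintegral m setT (fun x => complex.Im (f x) * sqmod (u x))).
  rewrite dot_mulop// cintegralE; congr (_ +i* _); congr Rintegral; apply/funext => x.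
    by rewrite -mulrA mul_conj ReM /= mulr0 subr0.
  by rewrite -mulrA mul_conj ImM /= mulr0 add0r.
have N (g : T -> R) u : rbounded g -> Rintegral m setT (fun x => - g x * sqmod (u x)) =
    - Rintegral m setT (fun x => g x * sqmod (u x)).
  move=> bg; have gi := integrable_rmul u bg.
  have := Rintegral_lin (- 1) 0 gi gi; rewrite mul0r addr0 mulN1r => <-.
  by congr Rintegral; apply/funext => x; rewrite mul0r addr0 mulN1r mulNr.
have h1 : \forall x \ae m, - complex.Re (f x) <= 0.
  apply: ae_le0; first exact: rboundedN.
  by move=> u; have := f0 u; rewrite fE lecE /= N// oppr_le0 => /andP[].
have h2 : \forall x \ae m, complex.Im (f x) <= 0.
  by apply: ae_le0 => // u; have := f0 u; rewrite fE lecE /= => /andP[/eqP ->].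
have h3 : \forall x \ae m, - complex.Im (f x) <= 0.
  apply: ae_le0; first exact: rboundedN.
  by move=> u; have := f0 u; rewrite fE lecE /= N// => /andP[/eqP ->]; rewrite oppr0.
apply: filterS3 h1 h2 h3 => x; rewrite !oppr_le0 => ? ? ?; split => //.
by apply/eqP; rewrite eq_le; apply/andP.
Qed.

End Positivity.

(** * From iterated Aluthge transforms to iterated weights *)

Section Iterates.
Context d (X : measurableType d) (R : realType).
Variable mu : probability X R.
Local Notation m := (crossed_measure mu).
Variables phi phiV : X -> X.
Hypothesis hphi : invertible_measure_preserving mu phi phiV.

Lemma positive_invertible_symbol (a : X -> R[i]) (L : R) : Linf mu a ->
  positive_op (cp_pi mu phi phiV a) ->
  (forall u, nsq u <= L * nsq (cp_pi mu phi phiV a u)) ->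
  exists (b : X -> R) (c K : R), [/\ measurable_fun setT b, 0 < c,
    forall x, c <= b x <= K & a = (fun x => (b x)%:C) %[ae mu]].
Proof.
move=> la; have [a' ba' aa'] := bounded_representative la.
rewrite (cp_pi_ae hphi (proj1 la) ba' aa') cp_piE => -[_ pos] low.
have msf := crossed_sigma_finite mu.
have bl := cbounded_lift hphi ba'.
(* At level zero the lifted symbol is [a'] itself, so almost everywhere statements on the product
   descend to [X]. *)
have [e e0 /ae_level0 he] := ae_bounded_below msf bl low.
have /ae_level0 h0 := mulop_ge0 msf bl pos.
have [[m1 m2] [K aK]] := ba'.
pose c := Num.sqrt e; pose K' := Num.max c (Num.sqrt K).
(* Truncation makes bounds that hold almost everywhere hold at every point; [K'] is at least [c], so
   the interval is not empty. *)
exists (fun x => Num.max c (Num.min K' (complex.Re (a' x)))), c, K'; split.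
- by apply: measurable_maxr => //; apply: measurable_minr.
- by rewrite sqrtr_gt0.
- move=> x; rewrite le_max lexx /= ge_max {1}/K' le_max lexx /= ge_min.
  by rewrite lexx.
- apply: filterS3 aa' he h0 => x; rewrite /lift /= => h1 h2 [h3 h4] _.
  rewrite h1//; apply: eqCP => //=.
  move: h2; rewrite /sqmod h4 expr0n /= addr0 => h2.
  have cR : c <= complex.Re (a' x).
    by rewrite -(ger0_norm h3) -sqrtr_sqr ler_wsqrtr.
  have RK : complex.Re (a' x) <= K'.
    rewrite le_max; apply/orP; right; rewrite -(ger0_norm h3) -sqrtr_sqr.
    rewrite ler_wsqrtr// (le_trans _ (aK x))// /sqmod h4 expr0n /= addr0.
    exact: lexx.
  by rewrite min_r// max_r.
Qed.

Variables (r lam c K : R).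
Hypotheses (r0 : r != 0) (lam01 : 0 < lam < 1) (c0 : 0 < c).

Definition mean_step (b : X -> R) : X -> R := fun x => wmean r lam (b (phiV x)) (b x).

Lemma measurable_mean_step b : measurable_fun setT b ->
  measurable_fun setT (mean_step b).
Proof.
move=> mb; apply: measurable_wmean => //.
exact: (measurableT_comp mb (proj1 (phiV_mp hphi))).
Qed.

Lemma mean_step_itv b : (forall x, c <= b x <= K) ->
  forall x, c <= mean_step b x <= K.
Proof. by move=> bcK x; exact: wmean_itv. Qed.

Lemma aluthge_mean_step b : measurable_fun setT b -> (forall x, c <= b x <= K) ->
  aluthge (power_mean r lam) (cp_U mu \o cp_pi mu phi phiV (fun x => (b x)%:C)) =
  cp_U mu \o cp_pi mu phi phiV (fun x => (mean_step b x)%:C).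
Proof.
move=> mb bcK; rewrite cp_UE !cp_piE.
(* [int_shift (- 1)] raises [n] by one, and [phi ^ (- n - 1) x] is [phiV (phi ^ (- n) x)]. *)
have E : (fun p => wmean r lam (lift phi phiV b (@int_shift _ X (- 1) p))
    (lift phi phiV b p)) = lift phi phiV (mean_step b).
  apply/funext => -[n x]; rewrite /lift /mean_step /int_shift /=.
  by rewrite -(ziterB1 hphi) opprK opprD.
have := aluthge_weighted_shift (crossed_sigma_finite mu) (int_shift_mp mu 1)
  (int_shift_mp mu (- 1)) (@int_shiftK _ X 1) (@int_shiftVK _ X 1) (measurable_lift hphi mb) c0
  (fun p => bcK _) r0 lam01.
by rewrite E.
Qed.

Lemma measurable_iter_mean_step n b : measurable_fun setT b ->
  measurable_fun setT (iter n mean_step b).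
Proof. by move=> mb; elim: n => //= n; exact: measurable_mean_step. Qed.

Lemma iter_mean_step_itv n b : (forall x, c <= b x <= K) ->
  forall x, c <= iter n mean_step b x <= K.
Proof. by move=> bcK; elim: n => //= n; exact: mean_step_itv. Qed.

Lemma iter_aluthge n b : measurable_fun setT b -> (forall x, c <= b x <= K) ->
  iter n (aluthge (power_mean r lam))
    (cp_U mu \o cp_pi mu phi phiV (fun x => (b x)%:C)) =
  cp_U mu \o cp_pi mu phi phiV (fun x => (iter n mean_step b x)%:C).
Proof.
move=> mb bcK; elim: n => //= n ->; apply: aluthge_mean_step.
  exact: measurable_iter_mean_step.
exact: iter_mean_step_itv.
Qed.

End Iterates.

(** * The mean ergodic theorem *)

Section MeanErgodic.
Context d (T : measurableType d) (R : realType).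
Variable m : {measure set T -> \bar R}.
Local Notation Re := complex.Re.
Local Notation Im := complex.Im.
Implicit Types (u v w k : L2 m).

(** Nonnegativity of [nsq (|v| ^ 2 u - <u, v> v)], divided by [|v| ^ 2]. *)
Lemma cauchy_schwarz u v : sqmod (dot u v) <= nsq u * nsq v.
Proof.
have [v0|v0] := eqVneq (nsq v) 0.
  by rewrite {1}(nsq_eq0 v0) dot0r v0 mulr0 /sqmod /= expr0n /= addr0.
have vp : 0 < nsq v by rewrite lt_neqAle eq_sym v0 nsq_ge0.
have := nsq_ge0 ((nsq v)%:C *: u - dot u v *: v).
rewrite nsqB !nsqZ sqmod_real dotZl dotZr.
have -> : Re ((nsq v)%:C * ((dot u v)^* * dot u v)) = nsq v * sqmod (dot u v).
  move: (dot u v) (nsq v) => c n.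
  by rewrite /sqmod !ReImE /=; move: (Re c) (Im c) => x y; ring.
move: (sqmod _) (nsq u) (nsq v) vp => c x n n0 h.
by rewrite -(ler_pM2l n0); move: h; nra.
Qed.

Lemma conj_real (c : R) : (c%:C)^* = c%:C.
Proof. by apply: eqCP; rewrite ?ReC ?ImC /= ?oppr0. Qed.

Section CommutingAverages.
Variables P Ps : operator m.
Hypotheses (lP : linear P) (lPs : linear Ps).
Hypothesis adjP : forall u v, dot (P u) v = dot u (Ps v).
Hypothesis PPs : forall u, P (Ps u) = Ps (P u).
Hypothesis nsqP_le : forall u, nsq (P u) <= nsq u.
Hypothesis nsqPs_le : forall u, nsq (Ps u) <= nsq u.
Hypothesis nsqP_eq : forall u, nsq (P u) = nsq u -> P u = u.

Definition square_op : operator m := fun u => Ps (P u).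

Let adj_iter n u v : dot (iter n P u) v = dot u (iter n Ps v).
Proof.
elim: n u v => [|n IH] u v; first by [].
by rewrite iterS adjP IH iterSr.
Qed.

Let adj_iterV n u v : dot (iter n Ps u) v = dot u (iter n P v).
Proof. by rewrite dotC -adj_iter -dotC. Qed.

Let PPsn n w : P (iter n Ps w) = iter n Ps (P w).
Proof. by elim: n => [|n IH]; [|rewrite !iterS PPs IH]. Qed.

Let PnPsn j n w : iter j P (iter n Ps w) = iter n Ps (iter j P w).
Proof. by elim: j => [|j IH]; [|rewrite !iterS IH PPsn]. Qed.

Lemma iter_square n u : iter n square_op u = iter n Ps (iter n P u).
Proof. by elim: n => [|n IH]; [|rewrite !iterS IH /square_op PPsn]. Qed.

(** Normality lets every factor [Ps] cross the factors [P] and return to the other side as [P], so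
    only the total [a + b] matters. *)
Lemma dot_iter_square a b u :
  dot (iter a square_op u) (iter b square_op u) = (nsq (iter (a + b) P u))%:C.
Proof.
rewrite !iter_square -adj_iter PnPsn adj_iterV -dot_nsq.
by rewrite -!iterD addnC.
Qed.

Let q n u := nsq (iter n P u).

Let q_le n u : q n.+1 u <= q n u.
Proof. by rewrite /q iterS. Qed.

Let q_mono n j u : (n <= j)%N -> q j u <= q n u.
Proof.
move=> /subnK <-; elim: (j - n)%N => [|i IH]; first by rewrite add0n.
by rewrite addSn (le_trans (q_le _ _)).
Qed.

Let q_inf u : exists2 l : R, forall n, l <= q n u &
  forall e, 0 < e -> exists N, forall n, (N <= n)%N -> q n u <= l + e.
Proof.
pose A := range (q^~ u).
have A0 : A !=set0 by exists (q 0 u), 0%N.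
have lA : lbound A 0 by move=> _ [n _ <-]; exact: nsq_ge0.
have hA : has_inf A by split => //; exists 0.
exists (inf A) => [n|e e0]; first by apply: ge_inf; [exists 0|exists n].
have [_ [N _ <-] hN] := inf_adherent e0 hA.
by exists N => n Nn; rewrite (le_trans (q_mono _ Nn))// ltW.
Qed.

(* [<Q^i u, Q^j u> = |P^(i + j) u|^2] for [Q = Ps P], so
   [|Q^i u - Q^j u|^2 = |P^(2 i) u|^2 + |P^(2 j) u|^2 - 2 |P^(i + j) u|^2], where
   the terms decrease to a common limit. *)
Lemma iter_square_cauchy u (e : R) : 0 < e ->
  exists N, forall i j, (N <= i)%N -> (N <= j)%N ->
    nsq (iter i square_op u - iter j square_op u) <= e.
Proof.
move=> e0; have [l lq hl] := q_inf u.
have [|N hN] := hl (e / 2); first by rewrite divr_gt0.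
have aN (n : nat) : (N <= n)%N -> (N <= n + n)%N.
  by move=> h; rewrite (leq_trans h)// leq_addr.
exists N => i j Ni Nj.
have qE n : nsq (iter n square_op u) = q (n + n) u.
  by rewrite nsqE dot_iter_square.
rewrite nsqB !qE dot_iter_square -[complex.Re _]/(q (i + j) u).
have h1 := hN _ (aN _ Ni); have h2 := hN _ (aN _ Nj); have h3 := lq (i + j)%N.
by move: (q _ u) (q _ u) (q _ u) h1 h2 h3 => x y z; lra.
Qed.

Section Limit.
Variables u w : L2 m.
Hypothesis uw : forall e : R, 0 < e ->
  exists N, forall n, (N <= n)%N -> nsq (iter n square_op u - w) <= e.

Let limit_dot k : (forall n, dot (iter n square_op u) k = dot u k) ->
  dot u k = dot w k.
Proof.
move=> h; apply/eqP; rewrite -subr_eq0 -dotBl; apply/eqP/sqmod_eq0.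
apply/eqP; rewrite eq_le sqmod_ge0 andbT; apply/ler_addgt0Pl => e e0.
have k1 : 0 < nsq k + 1 by rewrite ltr_wpDl// nsq_ge0.
have [|N /(_ N (leqnn N)) hN] := uw (e := e / (nsq k + 1)).
  by rewrite divr_gt0.
rewrite addr0 dotBl -(h N) -dotBl (le_trans (cauchy_schwarz _ _))//.
rewrite (le_trans (ler_wpM2r (nsq_ge0 k) hN))// -mulrA ger_pMr//.
by rewrite mulrC ler_pdivrMr// mul1r lerDl.
Qed.

Let lQ : linear square_op. Proof. exact: linear_comp. Qed.

(** [Q w - w] is the difference between [Q ^ (N + 1) u - w] and [Q (Q ^ N u - w)], both small since
    [Q] is a contraction; this explains the [e / 4]. *)
Let fixQ : square_op w = w.
Proof.
apply/eqP; rewrite -subr_eq0; apply/eqP/nsq_eq0.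
apply/eqP; rewrite eq_le nsq_ge0 andbT; apply/ler_addgt0Pl => e e0.
have [|N hN] := uw (e := e / 4); first by rewrite divr_gt0.
have h1 := hN _ (leqnn N); have h2 := hN _ (leqnSn N).
have -> : square_op w - w = (iter N.+1 square_op u - w) -
    square_op (iter N square_op u - w).
  by rewrite (opB _ _ lQ) iterS opprB [RHS]addrC subrKA.
rewrite addr0 (le_trans (nsqB_le _ _))//.
have h3 : nsq (square_op (iter N square_op u - w)) <= nsq (iter N square_op u - w).
  by rewrite (le_trans (nsqPs_le _)).
by move: h1 h2 h3; move: (nsq _) (nsq _) (nsq _) => x y z; lra.
Qed.

(** From [Q w = w] follows [|P w| ^ 2 = <w, Q w> = |w| ^ 2], and equality of norms forces a fixed
    vector. *)
Lemma limit_fixed : P w = w.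
Proof. by apply: nsqP_eq; rewrite nsqE adjP -/(square_op w) fixQ -nsqE. Qed.

Lemma limit_dot_fixed k : P k = k -> Ps k = k -> dot u k = dot w k.
Proof.
move=> Pk Psk; apply: limit_dot => n; elim: n => [|n IH]; first by [].
by rewrite iterS /square_op dotC -adjP Pk -dotC adjP Psk.
Qed.

(** With [v = u - w], the identity [|P ^ n v| ^ 2 = <Q ^ n v, v>] and Cauchy-Schwarz transfer the
    convergence from [Q] to [P]. *)
Lemma iter_limit (e : R) : 0 < e ->
  exists N, forall n, (N <= n)%N -> nsq (iter n P u - w) <= e.
Proof.
move=> e0; have k1 : 0 < nsq (u - w) + 1 by rewrite ltr_wpDl// nsq_ge0.
have [|N hN] := uw (e := e ^+ 2 / (nsq (u - w) + 1)).
  by rewrite divr_gt0// exprn_gt0.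
exists N => n /hN h.
have Pn x y : iter n P (x - y) = iter n P x - iter n P y.
  by elim: n {h} => [|n IH]; [|rewrite !iterS IH (opB _ _ lP)].
have Qn x y : iter n square_op (x - y) = iter n square_op x - iter n square_op y.
  by elim: n {h Pn} => [|n IH]; [|rewrite !iterS IH (opB _ _ lQ)].
have Pw : iter n P w = w.
  by elim: n {h Pn Qn} => [|n IH]; [|rewrite iterS IH limit_fixed].
have Qw : iter n square_op w = w.
  by elim: n {h Pn Qn Pw} => [|n IH]; [|rewrite iterS IH fixQ].
have := cauchy_schwarz (iter n square_op (u - w)) (u - w).
have := dot_iter_square n 0 (u - w); rewrite addn0 => ->.
rewrite sqmod_real Pn Qn Pw Qw => h2.
suff : nsq (iter n P u - w) ^+ 2 <= e ^+ 2.
  by rewrite ler_sqr// nnegrE ?nsq_ge0// ltW.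
rewrite (le_trans h2)// (le_trans (ler_wpM2r (nsq_ge0 _) h))// -mulrA ger_pMr ?exprn_gt0//.
by rewrite mulrC ler_pdivrMr// mul1r lerDl.
Qed.

End Limit.
End CommutingAverages.

Lemma mean_comm_expand (M : lmodType R[i]) (l k : R[i]) (u x y : M) :
  l *: (l *: u + k *: y) + k *: (l *: x + k *: u) =
  l *: (l *: u + k *: x) + k *: (l *: y + k *: u).
Proof. by rewrite !scalerDr !scalerA addrACA (mulrC k l). Qed.

Section Average.
Variables (V Vs : operator m) (lam : R).
Hypotheses (lV : linear V) (lVs : linear Vs).
Hypothesis adjV : forall u v, dot (V u) v = dot u (Vs v).
Hypotheses (VK : cancel V Vs) (VsK : cancel Vs V).
Hypothesis lam01 : 0 < lam < 1.

Definition average (W : operator m) : operator m :=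
  fun u => lam%:C *: u + (1 - lam)%:C *: W u.

Lemma average_linear (W : operator m) : linear W -> linear (average W).
Proof.
by move=> lW; apply: linear_opD; apply: linear_opZ => //; exact: linear_id.
Qed.

Lemma average_adj u v : dot (average V u) v = dot u (average Vs v).
Proof. by rewrite /average dotDl dotDr !dotZl !dotZr adjV !conj_real. Qed.

Lemma average_comm u : average V (average Vs u) = average Vs (average V u).
Proof.
rewrite /average (opD _ _ lV) (opD _ _ lVs) !(opZ _ _ lV) !(opZ _ _ lVs).
rewrite VK VsK; exact: mean_comm_expand.
Qed.

End Average.

(** Strict convexity in exact form: the loss [lam (1 - lam) |u - V u| ^ 2] shows both that the
    average is a contraction and that it preserves a norm only at fixed vectors. *)
Lemma nsq_average (V : operator m) (lam : R) u : nsq (V u) = nsq u ->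
  nsq (average lam V u) = nsq u - lam * (1 - lam) * nsq (u - V u).
Proof.
move=> nV; rewrite /average (nsqD (lam%:C *: u)) (nsqB u (V u)) (nsqZ lam%:C u).
rewrite (nsqZ (1 - lam)%:C (V u)) !sqmod_real nV (dotZl lam%:C u).
rewrite (dotZr (1 - lam)%:C u (V u)) conj_real.
move: (dot u (V u)) (nsq u) => c n; rewrite !ReM /=; move: (Re c) (Im c) => x y.
by ring.
Qed.

End MeanErgodic.

(** * Mean square completeness for uniformly bounded sequences *)

Section BoundedComplete.
Context d (T : measurableType d) (R : realType).
Variable mu : probability T R.

Let mufin : (mu setT < +oo)%E.
Proof. by rewrite probability_setT ltry. Qed.

Let fin_int (h : T -> R) : rbounded h -> (\int[mu]_x (h x)%:E)%E \is a fin_num.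
Proof.
by move=> bh; apply: integrable_fin_num => //; exact: (integrable_rbounded mufin).
Qed.

Section Subsequence.
Variables (f : nat -> T -> R) (K : R).
Hypotheses (mf : forall n, measurable_fun setT (f n))
  (fK : forall n x, `|f n x| <= K).
Hypothesis rapid : forall k : nat,
  Rintegral mu setT (fun x => (f k.+1 x - f k x) ^+ 2) <= (2 ^- k.+1) ^+ 2.

Let bd n k : rbounded (fun x => f n x - f k x).
Proof.
have bf j : rbounded (f j) by split => //; exists K.
exact: rboundedB.
Qed.

Let d_ k x : R := `|f k.+1 x - f k x|.

Let bd_ k : rbounded (d_ k).
Proof.
have [m1 [L hL]] := bd k.+1 k; split; first exact: measurableT_comp.
by exists L => x; rewrite normr_id.
Qed.

(** [|y| <= (y ^ 2 / t + t) / 2] with [t = 2 ^ - (k + 1)] passes from the mean square to the mean;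
    these bounds sum to one. *)
Let int_d k : (\int[mu]_x (d_ k x)%:E <= (1 / (2 ^ k.+1)%:R)%:E)%E.
Proof.
pose t : R := 2 ^- k.+1.
have t0 : 0 < t by rewrite invr_gt0 exprn_gt0.
have -> : 1 / (2 ^ k.+1)%:R = t by rewrite div1r natrX.
have i1 := integrable_rbounded mufin (bd_ k).
have i2 := integrable_rbounded mufin (rboundedX 2 (bd k.+1 k)).
have i3 := integrable_rbounded mufin (rbounded_cst t).
have := Rintegral_lin (t^-1 / 2) (2^-1) i2 i3.
rewrite (Rintegral_cst mu measurableT).
have -> : fine (mu [set: T]) = 1 by exact: congr1 (probability_setT mu).
move=> h.
rewrite -(fineK (integrable_fin_num measurableT i1)) lee_fin.
rewrite -[leLHS]/(Rintegral mu setT (d_ k)).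
apply: (@le_trans _ _ (t^-1 / 2 *
  Rintegral mu setT (fun x => (f k.+1 x - f k x) ^+ 2) + 2^-1 * (t * 1))).
  rewrite -h; apply: le_Rintegral => //.
    exact: integrable_lin.
  move=> x _; rewrite /d_ -[X in _ * X + _]real_normK ?num_real//.
  move: `|_| => y; rewrite -(ler_pM2l t0).
  have -> : t * (t^-1 / 2 * y ^+ 2 + 2^-1 * t) = (y ^+ 2 + t ^+ 2) / 2.
    by field; rewrite gt_eqF.
  by have := sqr_ge0 (y - t); nra.
have := rapid k; rewrite -/t; move: (Rintegral _ _ _) => I hI.
rewrite -(ler_pM2l t0).
have -> : t * (t^-1 / 2 * I + 2^-1 * (t * 1)) = (I + t ^+ 2) / 2.
  by field; rewrite gt_eqF.
by nra.
Qed.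

Let S x : \bar R := (\sum_(k <oo) (d_ k x)%:E)%E.

Let mS : measurable_fun setT S.
Proof.
have -> : S = fun x => (\sum_(i <oo | i \in xpredT) (d_ i x)%:E)%E.
  by [].
apply: ge0_emeasurable_sum => [k x _ _|k _]; first by rewrite lee_fin normr_ge0.
by apply/measurable_EFinP; case: (bd_ k).
Qed.

Let S0 x : (0 <= S x)%E.
Proof. by apply: nneseries_ge0 => n _ _; rewrite lee_fin normr_ge0. Qed.

Let S_fin : \forall x \ae mu, S x \is a fin_num.
Proof.
have iS : mu.-integrable setT S.
  apply/integrableP; split => //.
  under eq_integral do rewrite gee0_abs//.
  rewrite /S integral_nneseries//; last first.
  - by move=> n x _; rewrite lee_fin normr_ge0.
  - by move=> n; apply/measurable_EFinP; case: (bd_ n).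
  apply: (@le_lt_trans _ _ 1%E); last exact: ltry.
  apply: (le_trans _ (@epsilon_trick0 R 1 xpredT ler01)).
  apply: lee_nneseries => [n *|n *]; last exact: int_d.
  by apply: integral_ge0 => x _; rewrite lee_fin normr_ge0.
by apply: filterS (integrable_ae measurableT iS) => x; exact.
Qed.

Let cvg_S x : S x \is a fin_num -> cvgn (fun k => f k x).
Proof.
move=> Sx.
pose u k := f k.+1 x - f k x.
have cu : cvgn (series u).
  apply: normed_cvg; apply: nondecreasing_is_cvgn.
    by apply: nondecreasing_series => n _ _; rewrite normr_ge0.
  exists (fine (S x)) => _ [n _ <-].
  rewrite -lee_fin (fineK Sx) /= /series /= -sumEFin.
  rewrite big_mkord -(big_mkord xpredT (fun k => (d_ k x)%:E)).
  by apply: nneseries_lim_ge => k _ _; rewrite lee_fin normr_ge0.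
have -> : (fun k => f k x) = (fun k => f 0 x + series u k).
  by apply/funext => k; rewrite /series /= telescope_sumr// addrC subrK.
by apply: is_cvgD => //; exact: is_cvg_cst.
Qed.

(** The sequence is replaced by zero where the series of increments diverges, so the limit exists,
    is measurable and keeps the bound [K] at every point. *)
Lemma rapid_limit : exists g : T -> R, [/\ measurable_fun setT g,
  forall x, `|g x| <= K & \forall x \ae mu, (fun k => f k x) @ \oo --> g x].
Proof.
pose G := [set x | S x \is a fin_num].
have mG : measurable G.
  have -> : G = ~` (S @^-1` [set +oo%E]).
    apply/seteqP; split => x; rewrite /G /=.
      by move=> + Soo; rewrite Soo.
    move=> Soo; rewrite fin_numE; apply/andP; split; last exact/eqP.
    by apply/eqP => Sn; have := S0 x; rewrite Sn.
  by apply: measurableC; rewrite -[X in measurable X]setTI; exact: mS.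
pose h k x := f k x * \1_G x.
have mh k : measurable_fun setT (h k).
  by apply: measurable_funM => //; exact: measurable_indic.
have ch x : cvgn (h^~ x).
  rewrite /h indicE; case: (boolP (x \in G)) => [|_] /=.
    rewrite inE => /cvg_S; under [X in _ -> cvgn X]eq_fun do rewrite mulr1.
    by [].
  under eq_fun do rewrite mulr0; exact: is_cvg_cst.
exists (fun x => limn (h^~ x)); split.
- by apply: (measurable_fun_cvg mh) => x _; exact: ch.
- move=> x; have hK n : `|h n x| <= K.
    rewrite /h normrM indicE; case: (_ \in _); rewrite ?normr1 ?mulr1//.
    by rewrite normr0 mulr0 (le_trans _ (fK 0 x)).
  rewrite ler_norml; apply/andP; split.
    apply: limr_ge => //; apply: nearW => n.
    by have := hK n; rewrite ler_norml => /andP[].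
  apply: limr_le => //; apply: nearW => n.
  by have := hK n; rewrite ler_norml => /andP[].
- apply: filterS S_fin => x Gx.
  have -> : (fun k => f k x) = h^~ x.
    by apply/funext => k; rewrite /h indicE mem_set// mulr1.
  exact: ch.
Qed.

End Subsequence.

Lemma complete_bounded (f : nat -> T -> R) (K : R) :
  (forall n, measurable_fun setT (f n)) -> (forall n x, `|f n x| <= K) ->
  (forall e : R, 0 < e -> exists N : nat, forall i j, (N <= i)%N -> (N <= j)%N ->
    Rintegral mu setT (fun x => (f i x - f j x) ^+ 2) <= e) ->
  exists g : T -> R, [/\ measurable_fun setT g, forall x, `|g x| <= K &
    forall e : R, 0 < e -> exists N : nat, forall n, (N <= n)%N ->
    Rintegral mu setT (fun x => (f n x - g x) ^+ 2) <= e].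
Proof.
move=> mf fK cauchy.
have bf j : rbounded (f j) by split => //; exists K.
have /choice[N hN] : forall k : nat, exists N : nat, forall i j,
    (N <= i)%N -> (N <= j)%N ->
    Rintegral mu setT (fun x => (f i x - f j x) ^+ 2) <= (2 ^- k.+1) ^+ 2.
  by move=> k; apply: cauchy; rewrite exprn_gt0// invr_gt0 exprn_gt0.
(* [s k] exceeds [k] and every [N j] with [j <= k], so consecutive terms of the subsequence meet the
   bound of index [k]. *)
pose s k := (k + \sum_(i < k.+1) N i)%N.
have sN j k : (j <= k)%N -> (N j <= s k)%N.
  by move=> jk; rewrite /s (bigD1 (Ordinal (jk : (j < k.+1)%N)))//= addnCA leq_addr.
have [||k|g [mg gK fg]] := @rapid_limit (fun k => f (s k)) K.
- by [].
- by [].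
- by apply: hN; exact: sN.
exists g; split => // e e0; have [M hM] := cauchy e e0; exists M => n Mn.
have bg : rbounded g by split => //; exists K.
pose F k x : \bar R := ((f n x - f (s k) x) ^+ 2)%:E.
pose G x : \bar R := ((f n x - g x) ^+ 2)%:E.
have bF k : rbounded (fun x => (f n x - f (s k) x) ^+ 2).
  by apply: (rboundedX 2); exact: rboundedB.
have bG : rbounded (fun x => (f n x - g x) ^+ 2).
  by apply: (rboundedX 2); exact: rboundedB.
(* The second index of the Cauchy estimate goes to the limit along the subsequence; [(2 K) ^ 2]
   dominates. *)
have [] := @dominated_convergence _ _ _ mu setT measurableT F G (cst ((2 * K) ^+ 2)%:E).
- by move=> k; apply/measurable_EFinP; case: (bF k).
- by apply/measurable_EFinP; case: bG.
- apply: filterS fg => x hx _; apply: cvg_EFin; first exact: nearW.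
  have c : (fun k => (f n x - f (s k) x) ^+ 2) @ \oo --> (f n x - g x) ^+ 2.
    by rewrite expr2; under eq_fun do rewrite expr2; apply: cvgM;
      apply: cvgB => //; exact: cvg_cst.
  exact: c.
- exact: (integrable_rbounded mufin (rbounded_cst ((2 * K) ^+ 2))).
- apply: aeW => x k _; rewrite /F gee0_abs lee_fin ?sqr_ge0//.
  have := fK n x; have := fK (s k) x; rewrite !ler_norml => /andP[h1 h2] /andP[h3 h4].
  by nra.
move=> _ _ cv; rewrite /Rintegral -lee_fin fineK; last first.
  exact: fin_int bG.
rewrite -[leLHS](cvg_lim _ cv)//; apply: lime_le; first by apply/cvg_ex; exists (\int[mu]_x G x)%E.
have FE k : (\int[mu]_x F k x)%E =
    (Rintegral mu setT (fun x => (f n x - f (s k) x) ^+ 2))%:E.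
  by rewrite /Rintegral fineK//; exact: fin_int (bF k).
near=> k; rewrite /= FE.
rewrite lee_fin; apply: hM => //; near: k; exists M => // k /= Mk.
by rewrite (leq_trans Mk)// leq_addr.
Unshelve. all: by end_near. Qed.

Lemma cbounded_square_integrable (f : T -> R[i]) : cbounded f ->
  square_integrable mu f.
Proof.
move=> bf; have [b1 b2] := cbounded_rbounded bf.
apply/square_integrableP; split; first by case: bf.
have := integrable_rbounded mufin (rboundedD (rboundedX 2 b1) (rboundedX 2 b2)).
by [].
Qed.

Lemma toL2_cbounded_dot (f g : T -> R[i]) : cbounded f -> cbounded g ->
  dot (toL2 mu f) (toL2 mu g) = cintegral mu (fun x => f x * (g x)^*).
Proof.
move=> bf bg; apply: dotE; [by case: bf|by case: bg| |];
  exact: toL2K (cbounded_square_integrable _).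
Qed.

Lemma cmeasurableB (f g : T -> R[i]) : cmeasurable f -> cmeasurable g ->
  cmeasurable (fun x => f x - g x).
Proof.
move=> mf mg.
have -> : (fun x => f x - g x) = (fun x => f x + (- 1) * g x).
  by apply/funext => x; rewrite mulN1r.
apply: cmeasurableD => //; apply: cmeasurableM => //; exact: cmeasurable_cst.
Qed.

Lemma nsq_toL2B (f g : T -> R[i]) : cbounded f -> cbounded g ->
  nsq (toL2 mu f - toL2 mu g) = Rintegral mu setT (fun x => sqmod (f x - g x)).
Proof.
move=> bf bg; apply: Rintegral_ae_eq.
- by apply: measurable_sqmod; exact: L2_measurable.
- by apply: measurable_sqmod; apply: cmeasurableB; [case: bf|case: bg].
have := toL2K (cbounded_square_integrable bf).
have := toL2K (cbounded_square_integrable bg) => h1 h2.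
rewrite -[toL2 mu g]opprK opprK -scaleN1r.
apply: filter_app h1; apply: filterS3 h2 (L2_addE (toL2 mu f) ((- 1) *: toL2 mu g))
  (L2_scaleE (- 1) (toL2 mu g)) => x h2 h3 h4 h1 _.
by rewrite h3//= h4//= h1// h2// mulN1r.
Qed.

Lemma complete_cbounded (F : nat -> T -> R[i]) (K : R) :
  (forall n, cmeasurable (F n)) -> (forall n x, sqmod (F n x) <= K) ->
  (forall e : R, 0 < e -> exists N : nat, forall i j, (N <= i)%N -> (N <= j)%N ->
    nsq (toL2 mu (F i) - toL2 mu (F j)) <= e) ->
  exists2 g : T -> R[i], cbounded g &
    forall e : R, 0 < e -> exists N : nat, forall n, (N <= n)%N ->
    nsq (toL2 mu (F n) - toL2 mu g) <= e.
Proof.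
move=> mF FK cauchy.
have bF n : cbounded (F n) by split => //; exists K.
have bRe n := proj1 (cbounded_rbounded (bF n)).
have bIm n := proj2 (cbounded_rbounded (bF n)).
have sqE (f g : T -> R[i]) : cbounded f -> cbounded g ->
    nsq (toL2 mu f - toL2 mu g) =
    Rintegral mu setT (fun x => (complex.Re (f x) - complex.Re (g x)) ^+ 2) +
    Rintegral mu setT (fun x => (complex.Im (f x) - complex.Im (g x)) ^+ 2).
  move=> bf bg; rewrite nsq_toL2B//.
  have [f1 f2] := cbounded_rbounded bf; have [g1 g2] := cbounded_rbounded bg.
  have i1 := integrable_rbounded mufin (rboundedX 2 (rboundedB f1 g1)).
  have i2 := integrable_rbounded mufin (rboundedX 2 (rboundedB f2 g2)).
  have := Rintegral_lin 1 1 i1 i2; rewrite !mul1r => <-; congr Rintegral.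
  by apply/funext => x; rewrite !mul1r /sqmod !ReD !ImD !ReN !ImN.
have pos (h : T -> R) : 0 <= Rintegral mu setT (fun x => h x ^+ 2).
  by apply: Rintegral_ge0 => x _; exact: sqr_ge0.
have [||e e0|g1 [mg1 g1K hg1]] := @complete_bounded (fun n x => complex.Re (F n x)) (K + 1).
- by move=> n; case: (bRe n).
- by move=> n; have [] := cbounded_Re_Im (mF n) (FK n).
- have [N hN] := cauchy e e0; exists N => i j Ni Nj.
  by rewrite (le_trans _ (hN i j Ni Nj))// sqE// lerDl pos.
have [||e e0|g2 [mg2 g2K hg2]] := @complete_bounded (fun n x => complex.Im (F n x)) (K + 1).
- by move=> n; case: (bIm n).
- by move=> n; have [] := cbounded_Re_Im (mF n) (FK n).
- have [N hN] := cauchy e e0; exists N => i j Ni Nj.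
  by rewrite (le_trans _ (hN i j Ni Nj))// sqE// lerDr pos.
have bg : cbounded (fun x => g1 x +i* g2 x).
  split; first by split.
  exists ((K + 1) ^+ 2 + (K + 1) ^+ 2) => x; rewrite /sqmod /=.
  have sqle (y : R) : `|y| <= K + 1 -> y ^+ 2 <= (K + 1) ^+ 2.
    move=> h; rewrite -[y ^+ 2]real_normK ?num_real// ler_sqr ?nnegrE//.
    by rewrite (le_trans _ h).
  by apply: lerD; apply: sqle.
exists (fun x => g1 x +i* g2 x) => // e e0.
have e2 : 0 < e / 2 by rewrite divr_gt0.
have [N1 h1] := hg1 _ e2; have [N2 h2] := hg2 _ e2.
exists (maxn N1 N2) => n; rewrite geq_max => /andP[n1 n2].
by rewrite sqE//= [leRHS]splitr; apply: lerD; [exact: h1|exact: h2].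
Qed.

End BoundedComplete.

(** * The conditional expectation onto the invariant functions *)

Section ConditionalExpectation.
Context d (X : measurableType d) (R : realType).
Variable mu : probability X R.
Variables phi phiV : X -> X.
Hypothesis hphi : invertible_measure_preserving mu phi phiV.
Implicit Types (f g h k : X -> R[i]).

(** The operator [average] on functions instead of classes: pointwise bounds survive by convexity
    and make the limit bounded. *)
Definition fun_average (lam : R) (th : X -> X) f : X -> R[i] :=
  fun x => lam%:C * f x + (1 - lam)%:C * f (th x).

Lemma sqmod_convex (lam K : R) (z w : R[i]) : 0 < lam < 1 -> sqmod z <= K ->
  sqmod w <= K -> sqmod (lam%:C * z + (1 - lam)%:C * w) <= K.
Proof.
case: z w => [a b] [a' b'] /andP[l0 l1]; rewrite /sqmod /= => h1 h2.
rewrite !mul0r !subr0 !addr0.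
have h3 := sqr_ge0 (a - a'); have h4 := sqr_ge0 (b - b').
have -> : (lam * a + (1 - lam) * a') ^+ 2 + (lam * b + (1 - lam) * b') ^+ 2 =
  lam * (a ^+ 2 + b ^+ 2) + (1 - lam) * (a' ^+ 2 + b' ^+ 2)
  - lam * (1 - lam) * ((a - a') ^+ 2 + (b - b') ^+ 2) by ring.
have h5 : 0 <= lam * (1 - lam) * ((a - a') ^+ 2 + (b - b') ^+ 2).
  by rewrite mulr_ge0 ?addr_ge0// mulr_ge0 ?subr_ge0 ?ltW.
have h6 : lam * (a ^+ 2 + b ^+ 2) <= lam * K by rewrite ler_pM2l.
have h7 : (1 - lam) * (a' ^+ 2 + b' ^+ 2) <= (1 - lam) * K.
  by rewrite ler_pM2l// subr_gt0.
by move: h5 h6 h7; lra.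
Qed.

Section Average.
Variables (lam : R) (th : X -> X).
Hypotheses (lam01 : 0 < lam < 1) (hth : measure_preserving mu mu th).

Lemma cmeasurable_fun_average f : cmeasurable f ->
  cmeasurable (fun_average lam th f).
Proof.
move=> mf; apply: cmeasurableD.
  by apply: cmeasurableM => //; exact: cmeasurable_cst.
apply: cmeasurableM; first exact: cmeasurable_cst.
exact: (cmeasurable_comp hth mf).
Qed.

Lemma fun_average_le f (K : R) : (forall x, sqmod (f x) <= K) ->
  forall x, sqmod (fun_average lam th f x) <= K.
Proof. by move=> fK x; exact: sqmod_convex. Qed.

Lemma cbounded_fun_average f : cbounded f -> cbounded (fun_average lam th f).
Proof.
move=> [mf [K fK]]; split; first exact: cmeasurable_fun_average.
by exists K; exact: fun_average_le.
Qed.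

Lemma toL2_fun_average f : cbounded f ->
  toL2 mu (fun_average lam th f) = average lam (compop mu th) (toL2 mu f).
Proof.
move=> bf; apply/L2_eqP.
have h1 := toL2K (cbounded_square_integrable mu (cbounded_fun_average bf)).
have h2 := toL2K (cbounded_square_integrable mu bf).
have h3 := compopE hth (toL2 mu f); have h4 := ae_mp hth h2.
have h5 := L2_addE (lam%:C *: toL2 mu f) ((1 - lam)%:C *: compop mu th (toL2 mu f)).
have h6 := L2_scaleE lam%:C (toL2 mu f).
have h7 := L2_scaleE (1 - lam)%:C (compop mu th (toL2 mu f)).
apply: filter_app h1; apply: filter_app h2; apply: filter_app h3.
apply: filter_app h4; apply: filterS3 h5 h6 h7 => x h5 h6 h7 h4 h3 h2 h1 _.
by rewrite h1// h5//= h6// h7//= h2// h3// h4.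
Qed.

End Average.

Lemma Linf_invariant_compop k : cbounded k -> k \o phi = k %[ae mu] ->
  compop mu phi (toL2 mu k) = toL2 mu k /\ compop mu phiV (toL2 mu k) = toL2 mu k.
Proof.
move=> bk kphi; have [_ _ phiK phiVK _] := hphi.
have hk := toL2K (cbounded_square_integrable mu bk).
have E : compop mu phi (toL2 mu k) = toL2 mu k.
  apply/L2_eqP; apply: filter_app (compopE (phi_mp hphi) (toL2 mu k)).
  apply: filterS3 hk (ae_mp (phi_mp hphi) hk) kphi => x h1 h2 h3 h4 _.
  by rewrite h4// h1// h2// -h3.
split => //; rewrite -{1}E.
exact: (compopK (phiV_mp hphi) (phi_mp hphi) phiVK).
Qed.

Lemma mean_ergodic (lam : R) f : 0 < lam < 1 -> cbounded f ->
  exists g, [/\ cbounded g, g \o phi = g %[ae mu],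
    (forall k, cbounded k -> k \o phi = k %[ae mu] ->
      cintegral mu (fun x => f x * (k x)^*) = cintegral mu (fun x => g x * (k x)^*)) &
    forall e : R, 0 < e -> exists N : nat, forall n, (N <= n)%N ->
      Rintegral mu setT (fun x => sqmod (iter n (fun_average lam phiV) f x - g x)) <= e].
Proof.
move=> lam01 bf; have [_ _ phiK phiVK _] := hphi.
have hp := phi_mp hphi; have hpV := phiV_mp hphi.
pose V := compop mu phiV; pose Vs := compop mu phi.
have lV : linear V := compop_linear hpV.
have lVs : linear Vs := compop_linear hp.
have adjV u v : dot (V u) v = dot u (Vs v) by exact: (dot_compopl hpV hp phiK).
have VK : cancel V Vs := compopK hp hpV phiK.
have VsK : cancel Vs V := compopK hpV hp phiVK.
have lP := average_linear lam lV; have lPs := average_linear lam lVs.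
have aP := average_adj lam adjV.
have cP := average_comm lam lV lVs VK VsK.
have nV u : nsq (V u) = nsq u := nsq_compop hpV u.
have nVs u : nsq (Vs u) = nsq u := nsq_compop hp u.
have l0 : 0 < lam * (1 - lam).
  by case/andP: lam01 => ? ?; rewrite mulr_gt0// subr_gt0.
have nP u : nsq (average lam V u) <= nsq u.
  by rewrite (nsq_average lam (nV u)) gerBl mulr_ge0 ?nsq_ge0// ltW.
have nPs u : nsq (average lam Vs u) <= nsq u.
  by rewrite (nsq_average lam (nVs u)) gerBl mulr_ge0 ?nsq_ge0// ltW.
have fixV u : nsq (average lam V u) = nsq u -> V u = u.
  rewrite (nsq_average lam (nV u)) => /eqP; rewrite subr_eq addrC -subr_eq subrr eq_sym.
  rewrite mulf_eq0 gt_eqF//= => /eqP /nsq_eq0 /eqP.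
  by rewrite subr_eq0 => /eqP.
have avfix (W : operator mu) u : W u = u -> average lam W u = u.
  have lE : lam%:C + (1 - lam)%:C = 1 :> R[i].
    by apply: eqCP; rewrite ?ReD ?ImD /= ?addr0// addrC subrK.
  by move=> Wu; rewrite /average Wu -scalerDl lE scale1r.
have fixP u : nsq (average lam V u) = nsq u -> average lam V u = u.
  by move=> /fixV /avfix.
(* A pointwise version of the iterates of [Ps P], uniformly bounded by the bound of [f]. *)
pose F n := iter n (fun h => fun_average lam phi (fun_average lam phiV h)) f.
have bF n : cbounded (F n).
  elim: n => [//|n IH]; rewrite /F iterS -/(F n).
  exact: (cbounded_fun_average lam01 hp (cbounded_fun_average lam01 hpV IH)).
have FE n : toL2 mu (F n) = iter n (square_op (average lam V) (average lam Vs)) (toL2 mu f).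
  elim: n => [//|n IH]; rewrite /F iterS -/(F n).
  rewrite (toL2_fun_average lam01 hp (cbounded_fun_average lam01 hpV (bF n))).
  by rewrite (toL2_fun_average lam01 hpV (bF n)) IH.
have [mf [K fK]] := bf.
have FK n x : sqmod (F n x) <= K.
  elim: n x => [//|n IH] x; rewrite /F iterS -/(F n).
  exact: (fun_average_le phi lam01 (fun_average_le phiV lam01 IH)).
have [||e e0|g bg hg] := @complete_cbounded _ _ _ mu F K.
- by move=> n; case: (bF n).
- by [].
- have [N hN] := iter_square_cauchy aP cP nP (toL2 mu f) e0.
  by exists N => i j Ni Nj; rewrite !FE; exact: hN.
have uw e : 0 < e -> exists N : nat, forall n, (N <= n)%N ->
    nsq (iter n (square_op (average lam V) (average lam Vs)) (toL2 mu f) - toL2 mu g) <= e.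
  by move=> /hg[N hN]; exists N => n /hN; rewrite FE.
have Pw := limit_fixed lP lPs aP nP nPs fixP uw.
have Vw : V (toL2 mu g) = toL2 mu g by apply: fixV; rewrite Pw.
exists g; split => //.
- have h1 := toL2K (cbounded_square_integrable mu bg).
  have h2 := compopE hpV (toL2 mu g); rewrite -/V Vw in h2.
  (* Invariance under [phiV] comes from [V w = w]; composing with [phi] turns it into invariance
     under [phi]. *)
  have h3 : \forall x \ae mu, g x = g (phiV x).
    by apply: filterS3 h1 h2 (ae_mp hpV h1) => x h1 h2 h3; rewrite -h1// h2// h3.
  by apply: filterS (ae_mp hp h3) => x /= -> _; rewrite phiK.
- move=> k bk kphi; rewrite -(toL2_cbounded_dot mu bf bk) -(toL2_cbounded_dot mu bg bk).
  have [k1 k2] := Linf_invariant_compop bk kphi.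
  by apply: (limit_dot_fixed aP uw); exact: avfix.
- move=> e e0; have [N hN] := iter_limit lP lPs aP cP nP nPs fixP uw e0.
  exists N => n Nn.
  have [bn bnE] : cbounded (iter n (fun_average lam phiV) f) /\
      toL2 mu (iter n (fun_average lam phiV) f) = iter n (average lam V) (toL2 mu f).
    elim: n {Nn} => [//|n [IH1 IH2]]; rewrite !iterS; split.
      exact: (cbounded_fun_average lam01 hpV IH1).
    by rewrite (toL2_fun_average lam01 hpV IH1) IH2.
  by rewrite -(nsq_toL2B mu bn bg) bnE; exact: hN.
Qed.

Lemma LinfM f g : Linf mu f -> Linf mu g -> Linf mu (fun x => f x * g x).
Proof.
move=> [mf [K fK]] [mg [L gL]]; split; first exact: cmeasurableM.
exists (K * L); apply: filterS2 fK gL => x h1 h2.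
by rewrite normrM rmorphM ler_pM.
Qed.

Lemma LinfD f g : Linf mu f -> Linf mu g -> Linf mu (fun x => f x + g x).
Proof.
move=> [mf [K fK]] [mg [L gL]]; split; first exact: cmeasurableD.
exists (K + L); apply: filterS2 fK gL => x h1 h2.
by rewrite (le_trans (ler_normD _ _))// rmorphD lerD.
Qed.

Lemma Linf_conj f : Linf mu f -> Linf mu (fun x => (f x)^*).
Proof.
move=> [mf [K fK]]; split; first exact: cmeasurable_conj.
by exists K; apply: filterS fK => x; rewrite norm_conjC.
Qed.

Lemma Linf_cst (c : R[i]) : Linf mu (fun=> c).
Proof. exact: cbounded_Linf (cbounded_cst X c). Qed.

Lemma Linf_cintegrable f : Linf mu f -> cintegrable mu f.
Proof.
move=> lf; have [f' bf' ff'] := bounded_representative lf.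
have s1 := square_integrable_ae (proj1 lf) (cbounded_square_integrable mu bf') ff'.
have s2 := cbounded_square_integrable mu (cbounded_cst X (1 : R[i])).
have := square_integrable_mul s1 s2.
by have -> : (fun x => f x * 1) = f by apply/funext => x; rewrite mulr1.
Qed.

Local Notation invariant := (invariant_Linf mu phi).

Lemma invariantM f g : invariant f -> invariant g ->
  invariant (fun x => f x * g x).
Proof.
move=> [lf fi] [lg gi]; split; first exact: LinfM.
by apply: filterS2 fi gi => x h1 h2 _; move: (h1 I) (h2 I) => /= -> ->.
Qed.

Lemma invariantD f g : invariant f -> invariant g ->
  invariant (fun x => f x + g x).
Proof.
move=> [lf fi] [lg gi]; split; first exact: LinfD.
by apply: filterS2 fi gi => x h1 h2 _; move: (h1 I) (h2 I) => /= -> ->.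
Qed.

Lemma invariant_conj f : invariant f -> invariant (fun x => (f x)^*).
Proof.
move=> [lf fi]; split; first exact: Linf_conj.
by apply: filterS fi => x h1 _; move: (h1 I) => /= ->.
Qed.

Lemma invariant_cst (c : R[i]) : invariant (fun=> c).
Proof. by split; [exact: Linf_cst|exact: aeW]. Qed.

(* This determines [g] almost everywhere, and any conditional expectation of [f]
   satisfies it. *)
Definition is_projection f g := invariant g /\ forall k, invariant k ->
  cintegral mu (fun x => f x * (k x)^*) = cintegral mu (fun x => g x * (k x)^*).

(** The difference [k = g - h] is itself invariant and may serve as test function, which gives zero
    mean square. *)
Lemma is_projection_unique f g h : is_projection f g -> is_projection f h ->
  g = h %[ae mu].
Proof.
move=> [ig gE] [ih hE].
pose k x := g x + (- 1) * h x.
have ik : invariant k by apply: invariantD => //; apply: invariantM => //; exact: invariant_cst.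
have E : cintegral mu (fun x => k x * (k x)^*) = 0.
  have -> : (fun x => k x * (k x)^*) =
      (fun x => g x * (k x)^* + (- 1) * (h x * (k x)^*)).
    by apply/funext => x; rewrite {1}/k mulrDl mulrA.
  have lk := Linf_conj (proj1 ik).
  have c1 := Linf_cintegrable (LinfM (proj1 ig) lk).
  have c2 := Linf_cintegrable (LinfM (proj1 ih) lk).
  rewrite (cintegralD c1 (cintegrableZ (- 1) c2)) (cintegralZ (- 1) c2).
  by rewrite -gE// -hE// mulN1r subrr.
have ci := Linf_cintegrable (LinfM (proj1 ik) (Linf_conj (proj1 ik))).
have sE : (fun x => k x * (k x)^*) = (fun x => (sqmod (k x))%:C).
  by apply/funext => x; rewrite mul_conj.
rewrite sE in E ci.
have k0 := Rintegral_eq0 (fun x => sqmod_ge0 (k x)) (proj1 ci).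
have {}k0 : (fun x => sqmod (k x)) = cst 0 %[ae mu].
  by apply: k0; have := congr1 (@complex.Re R) E; rewrite cintegralE.
apply: filterS k0 => x /(_ I) /sqmod_eq0; rewrite /k mulN1r => /eqP + _.
by rewrite subr_eq0 => /eqP.
Qed.

Lemma is_projection_cbounded f g : cbounded f -> cbounded g ->
  g \o phi = g %[ae mu] ->
  (forall k, cbounded k -> k \o phi = k %[ae mu] ->
    cintegral mu (fun x => f x * (k x)^*) = cintegral mu (fun x => g x * (k x)^*)) ->
  is_projection f g.
Proof.
move=> [mf _] bg gi gE; split; first by split => //; exact: cbounded_Linf.
move=> k [lk ki]; have [k' bk' kk'] := bounded_representative lk.
have ki' : k' \o phi = k' %[ae mu].
  apply: filterS3 ki kk' (ae_mp (phi_mp hphi) kk') => x h1 h2 h3 _.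
  by rewrite /= -h3// -h2//; exact: h1.
have mk := cmeasurable_conj (proj1 lk).
have mk' := cmeasurable_conj (proj1 bk').
have kE u : cmeasurable u -> cintegral mu (fun x => u x * (k x)^*) =
    cintegral mu (fun x => u x * (k' x)^*).
  move=> mu_; apply: cintegral_ae_eq; [exact: cmeasurableM|exact: cmeasurableM|].
  by apply: filterS kk' => x h _; rewrite h.
by rewrite kE// kE ?gE//; case: bg.
Qed.

Lemma is_projection_ae f f' g : cmeasurable f -> cmeasurable f' ->
  f = f' %[ae mu] -> is_projection f' g -> is_projection f g.
Proof.
move=> mf mf' ff' [ig gE]; split => // k ik; rewrite -gE//.
have mk := cmeasurable_conj (proj1 (proj1 ik)).
apply: cintegral_ae_eq; [exact: cmeasurableM|exact: cmeasurableM|].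
by apply: filterS ff' => x h _; rewrite h.
Qed.

Lemma is_projection_exists f : Linf mu f -> exists g, is_projection f g.
Proof.
move=> lf; have [f' bf' ff'] := bounded_representative lf.
(* Any averaging weight produces a projection, and projections are unique; one half is an arbitrary
   choice. *)
have h01 : 0 < (2^-1 : R) < 1 by rewrite invr_gt0 ltr0n invf_lt1// ltr1n.
have [g [bg gi gE _]] := mean_ergodic h01 bf'.
exists g; apply: is_projection_ae ff' _; [by case: lf|by case: bf'|].
exact: is_projection_cbounded.
Qed.

(** The set where [g] leaves the half-plane is invariant, so its indicator is an admissible test
    function: over it the integral of the form is nonnegative for [f], hence for [g], although the
    integrand for [g] is negative there. *)
Lemma is_projection_half (a b : R) f g : Linf mu f -> is_projection f g ->
  (\forall x \ae mu, 0 <= a * complex.Re (f x) + b * complex.Im (f x)) ->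
  \forall x \ae mu, 0 <= a * complex.Re (g x) + b * complex.Im (g x).
Proof.
move=> lf [ig gE] f0; have [lg gi] := ig.
pose l (h : X -> R[i]) x := a * complex.Re (h x) + b * complex.Im (h x).
have ml h : cmeasurable h -> measurable_fun setT (l h).
  by move=> [m1 m2]; apply: measurable_funD; apply: measurable_funM.
pose B := [set x | l g x < 0].
have mB : measurable B.
  have -> : B = l g @^-1` `]-oo, 0[%classic.
    by apply/seteqP; split => x; rewrite /B /= in_itv.
  by apply: preimage_measurable => //; apply: ml; exact: proj1 lg.
pose k x : R[i] := (\1_B x : R)%:C.
have bk : cbounded k := rbounded_cbounded (rbounded_indic R mB).
have ik : invariant k.
  split; first exact: cbounded_Linf.
  apply: filterS gi => x /(_ I) /= h _; rewrite /k !indicE; congr ((_ : nat)%:R%:C).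
  by rewrite /B; congr (nat_of_bool _); apply/idP/idP; rewrite !inE /= /l h.
have lE h : Linf mu h -> Rintegral mu setT (fun x => l h x * \1_B x) =
    a * complex.Re (cintegral mu (fun x => h x * (k x)^*)) +
    b * complex.Im (cintegral mu (fun x => h x * (k x)^*)).
  move=> lh; have [c1 c2] := Linf_cintegrable (LinfM lh (Linf_conj (proj1 ik))).
  rewrite cintegralE /= -(Rintegral_lin a b c1 c2); congr Rintegral.
  by apply/funext => x; rewrite ReM ImM ReC ImC /= oppr0 !mulr0 subr0 add0r mulrDl !mulrA.
have il h : Linf mu h -> mu.-integrable setT (EFin \o (fun x => l h x * \1_B x)).
  move=> lh; have [c1 c2] := Linf_cintegrable (LinfM lh (Linf_conj (proj1 ik))).
  have := integrable_lin a b c1 c2; congr (_.-integrable _ _); apply/funext => x /=.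
  by rewrite ReM ImM ReC ImC /= oppr0 !mulr0 subr0 add0r mulrDl !mulrA.
have I0 : 0 <= Rintegral mu setT (fun x => l g x * \1_B x).
  rewrite lE// -gE// -lE//.
  rewrite (@Rintegral_ae_eq _ _ _ mu _ (fun x => `|l f x * \1_B x|)).
  - by apply: Rintegral_ge0.
  - by apply: measurable_funM => //; apply: ml; exact: proj1 lf.
  - by apply: measurableT_comp => //; apply: measurable_funM => //; apply: ml; exact: proj1 lf.
  - by apply: filterS f0 => x h _; rewrite ger0_norm// mulr_ge0.
pose q x := - (l g x * \1_B x).
have q0 x : 0 <= q x.
  rewrite /q indicE; case: (boolP (x \in B)) => [|_]; last by rewrite mulr0 oppr0.
  by rewrite inE mulr1 oppr_ge0 => /ltW.
have iq : mu.-integrable setT (EFin \o q).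
  have := integrable_lin (- 1) 0 (il g lg) (il g lg).
  by congr (_.-integrable _ _); apply/funext => x /=; rewrite mul0r addr0 mulN1r.
have qI : Rintegral mu setT q = 0.
  apply/eqP; rewrite eq_le; apply/andP; split; last first.
    by apply: Rintegral_ge0 => x _; exact: q0.
  have := Rintegral_lin (- 1) 0 (il g lg) (il g lg).
  have -> : (fun x => -1 * (l g x * \1_B x) + 0 * (l g x * \1_B x)) = q.
    by apply/funext => x; rewrite mul0r addr0 mulN1r.
  by move=> ->; rewrite mul0r addr0 mulN1r oppr_le0.
apply: filterS (Rintegral_eq0 q0 iq qI) => x /(_ I); rewrite /q /=.
move=> /eqP; rewrite oppr_eq0 indicE => h; rewrite -[leRHS]/(l g x) leNgt.
apply/negP => gx; move: h; rewrite mem_set// mulr1 => /eqP h0.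
by move: gx; rewrite h0 ltxx.
Qed.

(** The nonnegative reals are the intersection of three half-planes, [Re >= 0], [Im >= 0] and
    [- Im >= 0]. *)
Lemma is_projection_ge0 f g : Linf mu f -> is_projection f g ->
  (\forall x \ae mu, 0 <= f x) -> \forall x \ae mu, 0 <= g x.
Proof.
move=> lf fg f0.
have h (a b : R) : 0 <= a -> \forall x \ae mu, 0 <= a * complex.Re (g x) + b * complex.Im (g x).
  move=> a0; apply: (is_projection_half lf fg); apply: filterS f0 => x.
  by rewrite lecE /= => /andP[/eqP -> ?]; rewrite mulr0 addr0 mulr_ge0.
apply: filterS3 (h 1 0 ler01) (h 0 1 (lexx 0)) (h 0 (- 1) (lexx 0)) => x.
rewrite !mul0r !mul1r addr0 !add0r mulN1r oppr_ge0 => h1 h2 h3.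
by rewrite lecE /= h1 andbT eq_le h2 h3.
Qed.

(** The witness picks a projection for each [f]; most of the axioms then follow from uniqueness by
    exhibiting both sides as projections of the same function. *)
Lemma cond_expP : is_cond_exp mu phi (cond_exp mu phi).
Proof.
apply: xgetPex.
exists (fun f => xget (fun=> 0) [set g | is_projection f g]).
set E := fun f => _.
have EP f : Linf mu f -> is_projection f (E f).
  by move=> lf; apply: xgetPex; exact: is_projection_exists.
split.
- move=> f g lf lg fg; apply: (@is_projection_unique f); first exact: EP.
  by apply: is_projection_ae fg (EP g lg); [case: lf|case: lg].
- by move=> f /EP[].
- move=> h ih; apply: (@is_projection_unique h); first exact: EP (proj1 ih).
  by split.
- move=> c f g lf lg.
  have lcf := LinfM (Linf_cst c) lf.
  apply: (@is_projection_unique (fun x => c * f x + g x)).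
    by apply: EP; exact: LinfD.
  have [iF FE] := EP f lf; have [iG GE] := EP g lg.
  split; first by apply: invariantD => //; apply: invariantM => //; exact: invariant_cst.
  move=> k ik; have lk := Linf_conj (proj1 ik).
  have lin u v : Linf mu u -> Linf mu v ->
      cintegral mu (fun x => (c * u x + v x) * (k x)^*) =
      c * cintegral mu (fun x => u x * (k x)^*) + cintegral mu (fun x => v x * (k x)^*).
    move=> lu lv; have c1 := Linf_cintegrable (LinfM lu lk).
    have c2 := Linf_cintegrable (LinfM lv lk).
    rewrite -(cintegralZ c c1) -(cintegralD (cintegrableZ c c1) c2).
    by congr cintegral; apply/funext => x; rewrite mulrDl mulrA.
  by rewrite lin// FE// GE// -lin//; [exact: proj1 iF|exact: proj1 iG].
- by move=> f lf f0; exact: is_projection_ge0 lf (EP f lf) f0.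
- move=> f h lf ih; have [iF FE] := EP f lf.
  apply: (@is_projection_unique (fun x => h x * f x)).
    by apply: EP; apply: LinfM => //; exact: proj1 ih.
  split; first exact: invariantM.
  move=> k ik.
  have := FE (fun x => (h x)^* * k x) (invariantM (invariant_conj ih) ik).
  have eqf u : (fun x => u x * ((h x)^* * k x)^*) = (fun x => h x * u x * (k x)^*).
    by apply/funext => x; rewrite conjM conjK mulrCA mulrA.
  by rewrite !eqf.
- move=> f lf; have [iF FE] := EP f lf.
  have := FE (fun=> 1) (invariant_cst 1).
  have eqf u : (fun x => u x * (1 : R[i])^*) = u :> (X -> R[i]).
    by apply/funext => x; rewrite conjC1 mulr1.
  by rewrite !eqf.
Qed.

(** Derived from the axioms, since [xget] may have picked any conditional expectation: the module
    property for the conjugate of [k], then preservation of the integral. *)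
Lemma cond_exp_is_projection f : Linf mu f -> is_projection f (cond_exp mu phi f).
Proof.
move=> lf; have CE := cond_expP; have iF := cond_exp_invariant CE lf.
split => // k ik; have ic := invariant_conj ik.
have lfk := LinfM (proj1 ic) lf.
have -> : (fun x => f x * (k x)^*) = (fun x => (k x)^* * f x).
  by apply/funext => x; rewrite mulrC.
rewrite -(cond_exp_preserving CE lfk).
apply: cintegral_ae_eq.
- by have [[]] := cond_exp_invariant CE lfk.
- by apply: cmeasurableM; [case: iF => -[]|case: ic => -[]].
- by apply: filterS (cond_exp_module CE lf ic) => x h _; rewrite h// mulrC.
Qed.

Lemma cond_exp_mean_ergodic (lam : R) f : 0 < lam < 1 -> cbounded f ->
  forall e : R, 0 < e -> exists N : nat, forall n, (N <= n)%N ->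
    Rintegral mu setT (fun x =>
      sqmod (iter n (fun_average lam phiV) f x - cond_exp mu phi f x)) <= e.
Proof.
move=> lam01 bf e e0; have [g [bg gi gE hg]] := mean_ergodic lam01 bf.
have pf := cond_exp_is_projection (cbounded_Linf mu bf).
have pg : is_projection f g by exact: is_projection_cbounded.
have gc := is_projection_unique pg pf.
have [N hN] := hg e e0; exists N => n /hN; apply: le_trans.
have mn : cmeasurable (iter n (fun_average lam phiV) f).
  elim: n => [|n IH]; first by case: bf.
  by rewrite iterS; exact: (cmeasurable_fun_average lam (phiV_mp hphi) IH).
have mB u : cmeasurable u ->
    measurable_fun setT (fun x => sqmod (iter n (fun_average lam phiV) f x - u x)).
  by move=> mu_; apply: measurable_sqmod; exact: cmeasurableB.
rewrite le_eqVlt; apply/orP; left; apply/eqP; apply: Rintegral_ae_eq.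
- by apply: mB; case: pf => -[[]].
- by apply: mB; case: bg.
- by apply: filterS gc => x h _; rewrite h.
Qed.

End ConditionalExpectation.

(** * Convergence of the weights *)

Section Convergence.
Context (R : realType).

(** Mean value theorem; [M] bounds the derivative by [powR_itv]. *)
Lemma powR_lipschitz (c K p : R) : 0 < c -> exists2 L : R, 0 <= L &
  forall x y, c <= x <= K -> c <= y <= K ->
    (x `^ p - y `^ p) ^+ 2 <= L * (x - y) ^+ 2.
Proof.
move=> c0; pose M := `|p| * (c `^ (p - 1) + K `^ (p - 1)).
have M0 : 0 <= M by rewrite mulr_ge0 ?addr_ge0 ?powR_ge0.
exists (M ^+ 2); first exact: sqr_ge0.
have main x y : c <= x <= K -> c <= y <= K -> x <= y ->
    (y `^ p - x `^ p) ^+ 2 <= M ^+ 2 * (y - x) ^+ 2.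
  move=> /andP[cx xK] /andP[cy yK] xy.
  have pos z : x <= z -> 0 < z by move=> xz; rewrite (lt_le_trans c0)// (le_trans cx).
  have [||z] := @MVT_segment R (fun z => z `^ p) (fun z => p * z `^ (p - 1)) x y xy.
  - move=> z; rewrite in_itv/= => /andP[xz _].
    exact: (is_derive1_powR p (pos z (ltW xz))).
  - apply: continuous_in_subspaceT => z; rewrite inE /= in_itv/= => /andP[xz _].
    exact: continuous_powR (pos z xz).
  rewrite in_itv/= => /andP[xz zy] ->; rewrite exprMn ler_wpM2r ?sqr_ge0//.
  rewrite -[leLHS]real_normK ?num_real// ler_sqr ?nnegrE//.
  rewrite normrM ler_wpM2l// ger0_norm ?powR_ge0//.
  by apply: powR_itv => //; rewrite (le_trans cx xz) (le_trans zy yK).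
move=> x y hx hy; case: (leP x y) => xy.
  by rewrite -sqrrN opprB -[(x - y) ^+ 2]sqrrN opprB main.
by apply: main => //; exact: ltW.
Qed.

Context d (X : measurableType d).
Variable mu : probability X R.
Local Notation m := (crossed_measure mu).
Variables phi phiV : X -> X.
Hypothesis hphi : invertible_measure_preserving mu phi phiV.
Variables (r lam c K : R).
Hypotheses (r0 : r != 0) (lam01 : 0 < lam < 1) (c0 : 0 < c).

Lemma iter_mean_step_powR n (b : X -> R) x : (forall x, c <= b x <= K) ->
  iter n (fun_average lam phiV) (fun x => (b x `^ r)%:C) x =
  (iter n (mean_step phiV r lam) b x `^ r)%:C.
Proof.
move=> bcK; elim: n x => [//|n IH] x; rewrite !iterS /fun_average !IH /mean_step /wmean.
have pos y : 0 < iter n (mean_step phiV r lam) b y.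
  have := iter_mean_step_itv phiV r0 lam01 c0 n bcK y.
  by move=> /andP[h _]; exact: lt_le_trans h.
rewrite (powRVK r0); last exact: wmean_arg_gt0.
move: (_ `^ r) (_ `^ r) => A B.
by apply: eqCP; rewrite ?ReD ?ImD ?ReM ?ImM /=; ring.
Qed.

Lemma itv_rbounded (f : X -> R) (p q : R) : measurable_fun setT f ->
  (forall x, p <= f x <= q) -> rbounded f.
Proof.
move=> mf fpq; split => //; exists (`|p| + `|q|) => x.
have /andP[h1 h2] := fpq x; rewrite ler_norml; apply/andP; split.
  by rewrite (le_trans _ h1)// lerNl (le_trans (ler_norm _))// normrN lerDl.
by rewrite (le_trans h2)// (le_trans (ler_norm _))// lerDr.
Qed.

(** Positivity is applied to [f - p] and [q - f]; being nonnegative in [R[i]] includes being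
    real. *)
Lemma cond_exp_itv (f : X -> R) (p q : R) : measurable_fun setT f ->
  (forall x, p <= f x <= q) ->
  \forall x \ae mu, p <= complex.Re (cond_exp mu phi (fun x => (f x)%:C) x) <= q /\
    complex.Im (cond_exp mu phi (fun x => (f x)%:C) x) = 0.
Proof.
move=> mf fpq; pose F x : R[i] := (f x)%:C; have CE := cond_expP hphi.
have lF : Linf mu F.
  by apply: cbounded_Linf; apply: rbounded_cbounded; exact: itv_rbounded fpq.
have E (s t : R) : (forall x, 0 <= s * f x + t) ->
    \forall x \ae mu, 0 <= s%:C * cond_exp mu phi F x + t%:C.
  move=> h; have lt : Linf mu (fun=> t%:C : R[i]) by exact: Linf_cst.
  have lL := LinfD (LinfM (Linf_cst mu s%:C) lF) lt.
  have h1 := cond_exp_ge0 CE lL (aeW mu (fun x => _)).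
  have h2 := cond_exp_linear CE s%:C lF lt.
  have h3 := cond_exp_id CE (invariant_cst mu phi t%:C).
  have {}h1 : \forall x \ae mu, 0 <= cond_exp mu phi (fun x => s%:C * F x + t%:C) x.
    apply: h1 => x; rewrite /F -rmorphM -rmorphD lecE /= eqxx /=; exact: h.
  apply: filterS3 h1 h2 h3 => x h1 h2 h3.
  by move: h1; rewrite h2// h3.
have /E h1 : forall x, 0 <= 1 * f x + - p.
  by move=> x; rewrite mul1r subr_ge0; case/andP: (fpq x).
have /E h2 : forall x, 0 <= - 1 * f x + q.
  by move=> x; rewrite mulN1r addrC subr_ge0; case/andP: (fpq x).
apply: filterS2 h1 h2.
move=> x; rewrite !lecE; case: (cond_exp _ _ _ x) => u v /=.
rewrite !mul0r !mul1r !subr0 !addr0 !mulN1r => /andP[/eqP v0 pu] /andP[_ uq].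
split; last by [].
by rewrite -subr_ge0 pu /= -subr_ge0 addrC.
Qed.

Lemma mean_step_cvg (b : X -> R) (a : X -> R[i]) :
  measurable_fun setT b -> (forall x, c <= b x <= K) -> Linf mu a ->
  a = (fun x => (b x)%:C) %[ae mu] ->
  let H := fun_pow (cond_exp mu phi (fun_pow a r)) r^-1 in
  exists h : X -> R, [/\ rbounded h, cmeasurable H, H = (fun x => (h x)%:C) %[ae mu] &
    forall e : R, 0 < e -> exists N : nat, forall n, (N <= n)%N ->
      Rintegral mu setT (fun x => (iter n (mean_step phiV r lam) b x - h x) ^+ 2) <= e].
Proof.
move=> mb bcK la ab H.
pose F x : R[i] := (b x `^ r)%:C.
pose p := Num.min (c `^ r) (K `^ r); pose q := Num.max (c `^ r) (K `^ r).
have bpq b' : (forall x, c <= b' x <= K) -> forall x : X, p <= b' x `^ r <= q.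
  move=> b'cK x; have := wmean_arg_itv r0 lam01 c0 (b'cK x) (b'cK x).
  by rewrite -mulrDl subrK mul1r.
have K0 (x : X) : 0 < K.
  by have /andP[h1 h2] := bcK x; rewrite (lt_le_trans c0)// (le_trans h1).
have mbr b' : measurable_fun setT b' -> measurable_fun setT (fun x : X => b' x `^ r).
  exact: measurable_powR_comp.
have rbr b' : measurable_fun setT b' -> (forall x, c <= b' x <= K) ->
    rbounded (fun x : X => b' x `^ r).
  by move=> mb' h; apply: itv_rbounded (bpq _ h); exact: mbr.
have bF : cbounded F by apply: rbounded_cbounded; exact: rbr.
have lF := cbounded_Linf mu bF.
have mRa : measurable_fun setT (fun x => complex.Re (a x)) by case: la => -[].
have aF : fun_pow a r = F %[ae mu].
  by apply: filterS ab => x h _; rewrite /fun_pow h.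
have la' : Linf mu (fun_pow a r).
  split; first exact: cmeasurable_real (measurable_powR_comp r mRa).
  have [_ [L FL]] := lF; exists L; apply: filterS2 aF FL => x h1 h2.
  by rewrite h1.
have CE := cond_expP hphi.
pose G := cond_exp mu phi F; pose G0 := cond_exp mu phi (fun_pow a r).
have GG : G0 = G %[ae mu] := cond_exp_ae CE la' lF aF.
have mG : cmeasurable G by case: (cond_exp_invariant CE lF) => -[].
have mG0 : cmeasurable G0 by case: (cond_exp_invariant CE la') => -[].
(* Truncated because the conditional expectation lies in [[p, q]] only almost everywhere, while the
   Lipschitz bound is used at every point. *)
pose g x := Num.max p (Num.min q (complex.Re (G x))).
have mg : measurable_fun setT g.
  by apply: measurable_maxr => //; apply: measurable_minr => //; case: mG.
have pq (x : X) : p <= q by have /andP[h1 h2] := bpq b bcK x; exact: le_trans h2.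
have gpq x : p <= g x <= q.
  by rewrite /g le_max lexx /= ge_max (pq x) /= ge_min lexx.
have Gg : G = (fun x => (g x)%:C) %[ae mu].
  apply: filterS (cond_exp_itv (mbr b mb) (bpq b bcK)) => x [/andP[h1 h2] h3] _.
  by apply: eqCP => //=; rewrite /g min_r// max_r.
have p0 (x : X) : 0 < p by rewrite lt_min !powR_gt0 ?(K0 x).
have rg : rbounded g := itv_rbounded mg gpq.
have mh := measurable_powR_comp r^-1 mg.
exists (fun x => g x `^ r^-1); split.
- split => //; exists (p `^ r^-1 + q `^ r^-1) => x.
  by rewrite ger0_norm ?powR_ge0//; apply: powR_itv; [exact: p0 x|exact: gpq].
- exact: cmeasurable_real (measurable_powR_comp r^-1 (proj1 mG0)).
- by apply: filterS2 GG Gg => x h1 h2 _; rewrite /H /fun_pow -/G0 h1// h2.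
(* Positivity of [p] rests on that of [K], which is read off at a point; without points all
   integrands coincide with zero. *)
move=> e e0; have [x0|X0] := pselect (exists x : X, True); last first.
  exists 0%N => n _; rewrite (_ : (fun x => _) = fun=> 0).
    by rewrite Rintegral_cst// mul0r ltW.
  by apply/funext => x; exfalso; apply: X0; exists x.
have {x0}[x0 _] := x0.
have [L L0 hL] := powR_lipschitz q r^-1 (p0 x0).
have L1 : 0 < L + 1 by rewrite ltr_wpDl.
have [|N hN] := cond_exp_mean_ergodic hphi lam01 bF (e := e / (L + 1)).
  by rewrite divr_gt0.
exists N => n /hN hn.
pose bn := iter n (mean_step phiV r lam) b.
have mbn : measurable_fun setT bn := measurable_iter_mean_step hphi r lam n mb.
have bncK := iter_mean_step_itv phiV r0 lam01 c0 n bcK.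
have mufin : (mu setT < +oo)%E by rewrite probability_setT ltry.
have rd : rbounded (fun x => (bn x `^ r - g x) ^+ 2).
  by apply: (rboundedX 2); apply: rboundedB => //; exact: rbr.
have di := integrable_rbounded mufin rd.
have dE : Rintegral mu setT (fun x => (bn x `^ r - g x) ^+ 2) =
    Rintegral mu setT (fun x =>
      sqmod (iter n (fun_average lam phiV) F x - cond_exp mu phi F x)).
  have FE x : iter n (fun_average lam phiV) F x = (bn x `^ r)%:C.
    exact: iter_mean_step_powR.
  under [in RHS]eq_fun do rewrite FE.
  apply: Rintegral_ae_eq.
  - by case: rd.
  - apply: measurable_sqmod; apply: cmeasurableB => //.
    by apply: cmeasurable_real; exact: mbr.
  - apply: filterS Gg => x h _; rewrite -/F -/(G x) h//.
    by rewrite /sqmod !ReImE /= oppr0 addr0 expr0n /= addr0.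
rewrite -dE in hn.
have Li := integrable_lin L 0 di di.
apply: (@le_trans _ _ (L * Rintegral mu setT (fun x => (bn x `^ r - g x) ^+ 2))); last first.
  rewrite (le_trans (ler_wpM2l L0 hn))// mulrCA ger_pMr// ler_pdivrMr// mul1r.
  by rewrite lerDl.
have := Rintegral_lin L 0 di di; rewrite mul0r addr0 => <-.
apply: le_Rintegral_sqmod => //.
  apply: measurable_funX; apply: measurable_funB => //.
move=> x; rewrite sqr_ge0 mul0r addr0 /=.
have bpos : 0 < bn x by have /andP[h _] := bncK x; exact: lt_le_trans h.
rewrite -[iter n _ b x]/(bn x) -{1}(powRK r0 bpos).
by apply: hL => //; exact: bpq.
Qed.

End Convergence.

Lemma rmulB d (T : measurableType d) (R : realType)
    (m : {measure set T -> \bar R}) (f g : T -> R) (u : L2 m) :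
  rbounded f -> rbounded g ->
  rmul m f u - rmul m g u = rmul m (fun x => f x - g x) u.
Proof.
move=> bf bg; apply/L2_eqP; rewrite -scaleN1r.
apply: filter_app (rmulE u bf); apply: filter_app (rmulE u bg).
apply: filterS3 (rmulE u (rboundedB bf bg))
  (L2_addE (rmul m f u) (- 1 *: rmul m g u)) (L2_scaleE (- 1) (rmul m g u)).
move=> x h1 h2 h3 h4 h5 _; rewrite h2//= h3// h1// h4// h5//.
by rewrite mulN1r rmorphB mulrBl.
Qed.

Theorem proposition9p4 (R : realType) (d : measure_display)
    (X : measurableType d) (mu : probability X R) (phi phiV : X -> X)
    (hphi : invertible_measure_preserving mu phi phiV)
    (T absT : operator (crossed_measure mu)) (a : X -> R[i])
    (hTM : crossed_product mu phi phiV T)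
    (hTinv : invertible_op T)
    (hpolar : polar_decomposition T (cp_U mu) absT)
    (hcentered : centered T)
    (ha : Linf mu a) (habsT : absT = cp_pi mu phi phiV a)
    (r lam : R) (hr : -1 <= r <= 1) (hr0 : r != 0) (hlam : 0 < lam < 1) :
  let H := fun_pow (cond_exp mu phi (fun_pow a r)) r^-1 in
  (fun n : nat =>
     norm2 mu phi phiV (iter n (aluthge (power_mean r lam)) T
                       \- (cp_U mu \o cp_pi mu phi phiV H)))
    @ \oo --> (0 : R).
Proof.
move=> H.
have [[pos _] TE _ _] := hpolar; rewrite habsT in pos TE.
have [_ [B [/bounded_opP[_ [L _ BL]] TK _]]] := hTinv.
(* [T] has a bounded inverse and [U] is isometric, so [|T|] is bounded below. *)
have low u : nsq u <= L * nsq (cp_pi mu phi phiV a u).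
  have := BL (T u); rewrite TK TE /= cp_UE.
  by rewrite (nsq_compop (int_shift_mp mu 1)).
have [b [c [K [mb c0 bcK ab]]]] := positive_invertible_symbol hphi ha pos low.
have bb : cbounded (fun x => (b x)%:C : R[i]).
  by apply: rbounded_cbounded; exact: itv_rbounded mb bcK.
have [h [bh mH Hh hcvg]] := mean_step_cvg hphi hr0 hlam c0 mb bcK ha ab.
rewrite -/H in mH Hh.
have nE n : norm2 mu phi phiV (iter n (aluthge (power_mean r lam)) T
    \- (cp_U mu \o cp_pi mu phi phiV H)) =
    Num.sqrt (Rintegral mu setT
      (fun x => (iter n (mean_step phiV r lam) b x - h x) ^+ 2)).
  (* The symbols [a] and [H] are replaced by the everywhere bounded [b] and [h], so that the
     difference of the operators is a weighted shift with a bounded symbol. *)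
  rewrite TE (cp_pi_ae hphi (proj1 ha) bb ab).
  rewrite (iter_aluthge hphi hr0 hlam c0 n mb bcK).
  rewrite (cp_pi_ae hphi mH (rbounded_cbounded bh) Hh).
  set bn := iter n _ b.
  have bbn : rbounded bn.
    apply: itv_rbounded (iter_mean_step_itv phiV hr0 hlam c0 n bcK).
    exact: (measurable_iter_mean_step hphi r lam n mb).
  have bd := rboundedB bbn bh.
  have -> : (cp_U mu \o cp_pi mu phi phiV (fun x => (bn x)%:C)) \-
      (cp_U mu \o cp_pi mu phi phiV (fun x => (h x)%:C)) =
      cp_U mu \o cp_pi mu phi phiV (fun x => (bn x - h x)%:C).
    apply/funext => u /=.
    rewrite cp_UE -(opB _ _ (compop_linear (int_shift_mp mu 1))) !cp_piE.
    have := rmulB u (rbounded_lift hphi bbn) (rbounded_lift hphi bh).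
    by move=> E; congr (compop _ _ _).
  rewrite (norm2_weighted_shift hphi (rbounded_cbounded bd)).
  by congr (Num.sqrt (Rintegral _ _ _)); apply/funext => x; rewrite sqmod_real.
under eq_fun do rewrite nE.
apply/cvgr0Pnorm_le => e e0.
have [N hN] := hcvg (e ^+ 2) (exprn_gt0 2 e0).
near=> n; rewrite ger0_norm ?sqrtr_ge0//.
rewrite -(ger0_norm (ltW e0)) -sqrtr_sqr ler_wsqrtr//; apply: hN.
by near: n; exists N.
Unshelve. all: by end_near. Qed.
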